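(* Let $q$ be a prime power and let $C$ be a non-trivial, reduced, linear completely regular code over $GF(q)$ with covering radius $\rho$ in $H(n,q)$ and ${\rm Spec}(C)=\{n(q-1),\,n(q-1)-qt,\,\dots,\,n(q-1)-q\rho t\}$ for some $t$. Let $\gamma_1=\gamma_1(C)$. Then one of the following holds: (a) $q=2$, $C\cong\mathrm{nullsp}[M|\cdots|M]$ ($\gamma_1$ copies), where $M=[I\,|\,\mathbf{1}]$ is a parity check matrix for a binary repetition code, and the quotient $H(n,q)/\Delta(C)$ is the folded cube; (b) $\rho=1$ and $C\cong\mathrm{nullsp}[H|\cdots|H]$ ($\gamma_1$ copies), where $H$ is a parity check matrix for some Hamming code; (c) $\rho=2$, $q=2$ and $C\cong\mathrm{nullsp}[E|\cdots|E]$ ($\gamma_1$ copies), where $E$ is a parity check matrix for a fixed extended Hamming code; (d) $\rho\ge2$, $q\ge2$ and $C\cong C_1\times\cdots\times C_1$ ($\rho$ factors), where $C_1$ is a completely regular code with covering radius $1$.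
   Context: $H(n,q)$ has vertex set $GF(q)^n$, two words adjacent iff they differ in exactly one coordinate. A linear code is a subspace $C\le GF(q)^n$; non-trivial means $|C|>1$ and $C\neq GF(q)^n$. For a code $C$, $C_i$ is the set of vertices at distance $i$ from $C$ and $\rho$ (covering radius) the largest $i$ with $C_i\neq\emptyset$; $C$ is completely regular if $\{C_0,\dots,C_\rho\}$ is equitable, with intersection numbers $\gamma_i,\alpha_i,\beta_i$ the numbers of neighbours of a vertex of $C_i$ in $C_{i-1},C_i,C_{i+1}$; ${\rm Spec}(C)$ is the set of eigenvalues of the tridiagonal matrix with diagonal $\alpha_0,\dots,\alpha_\rho$, superdiagonal $\beta_0,\dots,\beta_{\rho-1}$, subdiagonal $\gamma_1,\dots,\gamma_\rho$. $C$ is non-reduced if, after permuting coordinates, $C=C'\times GF(q)$ for some $C'$, and reduced otherwise. $\Delta(C)$ is the partition into cosets of $C$, and $H(n,q)/\Delta(C)$ is the graph on the cosets, two distinct cosets adjacent iff some edge joins them. $\mathrm{nullsp}$ denotes the null space; $[A|\cdots|A]$ is horizontal concatenation; $\mathbf{1}$ is the all-ones column. Hamming code: null space of a matrix whose columns are representatives of all one-dimensional subspaces of $GF(q)^r$; binary extended Hamming code: binary Hamming code with an overall parity bit appended. The folded cube is the $m$-cube with antipodal vertices identified. *)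

(* Defs.v *)
From HB Require Import structures.
From mathcomp Require Import all_boot all_order all_algebra all_field.
Set Implicit Arguments.
Unset Strict Implicit.
Unset Printing Implicit Defensive.
Import GRing.Theory.
Local Open Scope ring_scope.

Section Graphs.
Variable T : finType.

Definition equitable (e : rel T) (P : {set {set T}}) : Prop :=
  forall A B : {set T}, A \in P -> B \in P ->
  forall x y, x \in A -> y \in A ->
    #|[set z in B | e x z]| = #|[set z in B | e y z]|.

(* Adjacency of the quotient graph, whose vertices are the cells of a
   partition. *)
Definition quotient_adj (e : rel T) : rel {set T} :=
  fun A B => (A != B) && [exists x in A, exists y in B, e x y].

End Graphs.

(* A graph is a set of vertices V together with a relation, of which only the
   restriction to V matters. *)
Definition graph_iso (T T' : finType)
    (V : {set T}) (e : rel T) (V' : {set T'}) (e' : rel T') : Prop :=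
  exists f : T -> T',
    [/\ {in V &, injective f}, f @: V = V'
      & {in V &, forall x y, e' (f x) (f y) = e x y}].

Section Codes.
Variables (Q : finType) (n : nat).
Implicit Types (x y : 'rV[Q]_n) (C : {set 'rV[Q]_n}).

Definition hdist x y : nat := #|[set i | x 0 i != y 0 i]|.

Definition hamming_adj : rel 'rV[Q]_n := fun x y => hdist x y == 1%N.

(* The default value n only matters for the empty code. *)
Definition code_dist C x : nat := \big[minn/n]_(c in C) hdist x c.

Definition shell C (i : nat) : {set 'rV[Q]_n} := [set x | code_dist C x == i].

Definition covering_radius C : nat := \max_(x : 'rV[Q]_n) code_dist C x.

Definition completely_regular C : Prop :=
  equitable hamming_adj [set shell C i | i : 'I_(covering_radius C).+1].

(* Number of neighbours in shell j of some vertex of shell i; when the code is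
   completely regular it does not depend on the vertex picked. *)
Definition shell_nbrs C (i j : nat) : nat :=
  if [pick x in shell C i] is Some x
  then #|[set y in shell C j | hamming_adj x y]| else 0%N.

Definition gamma C i := shell_nbrs C i i.-1.
Definition alpha C i := shell_nbrs C i i.
Definition beta C i := shell_nbrs C i i.+1.

(* The entries are integers, so every complex eigenvalue lies in algC. *)
Definition intersection_mx C : 'M[algC]_((covering_radius C).+1) :=
  \matrix_(i, j)
    (if j == i :> nat then alpha C i
     else if j == i.+1 :> nat then beta C i
     else if i == j.+1 :> nat then gamma C i
     else 0%N)%:R.

Definition spec C : pred algC := eigenvalue (intersection_mx C).

Definition nontrivial C : Prop := (1 < #|C|)%N /\ C <> [set: 'rV[Q]_n].

End Codes.

(* The Hamming distance is the path distance of the Hamming graph. *)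
Lemma hdist_le_path (Q : finType) (n : nat) (x : 'rV[Q]_n) p :
  path (@hamming_adj Q n) x p -> (hdist x (last x p) <= size p)%N.
Proof.
elim: p x => [|y p IHp] x /=.
  by rewrite leqn0 cards_eq0 => _; apply/eqP/setP=> i; rewrite !inE eqxx.
case/andP=> /eqP xy /IHp yp.
apply: leq_trans (_ : hdist x y + hdist y (last y p) <= _)%N; last first.
  by rewrite xy add1n ltnS.
apply: leq_trans (leq_card_setU _ _); apply/subset_leq_card/subsetP=> i.
by rewrite !inE; case: (x 0 i =P y 0 i) => [->|].
Qed.

Lemma hdist_path (Q : finType) (n : nat) (x y : 'rV[Q]_n) :
  exists p, [/\ path (@hamming_adj Q n) x p, last x p = y
              & size p = hdist x y].
Proof.
move dE: (hdist x y) => d; elim: d x dE => [|d IHd] x dE.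
  exists [::]; split=> //=; apply/rowP=> i.
  move/eqP: dE; rewrite cards_eq0 => /eqP/setP/(_ i).
  by rewrite !inE => /negbFE/eqP.
have /card_gt0P[i] : (0 < #|[set i | x 0%R i != y 0%R i]|)%N.
  by rewrite -[#|_|]/(hdist x y) dE.
rewrite inE => xyi.
pose z : 'rV[Q]_n := \row_j if j == i then y 0 i else x 0 j.
have zy : hdist z y = d.
  apply: succn_inj; rewrite -dE /hdist (cardsD1 i [set i | x 0 i != y 0 i]).
  rewrite inE xyi add1n; congr _.+1; apply: eq_card => j; rewrite !inE mxE.
  by case: (j =P i) => [->|//]; rewrite eqxx.
have xz : hamming_adj x z.
  rewrite /hamming_adj /hdist; apply/cards1P; exists i.
  apply/setP=> j; rewrite !inE mxE.
  by case: (j =P i) => [->|]; rewrite ?xyi ?eqxx.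
have [p [pp lp sp]] := IHd z zy.
by exists (z :: p); split=> //=; [rewrite xz | rewrite sp].
Qed.

Definition antipode (m : nat) (x : 'rV[bool]_m) : 'rV[bool]_m := map_mx negb x.

Definition antipodal_pairs (m : nat) : {set {set 'rV[bool]_m}} :=
  [set [set x; antipode x] | x : 'rV[bool]_m].

Definition folded_cube_adj (m : nat) : rel {set 'rV[bool]_m} :=
  quotient_adj (@hamming_adj bool m).

Definition code_prod (Q : finType) (m1 m2 : nat)
    (C1 : {set 'rV[Q]_m1}) (C2 : {set 'rV[Q]_m2}) : {set 'rV[Q]_(m1 + m2)} :=
  [set x | (lsubmx x \in C1) && (rsubmx x \in C2)].

Definition code_power (Q : finType) (k m : nat) (C : {set 'rV[Q]_m}) :
    {set 'rV[Q]_(\sum_(j < k) m)} :=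
  [set x | [forall j : 'I_k, submxrow x j \in C]].

(* Equality after permuting coordinates; the two lengths are equal because s is
   a bijection. *)
Definition perm_equiv (Q : finType) (n m : nat)
    (C : {set 'rV[Q]_n}) (D : {set 'rV[Q]_m}) : Prop :=
  exists2 s : 'I_n -> 'I_m, bijective s &
      C = [set \row_i y 0 (s i) | y : 'rV[Q]_m in D].

Definition reduced (Q : finType) (n : nat) (C : {set 'rV[Q]_n}) : Prop :=
  ~ exists (m : nat) (C' : {set 'rV[Q]_m}),
      perm_equiv C (code_prod C' [set: 'rV[Q]_1]).

Section LinearCodes.
Variable F : finFieldType.

Definition linear_code (n : nat) (C : {set 'rV[F]_n}) : Prop := submod_closed C.

(* Equivalence of codes over F: a permutation of the coordinates followed by
   the scaling of each coordinate by a nonzero scalar. *)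
Definition code_equiv (n m : nat)
    (C : {set 'rV[F]_n}) (D : {set 'rV[F]_m}) : Prop :=
  exists (s : 'I_n -> 'I_m) (a : 'I_n -> F),
    [/\ bijective s, forall i, a i != 0
      & C = [set \row_i (a i * y 0 (s i)) | y : 'rV[F]_m in D]].

Definition cosets (n : nat) (C : {set 'rV[F]_n}) : {set {set 'rV[F]_n}} :=
  [set [set x + c | c in C] | x : 'rV[F]_n].

Definition coset_adj (n : nat) : rel {set 'rV[F]_n} :=
  quotient_adj (@hamming_adj F n).

Definition nullsp (r n : nat) (A : 'M[F]_(r, n)) : {set 'rV[F]_n} :=
  [set x : 'rV[F]_n | A *m x^T == 0].

Definition parity_check (r n : nat) (A : 'M[F]_(r, n)) (C : {set 'rV[F]_n}) :
    Prop := C = nullsp A.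

Definition hcopies (k r m : nat) (A : 'M[F]_(r, m)) :
    'M[F]_(r, \sum_(j < k) m) := \mxrow_(j < k) A.

Definition repetition_mx (r : nat) : 'M[F]_(r, r + 1) :=
  row_mx 1%:M (const_mx 1).

Definition hamming_mx (r m : nat) (H : 'M[F]_(r, m)) : Prop :=
  (forall j, col j H != 0) /\
  (forall U : {vspace 'cV[F]_r}, \dim U = 1%N ->
     exists! j, U = <[col j H]>%VS).

(* r = 1 is allowed: it gives the zero code of length 1. *)
Definition hamming_code (m : nat) (D : {set 'rV[F]_m}) : Prop :=
  exists (r : nat) (H : 'M[F]_(r, m)),
    [/\ (0 < r)%N, hamming_mx H & D = nullsp H].

Definition parity_extension (m : nat) (D : {set 'rV[F]_m}) :
    {set 'rV[F]_(m + 1)} :=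
  [set row_mx x (const_mx (\sum_i x 0 i)) | x : 'rV[F]_m in D].

End LinearCodes.

(* Main.v *)
Require Import Defs.
From HB Require Import structures.
From mathcomp Require Import all_boot all_order all_algebra all_field.
From mathcomp Require Import all_fingroup all_character.
From mathcomp Require Import ring zify.
Set Implicit Arguments.
Unset Strict Implicit.
Unset Printing Implicit Defensive.
Import GRing.Theory Num.Theory.
Local Open Scope ring_scope.

(* Let W be the dual code. Fourier analysis with a nontrivial additive character
   of F turns functions of the distance to C into functions supported on W that
   depend only on the weight, and complete regularity makes this a bijection;
   hence such functions on W are closed under convolution. The spectrum says that
   the weights occurring in W are exactly 0, t, ..., rho t. Consequently the set T
   of words of weight t spans W, and the number of ways to write a word of W as a
   sum of two words of T depends only on its weight.

   Two non-proportional words of T whose supports meet share t (q - 1) / q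
   coordinates. If meeting is transitive on T (always so when q > 2), W splits
   into constant-weight summands with disjoint supports, which gives (b) or (d).
   Otherwise q = 2, and any two disjoint words of T are linked by a third one
   inside their union. Take a maximal family of disjoint blocks of size t / 2 all
   of whose pairwise unions lie in T: either a word of T cuts each of four blocks
   in half, and W is a first-order Reed-Muller code repeated, case (c), or T
   consists of the pairwise unions of blocks, and W is an even-weight code
   repeated, case (a).

   A code is recovered from the weights of its dual by Fourier inversion: they
   determine how often each projective point occurs among the columns of a parity
   check matrix, hence the code up to equivalence. *)

(** * Characters and Fourier transform *)

(** What makes T rigid is that every weight in W is a multiple of t: two words of T with a common
    coordinate have a sum of weight below 2 t, so this sum is 0 or again in T. Thus a pencil a + l b
    of meeting, non-proportional words has constant weight t, and averaging over l produces the
    fraction (q - 1) / q.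

    Reducedness enters through a single fact: no unit vector lies in C, so all nonzero multiples of
    unit vectors are at distance 1 from C. Hence T misses no coordinate. The same fact explains the
    number of copies: the codeword neighbours of a vector with nonzero syndrome x correspond to the
    columns of a parity check matrix proportional to x, so a projective point that occurs among the
    columns occurs exactly gamma_1 times.

    In case (d) the factor C_1 is not extracted from C directly. Its parity check matrix is a
    constant-weight summand of W cut down to its support, and only weights are compared
    afterwards. *)

Lemma exists_additive_character (F : finFieldType) :
  exists chi : F -> algC,
    [/\ chi 0 = 1, forall a b, chi (a + b) = chi a * chi b
      & exists a, chi a != 1].
Proof.
pose G := [set: F]%G.
have abG : abelian G.
  by apply/centsP=> x _ y _; rewrite /commute; apply: addrC.
(* The irreducible characters have trivial common kernel, so 1 is outside the kernel of one of them;
   that character is linear because the additive group is abelian. *)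
have [i ni] : exists i : Iirr G, (1 : F) \notin cfker 'chi[G]_i.
  apply/existsP; rewrite -negb_forall; apply/negP=> /forallP h.
  have : (1 : F) \in \bigcap_(i : Iirr G) cfker 'chi[G]_i.
    by apply/bigcapP=> i _.
  rewrite (TI_cfker_irr G) => /set1P /= h1.
  by have := oner_neq0 F; rewrite h1 eqxx.
have lin : 'chi[G]_i \is a linear_char by apply/char_abelianP.
exists 'chi[G]_i; split; first exact: lin_char1 lin.
  by move=> a b; apply: (lin_charM lin); rewrite inE.
exists 1; apply: contra ni => /eqP h1.
by rewrite cfkerEchar ?irr_char // !inE h1 lin_char1 // eqxx.
Qed.

Definition dot (F : finFieldType) (n : nat) (u x : 'rV[F]_n) : F :=
  \sum_i u 0 i * x 0 i.

Definition weight (F : finFieldType) (n : nat) (u : 'rV[F]_n) : nat :=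
  #|[set i | u 0 i != 0]|.

Section Dot.
Variables (F : finFieldType) (n : nat).
Implicit Types (u v x : 'rV[F]_n).

Lemma dotC u x : dot u x = dot x u.
Proof. by apply: eq_bigr => i _; rewrite mulrC. Qed.

Lemma dotDl u v x : dot (u + v) x = dot u x + dot v x.
Proof. by rewrite -big_split; apply: eq_bigr => i _; rewrite mxE mulrDl. Qed.

Lemma dotZl a u x : dot (a *: u) x = a * dot u x.
Proof. by rewrite /dot big_distrr /=; apply: eq_bigr => i _; rewrite mxE mulrA. Qed.

Lemma dotNl u x : dot (- u) x = - dot u x.
Proof. by rewrite -scaleN1r dotZl mulN1r. Qed.

Lemma dot0l x : dot 0 x = 0.
Proof. by rewrite -[0](scale0r (0 : 'rV[F]_n)) dotZl mul0r. Qed.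

Lemma dotDr u x y : dot u (x + y) = dot u x + dot u y.
Proof. by rewrite dotC dotDl !(dotC u). Qed.

Lemma dotZr a u x : dot u (a *: x) = a * dot u x.
Proof. by rewrite dotC dotZl dotC. Qed.

Lemma dotNr u x : dot u (- x) = - dot u x.
Proof. by rewrite dotC dotNl dotC. Qed.

Lemma dot0r x : dot x 0 = 0.
Proof. by rewrite dotC dot0l. Qed.

Lemma dot_delta u i : dot u (delta_mx 0 i) = u 0 i.
Proof.
rewrite /dot (bigD1 i) //= mxE !eqxx mulr1 big1 ?addr0 // => j ji.
by rewrite mxE eqxx (negbTE ji) mulr0.
Qed.

Lemma weight0 : weight (0 : 'rV[F]_n) = 0%N.
Proof. by apply: eq_card0 => i; rewrite !inE mxE eqxx. Qed.

Lemma weight_eq0 u : (weight u == 0%N) = (u == 0).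
Proof.
apply/idP/eqP => [|->]; last by rewrite weight0.
rewrite cards_eq0 => /eqP/setP u0; apply/rowP=> i.
by have := u0 i; rewrite !inE mxE => /negbFE/eqP.
Qed.

Lemma weightZ a u : a != 0 -> weight (a *: u) = weight u.
Proof.
by move=> a0; apply: eq_card => i; rewrite !inE mxE mulf_eq0 (negbTE a0).
Qed.

Lemma weightN u : weight (- u) = weight u.
Proof. by rewrite -scaleN1r weightZ // oppr_eq0 oner_eq0. Qed.

Lemma weightD u v : (weight (u + v) <= weight u + weight v)%N.
Proof.
apply: leq_trans (leq_card_setU _ _); apply/subset_leq_card/subsetP=> i.
by rewrite !inE mxE; have [->|] := eqVneq (u 0 i) 0; rewrite ?add0r.
Qed.

Lemma weight_sum u : weight u = (\sum_i (u 0%R i != 0%R))%N.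
Proof. by rewrite /weight -sum1_card big_mkcond; apply: eq_bigr => i _;
  rewrite inE; case: eqP. Qed.

Lemma hdistE x y : hdist x y = weight (x - y).
Proof. by apply: eq_card => i; rewrite !inE !mxE subr_eq0. Qed.

Lemma hdistC x y : hdist x y = hdist y x.
Proof. by rewrite !hdistE -opprB weightN. Qed.

Lemma hamming_adjC x y : hamming_adj x y = hamming_adj y x.
Proof. by rewrite /hamming_adj hdistC. Qed.

Lemma weight1P u :
  reflect (exists i a, a != 0 /\ u = a *: delta_mx 0 i) (weight u == 1%N).
Proof.
apply: (iffP cards1P) => [[i /setP hi]|[i [a [a0 ->]]]].
  exists i, (u 0 i); split; first by have := hi i; rewrite !inE eqxx.
  apply/rowP=> j; rewrite !mxE eqxx /=.
  have [->|ji] := eqVneq j i; rewrite ?mulr1 //.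
  by have := hi j; rewrite !inE (negbTE ji) mulr0 => /negbFE/eqP->.
exists i; apply/setP=> j; rewrite !inE !mxE eqxx /=.
by case: (eqVneq j i) => _; rewrite ?mulr1 ?mulr0 ?eqxx ?a0.
Qed.

End Dot.


Section Fourier.
Variables (F : finFieldType) (chi : F -> algC).
Hypothesis chi0 : chi 0 = 1.
Hypothesis chiD : forall a b, chi (a + b) = chi a * chi b.
Hypothesis chi_nontrivial : exists a, chi a != 1.

(** For [b != 0], translating the variable by [c / b] multiplies the sum by [chi c], which differs
    from 1. *)
Lemma character_sum_mul b : \sum_a chi (a * b) = (#|F| * (b == 0))%:R.
Proof.
have [->|b0] := eqVneq b 0.
  rewrite muln1 (eq_bigr (fun=> 1)) ?sumr_const // => a _.
  by rewrite mulr0 chi0.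
rewrite muln0; have [c c1] := chi_nontrivial.
set S := (X in X = _); have h : chi c * S = S.
  rewrite /S big_distrr /= [RHS](reindex_inj (addrI (c / b))) /=.
  by apply: eq_bigr => a _; rewrite mulrDl mulfVK // chiD.
have : (chi c - 1) * S = 0 by rewrite mulrBl h mul1r subrr.
by move/eqP; rewrite mulf_eq0 subr_eq0 (negbTE c1) => /eqP.
Qed.

Lemma character_sum_rV n (x : 'rV[F]_n) :
  \sum_(u : 'rV[F]_n) chi (dot u x) = (#|F| ^ n * (x == 0))%:R.
Proof.
have [->|x0] := eqVneq x 0.
  rewrite muln1 (eq_bigr (fun=> 1)) ?sumr_const ?card_mx ?mul1n //.
  by move=> a _; rewrite dot0r chi0.
rewrite muln0; have [c c1] := chi_nontrivial.
have [i xi] : exists i, x 0 i != 0.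
  by apply/rV0Pn.
pose v := (c / x 0 i) *: delta_mx 0 i : 'rV[F]_n.
have dv : dot v x = c by rewrite dotZl dotC dot_delta mulfVK.
set S := (X in X = _); have h : chi c * S = S.
  rewrite /S big_distrr /= [RHS](reindex_inj (addrI v)) /=.
  by apply: eq_bigr => a _; rewrite dotDl dv chiD.
have : (chi c - 1) * S = 0 by rewrite mulrBl h mul1r subrr.
by move/eqP; rewrite mulf_eq0 subr_eq0 (negbTE c1) => /eqP.
Qed.

Definition fourier n (g : 'rV[F]_n -> algC) (u : 'rV[F]_n) : algC :=
  \sum_x g x * chi (dot u x).

Lemma fourier_inversion n (g : 'rV[F]_n -> algC) x :
  fourier (fourier g) x = (#|F| ^ n)%:R * g (- x).
Proof.
rewrite /fourier (eq_bigr (fun u => \sum_y g y * chi (dot u (x + y)))).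
  rewrite exchange_big /= (bigD1 (- x)) //= -big_distrr /= character_sum_rV.
  rewrite subrr eqxx muln1 mulrC big1 ?addr0 // => y yx.
  rewrite -big_distrr /= character_sum_rV addrC addr_eq0 (negbTE yx).
  by rewrite muln0 mulr0.
move=> u _; rewrite big_distrl /=; apply: eq_bigr => y _.
by rewrite dotDr addrC chiD mulrA [dot x u]dotC.
Qed.

Lemma fourier_inj0 n (g : 'rV[F]_n -> algC) :
  (forall u, fourier g u = 0) -> forall x, g x = 0.
Proof.
move=> h x; have := fourier_inversion g (- x).
rewrite opprK [LHS]big1 => [/esym/eqP|u _]; last by rewrite h mul0r.
rewrite mulf_eq0 pnatr_eq0 expn_eq0 => /orP[/andP[/eqP c0 _]|/eqP //].
by have := fintype0 (0 : F) c0.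
Qed.

(** Convolution theorem, in the direction needed below: functions of the distance to C are closed
    under products, hence their transforms under convolution. *)
Lemma fourierM n (g1 g2 : 'rV[F]_n -> algC) u :
  \sum_v fourier g1 v * fourier g2 (u - v)
    = (#|F| ^ n)%:R * fourier (fun x => g1 x * g2 x) u.
Proof.
rewrite (eq_bigr (fun v => \sum_x \sum_y
    g1 x * (g2 y * chi (dot u y)) * chi (dot v (x - y)))); last first.
  move=> v _; rewrite big_distrl /=; apply: eq_bigr => x _.
  rewrite big_distrr /=; apply: eq_bigr => y _.
  rewrite dotDl dotDr dotNl dotNr !chiD; ring.
rewrite exchange_big big_distrr /=; apply: eq_bigr => x _.
rewrite exchange_big (bigD1 x) //= [X in _ + X]big1 ?addr0 => [|y yx].

  by rewrite -big_distrr /= character_sum_rV subrr eqxx muln1; ring.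
rewrite -big_distrr /= character_sum_rV subr_eq0 eq_sym (negbTE yx).
by rewrite muln0 mulr0.
Qed.

(* The left-hand side is the eigenvalue of the Hamming graph at u. *)
Lemma character_sum_weight1 n (u : 'rV[F]_n) :
  \sum_(z : 'rV[F]_n | weight z == 1%N) chi (dot u z)
    = (n * #|F|.-1)%:R - (#|F| * weight u)%:R.
Proof.
pose h (p : 'I_n * F) : 'rV[F]_n := p.2 *: delta_mx 0 p.1.
have q0 : (0 < #|F|)%N by apply/card_gt0P; exists 0.
have hinj : {in [pred p | p.2 != 0] &, injective h}.
  move=> [i a] [j b]; rewrite !inE /= => a0 b0 /rowP /[dup] /(_ i).
  rewrite !mxE !eqxx /= mulr1; have [-> ->|_] := eqVneq i j; first by rewrite mulr1.
  by rewrite mulr0 => a00; rewrite a00 eqxx in a0.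
transitivity (\sum_(z in [set h p | p in [pred p | p.2 != 0]]) chi (dot u z)).
  apply: eq_bigl => z; apply/weight1P/imsetP => [[i [a [a0 ->]]]|[[i a]]].
    by exists (i, a).
  by rewrite inE /= => a0 ->; exists i, a.
rewrite big_imset //=.
rewrite -(pair_big xpredT (fun a : F => a != 0) (fun i a =>
  chi (dot u (h (i, a))))) /=.
have e i : \sum_(a | a != 0) chi (dot u (h (i, a)))
   = #|F|.-1%:R - (#|F| * (u 0 i != 0))%:R.
  have := character_sum_mul (u 0 i); rewrite (bigD1 0) //= mul0r chi0.
  rewrite (eq_bigr (fun a => chi (dot u (h (i, a))))); last first.
    by move=> a _; rewrite /h /= dotZr dot_delta.
  move/esym/eqP; rewrite addrC -subr_eq => /eqP <-.
  have -> : #|F|.-1%:R = #|F|%:R - 1 :> algC by rewrite -subn1 natrB.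
  by case: eqP => _; rewrite ?muln0 ?muln1 /= ; ring.
rewrite (eq_bigr _ (fun i _ => e i)) sumrB sumr_const card_ord -mulrnA mulnC.
by rewrite -natr_sum weight_sum big_distrr.
Qed.

End Fourier.

(** * Column multiplicities *)

(** Equal fibre sizes make the two lists of values permutations of each other, and a permutation
    between the lists is the bijection sought. *)
Lemma exists_fibre_bijection (T : eqType) (n m : nat)
    (f : 'I_n -> T) (g : 'I_m -> T) :
  (forall y, #|[set i | f i == y]| = #|[set j | g j == y]|) ->
  exists2 s : 'I_n -> 'I_m, bijective s & forall i, g (s i) = f i.
Proof.
have count_codom k (h : 'I_k -> T) y :
    count_mem y (codom h) = #|[set i | h i == y]|.
  rewrite -sum1_count -sum1_card big_image_cond /=.
  by apply: eq_bigl => i; rewrite inE.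
move=> fg; have pfg : perm_eq (codom f) (codom g).
  by apply/allP=> y _ /=; rewrite !count_codom fg.
have enm : n = m by have := perm_size pfg; rewrite !size_codom !card_ord.
case: _ / enm g {fg} pfg => g.
have -> : codom g = [tuple g i | i < n] by [].
case/tuple_permP=> p hp; exists p => [|i]; first by exists (p^-1)%g;
  [apply: permK|apply: permKV].
have := congr1 (fun s => nth (f i) s i) hp.
rewrite /codom /image_mem /= (nth_map i) ?size_enum_ord // nth_ord_enum => ->.
by rewrite (nth_map i) ?size_enum_ord // nth_ord_enum tnth_map tnth_ord_tuple.
Qed.

Lemma sum_concat_ord (k m : nat) (f : 'I_k -> 'I_m -> nat) :
  (\sum_(s < \sum_(j < k) m) f (tagnat.sig1 s) (tagnat.sig2 s)
    = \sum_(j < k) \sum_(i < m) f j i)%N.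
Proof. by rewrite sig_big_dep /= [RHS](reindex _ tagnat.sig_bij_on). Qed.

Section Multiplicity.
Variable F : finFieldType.

(** For [x != 0], the number of columns representing the projective point of [x]; zero columns are
    never counted. Columns are handled as rows of the transpose, so that [dot] applies to them. *)
Definition multiplicity (r n : nat) (A : 'M[F]_(r, n)) (x : 'rV[F]_r) : nat :=
  #|[set i | [exists a, a *: row i A^T == x]]|.

Lemma multiplicity_sum r n (A : 'M[F]_(r, n)) x :
  multiplicity A x = (\sum_i [exists a, a *: row i A^T == x])%N.
Proof.
rewrite /multiplicity -sum1_card big_mkcond; apply: eq_bigr => i _.
by rewrite inE; case: ifP.
Qed.

Lemma weight_mxrow (k m : nat) (v : 'rV[F]_(\sum_(j < k) m)) :
  weight v = (\sum_j weight (submxrow v j))%N.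
Proof.
rewrite -{1}[v]submxrowK weight_sum.
under eq_bigr => s _ do rewrite mxE.
rewrite (sum_concat_ord (fun j i => nat_of_bool (submxrow v j 0 i != 0))).
by apply: eq_bigr => j _; rewrite weight_sum.
Qed.

Lemma multiplicity_hcopies k r m (B : 'M[F]_(r, m)) x :
  multiplicity (hcopies k B) x = (k * multiplicity B x)%N.
Proof.
have e s : row s (hcopies k B)^T = row (tagnat.sig2 s) B^T.
  by apply/rowP=> i; rewrite !mxE.
rewrite multiplicity_sum; under eq_bigr => s _ do rewrite e.
rewrite (sum_concat_ord (fun j i => nat_of_bool [exists a, a *: row i B^T == x])).
by rewrite sum_nat_const card_ord multiplicity_sum.
Qed.

Lemma nullspE r n (A : 'M[F]_(r, n)) x : (x \in nullsp A) = (x *m A^T == 0).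
Proof. by rewrite inE -trmx_eq0 trmx_mul trmxK. Qed.

Lemma mulmx_tr_dot r n (A : 'M[F]_(r, n)) (u : 'rV_r) i :
  (u *m A) 0 i = dot u (row i A^T).
Proof. by rewrite mxE; apply: eq_bigr => k _; rewrite !mxE. Qed.

(** The weight of [u *m A] is n minus the number of columns orthogonal to [u]. Fourier inversion in
    [u] of this function isolates the columns proportional to [x]. *)
Lemma multiplicityE (chi : F -> algC) : chi 0 = 1 ->
  (forall a b, chi (a + b) = chi a * chi b) -> (exists a, chi a != 1) ->
  forall r n (A : 'M[F]_(r, n)) x, x != 0 ->
  (#|F| ^ r * multiplicity A x)%:R
    = - #|F|%:R * \sum_u chi (- dot u x) * (weight (u *m A))%:R.
Proof.
move=> chi0 chiD chi1 r n A x x0.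
(* Double count: summing over [u] first detects [a] times column i equal to [x]; summing over [a]
   first detects columns orthogonal to [u]. *)
pose S := \sum_(u : 'rV[F]_r) \sum_i \sum_a chi (dot u (a *: row i A^T - x)).
transitivity S.
  rewrite /S exchange_big multiplicity_sum big_distrr natr_sum /=.
  apply: eq_bigr => i _; rewrite exchange_big /=.
  under eq_bigr => a _ do rewrite (character_sum_rV chi0 chiD chi1) subr_eq0.
  have [/existsP[a /eqP ax]|] := boolP [exists a, a *: row i A^T == x].
    move: x0; rewrite -ax => x0.
    rewrite muln1 (bigD1 a) //= eqxx muln1 big1 ?addr0 // => b ba.
    suff /negbTE-> : b *: row i A^T != a *: row i A^T by rewrite muln0.
    apply: contra ba; rewrite -subr_eq0 -scalerBl scaler_eq0 subr_eq0.
    by case/orP=> // /eqP r0; rewrite r0 scaler0 eqxx in x0.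
  rewrite negb_exists muln0 => /forallP h.
  by rewrite big1 // => a _; rewrite (negbTE (h a)) muln0.
rewrite /S (eq_bigr (fun u => n%:R * #|F|%:R * chi (dot u (- x))
   - #|F|%:R * (chi (- dot u x) * (weight (u *m A))%:R))).
  rewrite sumrB -!big_distrr /= (character_sum_rV chi0 chiD chi1) oppr_eq0.
  by rewrite (negbTE x0) muln0 mulr0 sub0r mulNr.
move=> u _.
transitivity (\sum_i chi (- dot u x) * (#|F|%:R * (1 - ((u *m A) 0 i != 0)%:R))).
  apply: eq_bigr => i _.
  under eq_bigr => a _ do rewrite dotDr dotZr dotNr chiD mulrC.
  rewrite -big_distrr /= (character_sum_mul chi0 chiD chi1) natrM -mulmx_tr_dot.
  by case: eqP => _ /=; rewrite ?subr0 ?subrr.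
rewrite -!big_distrr /= sumrB sumr_const card_ord -natr_sum -weight_sum dotNr.
by ring.
Qed.

(** Multiplicities depend linearly on the weight function. The two factors allow weights in a fixed
    ratio to be compared without division. *)
Lemma multiplicity_proportional r n m (A : 'M[F]_(r, n)) (B : 'M[F]_(r, m)) c d :
  (forall u : 'rV_r, c * weight (u *m A) = d * weight (u *m B))%N ->
  forall x, x != 0 -> (c * multiplicity A x = d * multiplicity B x)%N.
Proof.
move=> h x x0; have [chi [chi0 chiD chi1]] := exists_additive_character F.
have q0 : (0 < #|F| ^ r)%N by rewrite expn_gt0; apply/orP; left; apply/card_gt0P;
  exists 0.
apply/eqP; rewrite -(eqn_pmul2l q0) -(eqr_nat algC) !(mulnCA (#|F| ^ r)%N).
rewrite natrM (natrM _ d) !(multiplicityE chi0 chiD chi1) // !(mulrCA _ (- _)).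
apply/eqP; congr (_ * _); rewrite !big_distrr /=; apply: eq_bigr => u _.
by rewrite !(mulrCA _ (chi _)) -!natrM h.
Qed.

(** Only [u = 0] deviates from the constant t, and the characters of the nonzero [u] sum to -1. *)
Lemma multiplicity_constant_weight r n (A : 'M[F]_(r, n)) t :
  (forall u : 'rV_r, u != 0 -> weight (u *m A) = t) ->
  forall x, x != 0 -> (#|F| ^ r * multiplicity A x = #|F| * t)%N.
Proof.
move=> h x x0; have [chi [chi0 chiD chi1]] := exists_additive_character F.
apply/eqP; rewrite -(eqr_nat algC) (multiplicityE chi0 chiD chi1) //.
rewrite (bigD1 0) //= mul0mx weight0 mulr0 add0r.
rewrite (eq_bigr (fun u => chi (dot u (- x)) * t%:R)); last first.
  by move=> u u0; rewrite h // dotNr.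
rewrite -big_distrl /=; have := character_sum_rV chi0 chiD chi1 (- x).
rewrite oppr_eq0 (negbTE x0) muln0 (bigD1 0) //= dot0l chi0 => /eqP.
rewrite addr_eq0 -eqr_oppLR => /eqP <-.
by rewrite mulN1r mulrNN natrM.
Qed.

(** A canonical name for the projective point of [x]: the predicate given to [pick] is the same for
    all nonzero multiples of [x]. It holds at [x] itself, so the default is never reached. *)
Definition line_rep (r : nat) (x : 'rV[F]_r) : 'rV[F]_r :=
  odflt 0 [pick y | [exists a, (a != 0) && (a *: x == y)]].

Lemma line_repP r (x : 'rV[F]_r) : exists2 a, a != 0 & line_rep x = a *: x.
Proof.
rewrite /line_rep; case: pickP => [y /existsP[a /andP[a0 /eqP <-]]|/(_ x)].
  by exists a.
by move/existsP; case; exists 1; rewrite oner_eq0 scale1r eqxx.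
Qed.

Lemma line_repZ r a (x : 'rV[F]_r) : a != 0 -> line_rep (a *: x) = line_rep x.
Proof.
move=> a0; rewrite /line_rep; congr odflt; apply: eq_pick => y.
apply/existsP/existsP => -[b /andP[b0 /eqP <-]].
  by exists (b * a); rewrite mulf_neq0 //= scalerA.
by exists (b / a); rewrite mulf_neq0 ?invr_eq0 //= scalerA mulfVK.
Qed.

(** Label each column by its projective point. Equal multiplicities give a bijection preserving
    labels, and columns with the same label differ by a nonzero scalar. *)
Lemma code_equiv_of_multiplicity r n m (A : 'M[F]_(r, n)) (B : 'M[F]_(r, m)) :
  (forall i, row i A^T != 0) -> (forall j, row j B^T != 0) ->
  (forall x, x != 0 -> multiplicity A x = multiplicity B x) ->
  code_equiv (nullsp A) (nullsp B).
Proof.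
move=> A0 B0 AB.
(* A label that is zero or not canonical has an empty fibre, so multiplicities at nonzero points
   control all fibres. *)
have fibre k (M : 'M[F]_(r, k)) y : (forall i, row i M^T != 0) ->
    #|[set i | line_rep (row i M^T) == y]|
      = if (y != 0) && (line_rep y == y) then multiplicity M y else 0%N.
  move=> M0; case: ifP => [/andP[y0 /eqP ry]|/negP yN].
    apply: eq_card => i; rewrite !inE; apply/eqP/existsP => [<-|[a /eqP ay]].
      by have [a _ ->] := line_repP (row i M^T); exists a.
    rewrite -ry -ay line_repZ //; apply: contra y0 => /eqP a0.
    by rewrite -ay a0 scale0r.
  apply: eq_card0 => i; rewrite !inE; apply/eqP=> iy; apply: yN.
  have [a a0 e] := line_repP (row i M^T).
  have rr : line_rep (line_rep (row i M^T)) = line_rep (row i M^T)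
    by rewrite [in LHS]e line_repZ.
  by rewrite -iy rr eqxx andbT e scaler_eq0 negb_or a0 M0.
have [s bs hs] : exists2 s : 'I_n -> 'I_m, bijective s
    & forall i, line_rep (row (s i) B^T) = line_rep (row i A^T).
  apply: (exists_fibre_bijection (f := fun i =>
    line_rep (row i A^T)) (g := fun i => line_rep (row i B^T))) => y;
      rewrite !fibre //.
  by case: ifP => // /andP[y0 _]; rewrite AB.
have sc i : exists a, (a != 0) && (a *: row i A^T == row (s i) B^T).
  have [a a0 ea] := line_repP (row i A^T);
    have [b b0 eb] := line_repP (row (s i) B^T).
  exists (b^-1 * a); rewrite mulf_neq0 ?invr_eq0 //= -scalerA -ea -hs eb.
  by rewrite scalerA mulVf // scale1r.
pose a i := xchoose (sc i).
have a0 i : a i != 0 by have /andP[] := xchooseP (sc i).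
have ea i : row (s i) B^T = a i *: row i A^T.
  by have /andP[_ /eqP->] := xchooseP (sc i).
have key (y : 'rV[F]_m) : (\row_i (a i * y 0 (s i))) *m A^T = y *m B^T.
  rewrite !mulmx_sum_row [RHS](reindex s) /=; last exact: onW_bij.
  by apply: eq_bigr => i _; rewrite ea mxE scalerA mulrC.
exists s, a; split=> //; apply/setP=> x; rewrite nullspE.
apply/idP/imsetP => [xA|[y]]; last by rewrite nullspE -key => yB ->.
case: (bs) => s' s's ss'.
exists (\row_j (x 0 (s' j) / a (s' j))).
  rewrite nullspE -key; congr (_ *m _ == 0): xA.
  by apply/rowP=> i; rewrite !mxE s's mulrC mulfVK.
by apply/rowP=> i; rewrite !mxE s's mulrC mulfVK.
Qed.

End Multiplicity.

(** * Radial functions of a completely regular code *)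

Section CodeDistance.
Variables (F : finFieldType) (n : nat) (C : {set 'rV[F]_n}).
Hypothesis C_linear : linear_code C.
Implicit Types (x y c u v : 'rV[F]_n).

Lemma code0 : 0 \in C. Proof. by case: C_linear. Qed.

Lemma codeZD a x y : x \in C -> y \in C -> a *: x + y \in C.
Proof. by case: C_linear => _; apply. Qed.

Lemma codeD x y : x \in C -> y \in C -> x + y \in C.
Proof. by move=> xC yC; rewrite -[x]scale1r codeZD. Qed.

Lemma codeZ a x : x \in C -> a *: x \in C.
Proof. by move=> xC; rewrite -[_ *: _]addr0 codeZD // code0. Qed.

Lemma codeN x : x \in C -> - x \in C.
Proof. by rewrite -scaleN1r => /codeZ; apply. Qed.

Lemma codeB x y : x \in C -> y \in C -> x - y \in C.
Proof. by move=> xC /codeN; apply: codeD. Qed.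

Lemma hdist_triangle x y z : (hdist x z <= hdist x y + hdist y z)%N.
Proof. by rewrite !hdistE -[x - z](subrKA y) weightD. Qed.

Lemma hdist_le_length x y : (hdist x y <= n)%N.
Proof. by rewrite -{2}[n]card_ord max_card. Qed.

Lemma code_dist_le x c : c \in C -> (code_dist C x <= hdist x c)%N.
Proof.
move=> cC; rewrite /code_dist; have := mem_index_enum c.
elim: (index_enum _) => // b s IHs; rewrite inE big_cons.
have [<- _|_ /= /IHs le] := eqVneq c b; first by rewrite cC geq_minl.
by case: ifP => // _; rewrite geq_min le orbT.
Qed.

Lemma code_dist_attained x : exists2 c, c \in C & code_dist C x = hdist x c.
Proof.
case: (@arg_minnP _ 0 [in C] (hdist x) code0) => c cC cmin; exists c => //.
apply/eqP; rewrite eqn_leq code_dist_le //=; rewrite /code_dist.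
elim/big_rec: _ => [|c' v /cmin le cv]; first exact: hdist_le_length.
by rewrite leq_min le.
Qed.

Lemma code_dist_eq0 x : (code_dist C x == 0%N) = (x \in C).
Proof.
apply/idP/idP => [|xC].
  have [c cC ->] := code_dist_attained x.
  by rewrite hdistE weight_eq0 subr_eq0 => /eqP->.
by rewrite -leqn0 (leq_trans (code_dist_le x xC)) // hdistE subrr weight0.
Qed.

Lemma code_dist_triangle x y : (code_dist C x <= hdist x y + code_dist C y)%N.
Proof.
have [c cC ->] := code_dist_attained y.
exact: leq_trans (code_dist_le x cC) (hdist_triangle _ _ _).
Qed.

Lemma code_dist_adj x y : hamming_adj x y ->
  (code_dist C x <= (code_dist C y).+1)%N.
Proof. by move/eqP=> xy; have := code_dist_triangle x y; rewrite xy. Qed.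

Lemma code_distD x c : c \in C -> code_dist C (x + c) = code_dist C x.
Proof.
have le z d : d \in C -> (code_dist C (z + d) <= code_dist C z)%N.
  move=> dC; have [c' c'C ->] := code_dist_attained z.
  apply: leq_trans (code_dist_le _ (codeD c'C dC)) _.
  by rewrite !hdistE opprD addrACA subrr addr0.
move=> cC; apply/eqP; rewrite eqn_leq le //= -{1}[x](addrK c).
exact/le/codeN.
Qed.

(** Take the first step of a shortest path to a closest codeword. *)
Lemma code_dist_descend x i : code_dist C x = i.+1 ->
  exists2 y, hamming_adj x y & code_dist C y = i.
Proof.
move=> dx; have [c cC dc] := code_dist_attained x.
have [[|y p] [/= pp lp sp]] := hdist_path x c.
  by rewrite -dc dx in sp.
case/andP: pp => xy pp; exists y => //; apply/eqP; rewrite eqn_leq.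
have := code_dist_adj xy; rewrite dx ltnS => ->; rewrite andbT.
apply: leq_trans (code_dist_le y cC) _.
have := hdist_le_path pp; rewrite lp => /leq_trans; apply.
by have [->] : (size p).+1 = i.+1 by rewrite sp -dc.
Qed.

Lemma code_dist_le_radius x : (code_dist C x <= covering_radius C)%N.
Proof. exact: leq_bigmax. Qed.

Lemma shell_inhabited i : (i <= covering_radius C)%N ->
  exists x, code_dist C x = i.
Proof.
move=> iR; have [x dx] : exists x, code_dist C x = covering_radius C.
  have [|x _ dx] := eq_bigmax_cond (code_dist C) (A := [pred x : 'rV[F]_n | true]).
    by apply/card_gt0P; exists 0.
  by exists x; rewrite -dx.
have {dx} dk : code_dist C x = (covering_radius C - i + i)%N by rewrite subnK.
elim: (_ - i)%N x dk => [|k IHk] x dk; first by exists x.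
by have [y _ /IHk] := code_dist_descend dk.
Qed.


Hypothesis C_cr : completely_regular C.

Lemma card_shell_nbrs x j : (j <= covering_radius C)%N ->
  #|[set y in shell C j | hamming_adj x y]| = shell_nbrs C (code_dist C x) j.
Proof.
move=> jR; rewrite /shell_nbrs; case: pickP => [z|/(_ x)]; last by rewrite inE eqxx.
rewrite inE => /eqP dz.
have memP k : (k <= covering_radius C)%N ->
    shell C k \in [set shell C i | i : 'I_(covering_radius C).+1].
  by move=> kR; apply/imsetP; exists (Ordinal (kR : (k < _.+1)%N)).
apply: (C_cr (memP _ (code_dist_le_radius x)) (memP _ jR)); rewrite inE ?dz //.
Qed.

Lemma shell_nbrs_gt0 i : (i < covering_radius C)%N ->
  (0 < shell_nbrs C i.+1 i)%N.
Proof.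
move=> iR; have [x dx] := shell_inhabited iR; rewrite -dx.
rewrite -card_shell_nbrs; last exact: ltnW.
have [y xy dy] := code_dist_descend dx.
by apply/card_gt0P; exists y; rewrite !inE dy eqxx.
Qed.

Lemma shell_nbrs_eq0 i j : (i <= covering_radius C)%N ->
  (j <= covering_radius C)%N -> (i.+1 < j)%N || (j.+1 < i)%N ->
  shell_nbrs C i j = 0%N.
Proof.
move=> iR jR ij; have [x dx] := shell_inhabited iR; rewrite -dx.
rewrite -card_shell_nbrs //; apply: eq_card0 => y; rewrite !inE.
apply/negP=> /andP[/eqP dy xy]; have := code_dist_adj xy.
rewrite hamming_adjC in xy; have := code_dist_adj xy; rewrite dx dy.
by move: ij; lia.
Qed.

(** The tridiagonal shape comes for free, since adjacent vertices lie in shells with indices at most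
    1 apart. The uniform entry turns products with this matrix into sums over all shells. *)
Lemma intersection_mxE i j :
  intersection_mx C i j = (shell_nbrs C i j)%:R.
Proof.
have iR : (i <= covering_radius C)%N by rewrite -ltnS.
have jR : (j <= covering_radius C)%N by rewrite -ltnS.
rewrite mxE /alpha /beta /gamma; congr _%:R.
have [->//|ji] := eqVneq; have [->//|ji1] := eqVneq.
have [->//|ij1] := eqVneq; rewrite shell_nbrs_eq0 //.
by move: ji ji1 ij1; lia.
Qed.

End CodeDistance.

(** * Transforms of functions of the distance to the code *)

Section RadialFunctions.
Variables (F : finFieldType) (n : nat) (C : {set 'rV[F]_n}).
Hypothesis C_linear : linear_code C.
Hypothesis C_cr : completely_regular C.
Variable chi : F -> algC.
Hypothesis chi0 : chi 0 = 1.
Hypothesis chiD : forall a b, chi (a + b) = chi a * chi b.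
Hypothesis chi_nontrivial : exists a, chi a != 1.
Implicit Types (x y c u v : 'rV[F]_n) (f g : 'rV[F]_n -> algC).

Local Notation R := (covering_radius C).
Local Notation transform := (fourier chi).

Definition dual_code : {set 'rV[F]_n} := [set u | [forall c in C, dot u c == 0]].

Definition distance_radial g := exists G, forall x, g x = G (code_dist C x).

(** The image of [distance_radial] under the transform, by [fourier_radial] and [radial_fourier]. *)
Definition dual_weight_radial f :=
  (forall u, u \notin dual_code -> f u = 0) /\
  {in dual_code &, forall u v, weight u = weight v -> f u = f v}.

Definition adjacency g x : algC := \sum_(y | hamming_adj x y) g y.

Definition theta u : algC := (n * #|F|.-1)%:R - (#|F| * weight u)%:R.

Definition shell_indicator j x : algC := (code_dist C x == j)%:R.

Lemma dual_codeP u : reflect (forall c, c \in C -> dot u c = 0) (u \in dual_code).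
Proof.
rewrite inE; apply: (iffP forall_inP) => h c cC; first exact/eqP/h.
by rewrite h.
Qed.

Lemma dual_linear : linear_code dual_code.
Proof.
split; first by apply/dual_codeP=> c _; rewrite dot0l.
move=> a u v /dual_codeP uW /dual_codeP vW; apply/dual_codeP=> c cC.
by rewrite dotDl dotZl uW // vW // mulr0 addr0.
Qed.

Lemma adjacency_shell j x : (j <= R)%N ->
  adjacency (shell_indicator j) x = (shell_nbrs C (code_dist C x) j)%:R.
Proof.
move=> jR; rewrite -card_shell_nbrs // -sum1_card natr_sum.
rewrite /adjacency big_mkcond [RHS]big_mkcond; apply: eq_bigr => y _.
rewrite !inE /shell_indicator.
by case: (hamming_adj x y); case: (code_dist C y == j).
Qed.

Lemma radial_decomp (G : nat -> algC) x :
  G (code_dist C x) = \sum_(j < R.+1) G j * shell_indicator j x.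
Proof.
have dR : (code_dist C x < R.+1)%N by rewrite ltnS code_dist_le_radius.
rewrite (bigD1 (Ordinal dR)) //= /shell_indicator eqxx mulr1 big1 ?addr0 // => j jd.
by rewrite eq_sym (negbTE (_ : j != code_dist C x :> nat)) ?mulr0.
Qed.

Lemma adjacency_radial (G : nat -> algC) x :
  adjacency (fun y => G (code_dist C y)) x
    = \sum_(j < R.+1) (shell_nbrs C (code_dist C x) j)%:R * G j.
Proof.
rewrite /adjacency; under eq_bigr => y _ do rewrite radial_decomp.
rewrite exchange_big; apply: eq_bigr => j _ /=.
by rewrite -big_distrr /= -/(adjacency _ x) adjacency_shell -1?ltnS // mulrC.
Qed.

Lemma fourier_adjacency g u : transform (adjacency g) u = theta u * transform g u.
Proof.
rewrite /theta -(character_sum_weight1 chi0 chiD chi_nontrivial).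
rewrite /fourier /adjacency big_distrr /=.
under eq_bigr => x _ do rewrite big_distrl /=.
rewrite (exchange_big_dep xpredT) //=; apply: eq_bigr => y _.
rewrite big_distrl /= (reindex_inj (addIr y)) /=.
apply: eq_big => [z|z _]; first by rewrite /hamming_adj hdistE addrK.
by rewrite dotDr chiD; ring.
Qed.

(** This serves twice: as a left eigenvector equation for the intersection matrix, and as a
    recursion producing the transform of each shell from those of the earlier ones. *)
Lemma fourier_shell_rec u i : (i <= R)%N ->
  theta u * transform (shell_indicator i) u
    = \sum_(j < R.+1) (shell_nbrs C j i)%:R * transform (shell_indicator j) u.
Proof.
move=> iR; rewrite -fourier_adjacency /fourier.
under eq_bigr => x _ do rewrite adjacency_shell //
  (radial_decomp (fun j => (shell_nbrs C j i)%:R)) big_distrl /=.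
rewrite exchange_big; apply: eq_bigr => j _; rewrite big_distrr /=.
by apply: eq_bigr => x _; rewrite mulrA.
Qed.

Lemma fourier_code u : u \in dual_code -> transform (shell_indicator 0) u = #|C|%:R.
Proof.
move/dual_codeP=> uW; rewrite -sum1_card natr_sum [RHS]big_mkcond.
apply: eq_bigr => x _; rewrite /shell_indicator code_dist_eq0 //.
by case: ifP => [xC|_]; rewrite ?mul0r // mul1r uW // chi0.
Qed.

(* The columns of the tridiagonal intersection matrix determine the transforms
   of the shells recursively from that of the code. *)
Lemma fourier_shell_weight u v : u \in dual_code -> v \in dual_code ->
  weight u = weight v -> forall i, (i <= R)%N ->
  transform (shell_indicator i) u = transform (shell_indicator i) v.
Proof.
move=> uW vW uv i; elim/ltn_ind: i => -[_ _|i IHi iR];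
  first by rewrite !fourier_code.
have IH j : (j <= i)%N ->
    transform (shell_indicator j) u = transform (shell_indicator j) v.
  by move=> ji; rewrite IHi // (leq_trans _ iR) // ltnW.
have iR1 : (i.+1 < R.+1)%N by [].
have rec w : (shell_nbrs C i.+1 i)%:R * transform (shell_indicator i.+1) w
    = theta w * transform (shell_indicator i) w
      - \sum_(j < R.+1 | (j <= i)%N)
          (shell_nbrs C j i)%:R * transform (shell_indicator j) w.
  rewrite fourier_shell_rec 1?ltnW // (bigID (fun j : 'I__ => (j <= i)%N)) /=.
  rewrite [RHS]addrC addKr (bigD1 (Ordinal iR1)) /= -?ltnNge // big1 ?addr0 // => j.
  case/andP; rewrite -ltnNge => ij; rewrite -val_eqE /= => ji.
  by rewrite shell_nbrs_eq0 ?mul0r // -1?ltnS ?ltn_ord ?ltnS ?(ltnW iR) //;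
    move: ij ji; lia.
have c0 : (shell_nbrs C i.+1 i)%:R != 0 :> algC.
  by rewrite pnatr_eq0 -lt0n shell_nbrs_gt0.
apply: (mulfI c0); rewrite !rec /theta uv IH //; congr (_ - _).
by apply: eq_bigr => j ji; rewrite IH.
Qed.

(** Translating by a codeword leaves [g] unchanged but multiplies its transform at [u] by a
    character value, which can be chosen different from 1. *)
Lemma fourier_notin_dual g u : distance_radial g -> u \notin dual_code ->
  transform g u = 0.
Proof.
case=> G gG; rewrite inE negb_forall_in => /exists_inP[c cC uc].
have [a a1] := chi_nontrivial.
pose d := (a / dot u c) *: c.
have du : dot u d = a by rewrite dotZr mulfVK.
have h : chi a * transform g u = transform g u.
  rewrite /fourier big_distrr /= [RHS](reindex_inj (addIr d)) /=.
  apply: eq_bigr => x _; rewrite !gG code_distD ?codeZ // dotDr du chiD; ring.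
have : (chi a - 1) * transform g u = 0 by rewrite mulrBl h mul1r subrr.
by move/eqP; rewrite mulf_eq0 subr_eq0 (negbTE a1) => /eqP.
Qed.

Lemma fourier_radial g : distance_radial g -> dual_weight_radial (transform g).
Proof.
move=> gr; split=> [u|]; first exact: fourier_notin_dual.
have [G gG] := gr => u v uW vW uv.
have e w : transform g w = \sum_(j < R.+1) G j * transform (shell_indicator j) w.
  rewrite /fourier; under eq_bigr => x _ do rewrite gG radial_decomp big_distrl /=.
  rewrite exchange_big; apply: eq_bigr => j _; rewrite big_distrr /=.
  by apply: eq_bigr => x _; rewrite mulrA.
rewrite !e; apply: eq_bigr => j _.
by rewrite (fourier_shell_weight uW vW uv) // -ltnS.
Qed.

Lemma interpolation (m : nat) (phi : nat -> algC) :
  exists p : {poly algC}, forall j, (j < m)%N -> p.[j%:R] = phi j.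
Proof.
elim: m => [|m [p hp]]; first by exists 0.
pose w := \prod_(i < m) ('X - (i%:R)%:P) : {poly algC}.
have w0 j : (j < m)%N -> w.[j%:R] = 0.
  move=> jm; rewrite /w horner_prod (bigD1 (Ordinal jm)) //=.
  by rewrite hornerXsubC subrr mul0r.
have wm : w.[m%:R] != 0.
  rewrite /w horner_prod; apply/prodf_neq0 => i _.
  by rewrite hornerXsubC subr_eq0 eqr_nat gtn_eqF.
exists (p + ((phi m - p.[m%:R]) / w.[m%:R])%:P * w) => j.
rewrite ltnS leq_eqVlt hornerD hornerM hornerC => /orP[/eqP->|jm].
  by rewrite mulfVK // addrC subrK.
by rewrite (w0 j jm) mulr0 addr0; apply: hp.
Qed.

(** On the transform side, [(n (q - 1) - adjacency) / q] is multiplication by the weight, and the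
    indicator of C is the constant [#|C|] on the dual code. So every polynomial in the weight is
    reached, and by interpolation every function of the weight. *)
Lemma radial_fourier f : dual_weight_radial f ->
  exists2 g, distance_radial g & f =1 transform g.
Proof.
have q0 : #|F|%:R != 0 :> algC.
  by rewrite pnatr_eq0 -lt0n; apply/card_gt0P; exists 0.
have step (p : {poly algC}) : exists2 g, distance_radial g &
    forall u, u \in dual_code -> transform g u = p.[(weight u)%:R].
  elim/poly_ind: p => [|p a [g [G gG] gp]].
    exists (fun=> 0); first by exists (fun=> 0).
    by move=> u _; rewrite horner0 /fourier big1 // => x _; rewrite mul0r.
  (* Horner step: the first term multiplies by the weight, the second adds the constant [a]. *)
  exists (fun x => #|F|%:R^-1 * ((n * #|F|.-1)%:R * g x - adjacency g x)
                   + a / #|C|%:R * shell_indicator 0 x).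
    exists (fun k => #|F|%:R^-1 * ((n * #|F|.-1)%:R * G k
        - \sum_(j < R.+1) (shell_nbrs C k j)%:R * G j) + a / #|C|%:R * (k == 0%N)%:R).
    move=> x; rewrite gG -adjacency_radial; congr (_ * (_ - _) + _).
    by apply: eq_bigr => y _; rewrite gG.
  move=> u uW; rewrite hornerMXaddC -gp //.
  have C0 : #|C|%:R != 0 :> algC.
    by rewrite pnatr_eq0 -lt0n; apply/card_gt0P; exists 0; apply: code0.
  transitivity (#|F|%:R^-1 * ((n * #|F|.-1)%:R * transform g u
      - transform (adjacency g) u) + a / #|C|%:R * transform (shell_indicator 0) u).
    rewrite /fourier !big_distrr /= -sumrB big_distrr /= -big_split /=.
    by apply: eq_bigr => x _; ring.
  rewrite fourier_adjacency fourier_code // /theta !natrM.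
  by field; rewrite ?q0 ?C0.
move=> [f0 fW].
(* The value 0 at weights missing from the dual code is arbitrary; [n.+1] nodes cover all possible
   weights. *)
pose phi j := if [pick u in dual_code | weight u == j] is Some u then f u else 0.
have [p hp] := interpolation n.+1 phi; have [g gr gp] := step p.
exists g => // u; have [uW|uW] := boolP (u \in dual_code); last first.
  by rewrite f0 // fourier_notin_dual.
rewrite gp // hp; last by rewrite ltnS -{2}[n]card_ord max_card.
rewrite /phi; case: pickP => [v /andP[vW /eqP uv]|/(_ u)]; first exact: fW.
by rewrite uW eqxx.
Qed.

Lemma dual_weight_radial_conv f1 f2 :
  dual_weight_radial f1 -> dual_weight_radial f2 ->
  dual_weight_radial (fun u => \sum_v f1 v * f2 (u - v)).
Proof.
move=> /radial_fourier[g1 [G1 gG1] e1] /radial_fourier[g2 [G2 gG2] e2].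
have [|z w] := @fourier_radial (fun x => (#|F| ^ n)%:R * (g1 x * g2 x)).
  by exists (fun k => (#|F| ^ n)%:R * (G1 k * G2 k)) => x; rewrite gG1 gG2.
have e u : \sum_v f1 v * f2 (u - v)
    = transform (fun x => (#|F| ^ n)%:R * (g1 x * g2 x)) u.
  under eq_bigr => v _ do rewrite e1 e2.
  rewrite (fourierM chi0 chiD chi_nontrivial) /fourier big_distrr /=.
  by apply: eq_bigr => x _; rewrite mulrA.
by split=> [u|u v] *; rewrite !e; [apply: z|apply: w].
Qed.

End RadialFunctions.

(** * Weights of the dual code *)

(** A unit vector in a linear code makes its coordinate free. A transposition moves this coordinate
    to the end, exhibiting the code as a product with the full line. *)
Lemma reduced_delta (F : finFieldType) (n : nat) (C : {set 'rV[F]_n}) i :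
  linear_code C -> reduced C -> delta_mx 0 i \notin C.
Proof.
move=> C_linear red; apply/negP=> iC; apply: red.
case: n C C_linear i iC => [|m] C C_linear i iC; first by case: i {iC}.
have e : (m.+1 = m + 1)%N by rewrite addn1.
pose s (j : 'I_m.+1) := cast_ord e (tperm i ord_max j).
pose s' (j : 'I_(m + 1)) := tperm i ord_max (cast_ord (esym e) j).
have ss' j : s' (s j) = j by rewrite /s /s' cast_ordK tpermK.
have s's j : s (s' j) = j by rewrite /s /s' tpermK cast_ordKV.
pose sh (x : 'rV[F]_m.+1) : 'rV[F]_(m + 1) := \row_j x 0 (s' j).
exists m, [set lsubmx (sh x) | x in C], s; first by exists s'.
apply/setP=> x; apply/idP/imsetP => [xC|[y]].
  exists (sh x); first by rewrite !inE andbT; apply/imsetP; exists x.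
  by apply/rowP=> j; rewrite !mxE ss'.
rewrite !inE andbT => /imsetP[z zC yz ->].
suff -> : \row_i0 y 0 (s i0) = (y 0 (s i) - z 0 i) *: delta_mx 0 i + z.
  by rewrite codeZD.
apply/rowP=> j; rewrite !mxE eqxx /=.
have [->|ji] := eqVneq j i; first by rewrite mulr1 subrK.
rewrite mulr0 add0r; case: (split_ordP (s j)) => [k sk|k sk].
  have := congr1 (fun v : 'rV[F]_m => v 0 k) yz; rewrite !mxE -sk => ->.
  by rewrite ss'.
case/eqP: ji; rewrite -[j]ss' sk /s'.
suff -> : cast_ord (esym e) (rshift m k) = ord_max by rewrite tpermR.
by apply: val_inj; rewrite /= ord1 addn0.
Qed.

(** When all weights of W are multiples of a positive t, these are its nonzero words of least
    possible weight. *)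
Definition minwords (F : finFieldType) (n t : nat) (W : {set 'rV[F]_n}) :
  {set 'rV[F]_n} := [set w in W | weight w == t].

Section MinimalWeightWords.
Variables (F : finFieldType) (n t : nat) (W : {set 'rV[F]_n}).
Implicit Types (w : 'rV[F]_n).

Lemma in_minwords w : (w \in minwords t W) = (w \in W) && (weight w == t).
Proof. by rewrite /minwords in_set. Qed.

Lemma minwordP w : reflect (w \in W /\ weight w = t) (w \in minwords t W).
Proof. by rewrite in_minwords; apply: (iffP andP) => -[? /eqP]. Qed.

Lemma minword_in w : w \in minwords t W -> w \in W.
Proof. by case/minwordP. Qed.

Lemma minword_weight w : w \in minwords t W -> weight w = t.
Proof. by case/minwordP. Qed.

Lemma minword_neq0 w : (0 < t)%N -> w \in minwords t W -> w != 0.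
Proof. by move=> t0 /minword_weight wt; rewrite -weight_eq0 wt -lt0n. Qed.

Lemma minwordZ l w : linear_code W -> l != 0 -> w \in minwords t W ->
  l *: w \in minwords t W.
Proof.
move=> W_linear l0 /minwordP[wW wt]; apply/minwordP.
by rewrite weightZ // codeZ.
Qed.

End MinimalWeightWords.

Section DualWeights.
Variables (F : finFieldType) (n : nat) (C : {set 'rV[F]_n}).
Hypothesis C_linear : linear_code C.
Hypothesis C_cr : completely_regular C.
Implicit Types (x y c u v w : 'rV[F]_n) (S : {set 'rV[F]_n}).

Local Notation R := (covering_radius C).
Local Notation W := (dual_code C).

(** The transform of the indicator of C is [#|C|] on W and 0 elsewhere. Inverting it at a vector
    orthogonal to W gives [#|C| * #|W|], which is not 0. *)
Lemma dual_dual x : (forall u, u \in W -> dot u x = 0) -> x \in C.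
Proof.
move=> h; have [chi [chi0 chiD chi1]] := exists_additive_character F.
have := fourier_inversion chi0 chiD chi1 (shell_indicator C 0) (- x).
rewrite opprK {2}/shell_indicator code_dist_eq0 //.
case: (x \in C) => //; rewrite mulr0 => /eqP.
rewrite /fourier (bigID [in W]) /= addrC big1 => [|u uW]; last first.
  rewrite -/(fourier chi (shell_indicator C 0) u).
  rewrite (fourier_notin_dual C_linear chiD chi1 _ uW) ?mul0r //.
  by exists (fun k => (k == 0%N)%:R).
rewrite add0r (eq_bigr (fun=> #|C|%:R)) => [|u uW]; last first.
  rewrite -/(fourier chi (shell_indicator C 0) u) (fourier_code C_linear chi0 uW).
  by rewrite dotC dotNr h // oppr0 chi0 mulr1.
rewrite sumr_const -mulrnA pnatr_eq0 muln_eq0 => /orP[] /eqP /card0_eq.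
  by move/(_ 0); rewrite code0.
by move/(_ 0); rewrite (code0 (dual_linear C)).
Qed.

(** The transforms of the shells at [u] form an eigenvector, nonzero because its entry at shell 0 is
    [#|C|]. *)
Lemma theta_in_spec u : u \in W -> theta u \in spec C.
Proof.
move=> uW; have [chi [chi0 chiD chi1]] := exists_additive_character F.
apply/eigenvalueP; exists (\row_(i < R.+1) fourier chi (shell_indicator C i) u).
  apply/rowP=> j; rewrite !mxE.
  rewrite (fourier_shell_rec C_cr chi0 chiD chi1) -1?ltnS //.
  by apply: eq_bigr => i _; rewrite intersection_mxE // mxE mulrC.
apply/eqP=> /rowP/(_ ord0); rewrite !mxE (fourier_code C_linear chi0 uW).
by move/eqP; rewrite pnatr_eq0 => /eqP/card0_eq/(_ 0); rewrite code0.
Qed.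

(** An eigenvector on the other side, read as a function of the distance, is an eigenfunction of the
    Hamming graph. Its transform lives on the [u] in W with [theta u = a], and cannot vanish
    everywhere. *)
Lemma spec_theta a : a \in spec C -> exists2 u, u \in W & theta u = a.
Proof.
move=> aS; have [chi [chi0 chiD chi1]] := exists_additive_character F.
have : eigenvalue (intersection_mx C)^T a.
  move: aS; rewrite unfold_in /spec /eigenvalue /eigenspace !kermx_eq0 !row_free_unit.
  by rewrite -unitmx_tr linearB /= tr_scalar_mx.
case/eigenvalueP=> v va v0; pose G k := v 0 (inord k).
pose g x := G (code_dist C x).
have gr : distance_radial C g by exists G.
have ga x : adjacency g x = a * g x.
  have dR : (code_dist C x < R.+1)%N by rewrite ltnS code_dist_le_radius.
  have e : \sum_j v 0 j * (shell_nbrs C (code_dist C x) j)%:R = a * v 0 (Ordinal dR).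
    have := congr1 (fun m : 'rV_ _ => m 0 (Ordinal dR)) va.
    rewrite /= [in LHS]mxE [in RHS]mxE => <-; apply: eq_bigr => j _.
    by rewrite [_^T _ _]mxE (intersection_mxE C_linear C_cr).
  rewrite /g (adjacency_radial C_cr).
  have -> : G (code_dist C x) = v 0 (Ordinal dR).
    by congr (v 0 _); apply: val_inj; rewrite /= inordK.
  by rewrite -e; apply: eq_bigr => j _; rewrite /G inord_val mulrC.
have [|noW] := boolP [exists u in W, theta u == a].
  by case/exists_inP=> u uW /eqP; exists u.
have f0 u : fourier chi g u = 0.
  have [uW|] := boolP (u \in W); last exact: fourier_notin_dual.
  have := fourier_adjacency chi0 chiD chi1 g u.
  have -> : fourier chi (adjacency g) u = a * fourier chi g u.
    by rewrite /fourier big_distrr /=; apply: eq_bigr => x _; rewrite ga mulrA.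
  move/eqP; rewrite -subr_eq0 -mulrBl mulf_eq0 subr_eq0 => /orP[/eqP ta|/eqP //].
  by case/exists_inP: noW; exists u; rewrite // -ta.
have g0 := fourier_inj0 chi0 chiD chi1 f0.
case/eqP: v0; apply/rowP=> j; rewrite mxE.
have [x dx] := shell_inhabited C_linear (ltn_ord j : (j <= R)%N).
by have := g0 x; rewrite /g /G dx inord_val.
Qed.

(** The algebraic number [t] turns out to be a natural number, the weight of a dual word whose
    eigenvalue has [j = 1]. Were it 0, the dual would be trivial and C the whole space. *)
Lemma arithmetic_weights (t : algC) :
  C <> [set: 'rV[F]_n] ->
  spec C =i [seq (n * #|F|.-1)%:R - (#|F| * j)%:R * t | j <- iota 0 R.+1] ->
  exists s, [/\ (0 < s)%N, (0 < R)%N,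
    forall u, u \in W -> exists2 j, (j <= R)%N & weight u = (j * s)%N
    & forall j, (j <= R)%N -> exists2 u, u \in W & weight u = (j * s)%N].
Proof.
move=> CT hspec.
have q0 : #|F|%:R != 0 :> algC.
  by rewrite pnatr_eq0 -lt0n; apply/card_gt0P; exists 0.
have wE u j : theta u = (n * #|F|.-1)%:R - (#|F| * j)%:R * t ->
    (weight u)%:R = j%:R * t.
  by move/addrI/oppr_inj; rewrite !natrM -mulrA => /(mulfI q0).
have w1 u : u \in W -> exists2 j, (j <= R)%N & (weight u)%:R = j%:R * t.
  move/theta_in_spec; rewrite hspec => /mapP[j]; rewrite mem_iota ltnS => jR.
  by exists j => //; apply: wE.
have w2 j : (j <= R)%N -> exists2 u, u \in W & (weight u)%:R = j%:R * t.
  move=> jR; have [|u uW /wE] := @spec_theta ((n * #|F|.-1)%:R - (#|F| * j)%:R * t).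
    by rewrite hspec; apply/mapP; exists j => //; rewrite mem_iota ltnS.
  by exists u.
have [x xC] : exists x, x \notin C.
  by apply/existsP; rewrite -negb_forall; apply/negP=> /forallP h;
     apply: CT; apply/setP=> x; rewrite inE h.
have R0 : (0 < R)%N.
  rewrite (leq_trans _ (code_dist_le_radius C x)) // lt0n.
  by rewrite code_dist_eq0.
have [u1 u1W tE] := w2 1%N R0; rewrite mul1r in tE.
exists (weight u1); split=> // [|u uW|j jR].
- rewrite lt0n; apply: contra xC => /eqP t0; apply: dual_dual => u uW.
  have [j _] := w1 u uW; rewrite -tE t0 mulr0 => /eqP.
  by rewrite pnatr_eq0 weight_eq0 => /eqP->; rewrite dot0l.
- have [j jR] := w1 u uW; rewrite -tE -natrM => /eqP.
  by rewrite eqr_nat => /eqP; exists j.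
have [u uW] := w2 j jR; rewrite -tE -natrM => /eqP.
by rewrite eqr_nat => /eqP; exists u.
Qed.

Definition weight_invariant S := S \subset W /\
  {in W &, forall u v, weight u = weight v -> u \in S -> v \in S}.

Lemma weight_invariant_radial S : weight_invariant S ->
  dual_weight_radial C (fun u => (u \in S)%:R).
Proof.
move=> [SW Sw]; split=> [u|u v uW vW uv].
  by move/(contra (subsetP SW u))/negbTE->.
by congr (nat_of_bool _)%:R; apply/idP/idP; apply: Sw.
Qed.

Lemma weight_invariant_minwords t : weight_invariant (minwords t W).
Proof.
split; first by apply/subsetP=> u; rewrite in_minwords => /andP[].
by move=> u v uW vW; rewrite !in_minwords uW vW => ->.
Qed.

(** The count is the convolution of two indicator functions, hence depends on the weight only. *)
Lemma card_sum_decomp S1 S2 u v :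
  weight_invariant S1 -> weight_invariant S2 -> u \in W -> v \in W ->
  weight u = weight v ->
  #|[set b in S1 | u - b \in S2]| = #|[set b in S1 | v - b \in S2]|.
Proof.
move=> S1w S2w uW vW uv; have [chi [chi0 chiD chi1]] := exists_additive_character F.
have [_ h] := dual_weight_radial_conv C_linear C_cr chi0 chiD chi1
   (weight_invariant_radial S1w) (weight_invariant_radial S2w).
have e w : (#|[set b in S1 | w - b \in S2]|)%:R
    = \sum_b (b \in S1)%:R * (w - b \in S2)%:R :> algC.
  rewrite -sum1_card natr_sum big_mkcond; apply: eq_bigr => b _.
  by rewrite inE -natrM; case: (b \in S1); case: (_ \in S2).
by apply/eqP; rewrite -(eqr_nat algC) !e; apply/eqP/h.
Qed.

Lemma weight_invariant_sum S1 S2 : weight_invariant S1 -> weight_invariant S2 ->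
  weight_invariant [set a + b | a in S1, b in S2].
Proof.
move=> S1w S2w; have [[/subsetP s1 _] [/subsetP s2 _]] := (S1w, S2w).
have memE u : (u \in [set a + b | a in S1, b in S2])
    = (0 < #|[set b in S1 | (u - b)%R \in S2]|)%N.
  apply/imset2P/card_gt0P => [[a b aS bS ->]|[a]].
    by exists a; rewrite inE aS addrC addKr.
  by rewrite inE => /andP[aS bS]; exists a (u - a)%R; rewrite // addrC subrK.
split=> [|u v uW vW uv].
  apply/subsetP=> _ /imset2P[a b /s1 aW /s2 bW ->].
  exact: (codeD (dual_linear C)).
by rewrite !memE (card_sum_decomp S1w S2w uW vW uv).
Qed.

(** * Generation of the dual code by its words of weight t *)

Section MinimalWords.
Variable t : nat.
Hypothesis t_gt0 : (0 < t)%N.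
Hypothesis R_gt0 : (0 < R)%N.
Hypothesis W_weights :
  forall u, u \in W -> exists2 j, (j <= R)%N & weight u = (j * t)%N.
Hypothesis W_weights_attained :
  forall j, (j <= R)%N -> exists2 u, u \in W & weight u = (j * t)%N.
Hypothesis C_delta : forall i, delta_mx 0 i \notin C.

Local Notation T := (minwords t W).

Lemma code_dist_delta i a : a != 0 -> code_dist C (a *: delta_mx 0 i) = 1%N.
Proof.
move=> a0; apply/eqP; rewrite eqn_leq; apply/andP; split.
  apply: leq_trans (code_dist_le _ (code0 C_linear)) _.
  by rewrite hdistE subr0; apply/eq_leq/eqP/weight1P; exists i, a.
rewrite lt0n code_dist_eq0 //; apply: contra (C_delta i) => h.
by rewrite -[delta_mx _ _](scalerK a0) codeZ.
Qed.

(* The transform of the indicator of T depends only on the distance to C, hence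
   takes the same value at all unit vectors; a coordinate missed by T would make
   that value #|T|, so that every coordinate would be missed. *)
Lemma minwords_cover i : exists2 w, w \in T & w 0 i != 0.
Proof.
have [|noi] := boolP [exists w in T, w 0 i != 0].
  by case/exists_inP=> w; exists w.
have [chi [chi0 chiD chi1]] := exists_additive_character F.
have iT w : w \in T -> w 0 i = 0.
  by move=> wT; apply/eqP; apply: contraNT noi => wi; apply/exists_inP; exists w.
have [g [G gG] e] := radial_fourier C_linear C_cr chi0 chiD chi1
  (weight_invariant_radial (weight_invariant_minwords t)).
pose h x := \sum_(w in T) chi (dot w x).
have hE x : h x = (#|F| ^ n)%:R * G (code_dist C (- x)).
  rewrite -gG -(fourier_inversion chi0 chiD chi1) /h big_mkcond /fourier.
  apply: eq_bigr => w _; rewrite -/(fourier chi g w) -e dotC.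
  by case: (w \in T); rewrite ?mul1r ?mul0r.
have hT j a : h (a *: delta_mx 0 j) = #|T|%:R.
  have [->|a0] := eqVneq a 0.
    rewrite scale0r /h (eq_bigr (fun=> 1)) ?sumr_const // => w _.
    by rewrite dot0r chi0.
  transitivity (h (1 *: delta_mx 0 i)).
    by rewrite !hE -!scaleNr !code_dist_delta ?oppr_eq0 ?oner_eq0.
  rewrite /h (eq_bigr (fun=> 1)) ?sumr_const // => w wT.
  by rewrite dotZr dot_delta iT // mulr0 chi0.
have T0 w j : w \in T -> w 0 j = 0.
  move=> wT; apply/eqP; apply: contraTT isT => wj.
  (* By orthogonality the sum over multiples of a unit vector counts the words of T vanishing at
     [j]; as [h] is constantly [#|T|] there, all of them vanish. *)
  have : \sum_a h (a *: delta_mx 0 j) = (#|F| * #|[set w in T | w 0 j == 0]|)%:R.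
    rewrite /h exchange_big /= -[X in (_ * X)%:R]sum1_card natrM natr_sum big_distrr /=.
    rewrite big_mkcond [RHS]big_mkcond; apply: eq_bigr => v _.
    rewrite [in RHS]in_set; case: (v \in T) => //=.
    under eq_bigr => a _ do rewrite dotZr dot_delta.
    by rewrite (character_sum_mul chi0 chiD chi1); case: eqP => _ /=;
      rewrite ?muln1 ?muln0 ?mulr1.
  under eq_bigr => a _ do rewrite hT.
  rewrite sumr_const -mulrnA mulnC => /eqP.
  rewrite eqr_nat eqn_pmul2l; last by apply/card_gt0P; exists 0.
  move/eqP=> eT; suff : (#|[set w in T | w 0%R j == 0%R]| < #|T|)%N
    by rewrite -eT ltnn.
  apply: proper_card.
  apply/properP; split; first by apply/subsetP=> v; rewrite in_set => /andP[].
  by exists w => //; rewrite in_set wT (negbTE wj).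
have [u uW] := W_weights_attained R_gt0; rewrite mul1n => ut.
have /T0 u0 : u \in T by apply/minwordP.
suff e0 : u = 0 by move: t_gt0; rewrite -ut e0 weight0.
by apply/rowP=> j; rewrite mxE u0.
Qed.

Definition add_words S : {set 'rV[F]_n} := 0 |: [set a + b | a in S, b in T].

(** The span is built by adding one word of T at a time because each stage is then a union of weight
    classes of W, by [weight_invariant_sum]. *)
Definition word_span := fixset add_words.

Lemma add_words_mono : {homo add_words : S1 S2 / S1 \subset S2}.
Proof. by move=> S1 S2 s; apply/setUS/imset2S. Qed.

Lemma word_spanE : add_words word_span = word_span.
Proof. exact: (fixsetK add_words_mono). Qed.

Lemma word_span_ind (P : 'rV[F]_n -> Prop) :
  P 0 -> (forall a b, a \in word_span -> P a -> b \in T -> P (a + b)) ->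
  forall u, u \in word_span -> P u.
Proof.
move=> P0 PD u; rewrite /word_span => /fix_order_proof[k].
elim: k u => [|k IHk] u; first by rewrite inE.
rewrite /= in_setU1 => /orP[/eqP-> //|/imset2P[a b ak bT ->]].
apply: PD => //; last exact: IHk ak.
exact: (subsetP (iter_sub_fix add_words_mono k)).
Qed.

Lemma word_span0 : 0 \in word_span.
Proof. by rewrite -word_spanE setU11. Qed.

Lemma word_spanD a b : a \in word_span -> b \in T -> a + b \in word_span.
Proof.
by move=> aU bT; rewrite -word_spanE in_setU1; apply/orP; right; apply/imset2P;
  exists a b.
Qed.

Lemma word_span_invariant : weight_invariant word_span.
Proof.
rewrite /word_span /fixset; elim: #|_| => [|k IHk] /=.
  by split=> [|u v _ _ _]; rewrite ?sub0set ?inE.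
have [s1 i1] := weight_invariant_sum IHk (weight_invariant_minwords t).
split=> [|u v uW vW uv].
  by rewrite subUset s1 sub1set (code0 (dual_linear C)).
rewrite !in_setU1 => /orP[/eqP u0|us]; last by rewrite (i1 u) ?orbT.
by rewrite -weight_eq0 -uv u0 weight0.
Qed.

Lemma word_span_sub : {subset word_span <= W}.
Proof. by case: word_span_invariant => /subsetP. Qed.

Lemma word_span_add u v : u \in word_span -> v \in word_span -> u + v \in word_span.
Proof.
move=> uU; move: v; apply: word_span_ind => [|a b _ IH bT]; first by rewrite addr0.
by rewrite addrA word_spanD.
Qed.

Lemma word_span_scale a u : u \in word_span -> a *: u \in word_span.
Proof.
have [->|a0] := eqVneq a 0; first by rewrite scale0r word_span0.
move: u; apply: word_span_ind => [|c b _ IH bT];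
  first by rewrite scaler0 word_span0.
rewrite scalerDr word_spanD // minwordZ //; exact: dual_linear.
Qed.

(** Adding one word of T raises the weight by at most t, so no multiple of t is skipped on the way
    from 0 to [u]. *)
Lemma word_span_weights u j i : u \in word_span -> weight u = (j * t)%N ->
  (i <= j)%N -> exists2 v, v \in word_span & weight v = (i * t)%N.
Proof.
move=> uU; move: u uU j; apply: word_span_ind => [|a b aU IH bT] j.
  rewrite weight0 => /esym/eqP; rewrite muln_eq0 (gtn_eqF t_gt0) orbF => /eqP->.
  by rewrite leqn0 => /eqP->; exists 0; rewrite ?word_span0 ?weight0.
move=> wj; rewrite leq_eqVlt => /orP[/eqP->|ij].
  by exists (a + b); rewrite ?word_spanD.
have [ja _ wa] := W_weights (word_span_sub aU).
apply: (IH ja wa); rewrite -ltnS; apply: leq_trans ij _.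
have /minwordP[_ wb] := bT; have := weightD a b.
by rewrite wj wa wb -mulSnr leq_pmul2r.
Qed.

Lemma word_span_downward u v : u \in word_span -> v \in W ->
  (weight v <= weight u)%N -> v \in word_span.
Proof.
move=> uU vW; have [j _ wu] := W_weights (word_span_sub uU).
have [i _ wv] := W_weights vW; rewrite wu wv leq_pmul2r // => ij.
have [x xU wx] := word_span_weights uU wu ij.
have [_ inv] := word_span_invariant.
by apply: (inv x) => //; [apply: word_span_sub|rewrite wx].
Qed.

(* A word outside the span would be heavier than every word of the span, and so
   would its whole coset; but since the span covers all coordinates, its cosets
   all have the same average weight. *)
Lemma word_span_full : W \subset word_span.
Proof.
apply/subsetP=> v vW; apply: contraT => vU.
have heavy u : u \in word_span -> (weight u < weight (v + u))%N.
  move=> uU; rewrite ltnNge; apply: contra vU => le.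
  rewrite -[v](addrK u) -scaleN1r word_span_add ?word_span_scale //.
  by apply: (word_span_downward uU) le;
    apply: (codeD (dual_linear C) vW (word_span_sub uU)).
have : (\sum_(u in word_span) weight u < \sum_(u in word_span) weight (v + u))%N.
  rewrite (bigD1 0) ?word_span0 //= [X in (_ < X)%N](bigD1 0) ?word_span0 //=.
  rewrite -addSn leq_add ?heavy ?word_span0 //.
  by apply: leq_sum => u /andP[/heavy/ltnW].
suff -> : (\sum_(u in word_span) weight (v + u)
          = \sum_(u in word_span) weight u)%N by rewrite ltnn.
under eq_bigr => u _ do rewrite weight_sum.
under [RHS]eq_bigr => u _ do rewrite weight_sum.
rewrite exchange_big [RHS]exchange_big; apply: eq_bigr => i _ /=.
have [w wT wi] := minwords_cover i.
(* A word of the span that agrees with [v] at coordinate [i]. Translation by it permutes the span,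
   so at [i] the coset and the span have equally many nonzero entries. *)
pose u0 := (v 0 i / w 0 i) *: w.
have u0U : u0 \in word_span.
  by rewrite word_span_scale // -[w]add0r word_spanD ?word_span0.
rewrite [RHS](reindex_inj (addrI u0)) /=; apply: eq_big => [u|u _].
  apply/idP/idP => [|uU]; first exact: word_span_add.
  rewrite -[u](addKr u0) -scaleN1r word_span_add // word_span_scale //.
by rewrite !mxE mulfVK.
Qed.

Lemma minwords_generate S : linear_code S -> T \subset S -> W \subset S.
Proof.
move=> Slin /subsetP TS; apply: subset_trans word_span_full _.
apply/subsetP; apply: word_span_ind => [|a b _ aS /TS bS].
  exact: code0.
exact: codeD.
Qed.

End MinimalWords.
End DualWeights.

(** * Column multiplicities and intersection numbers *)

Section SyndromeCounting.
Variables (F : finFieldType) (r n : nat) (A : 'M[F]_(r, n)).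
Implicit Types (x z : 'rV[F]_n).

Lemma nullsp_linear : linear_code (nullsp A).
Proof.
split; first by rewrite nullspE mul0mx.
move=> a u v; rewrite !nullspE => /eqP u0 /eqP v0.
by rewrite mulmxDl -scalemxAl u0 v0 scaler0 addr0.
Qed.

Lemma syndrome_delta i : delta_mx 0 i *m A^T = row i A^T.
Proof. by rewrite -rowE. Qed.

(** A codeword adjacent to [z] is [z] minus [a] times a unit vector, where [a] times the
    corresponding column is the syndrome of [z]. As this is nonzero, the column determines [a]. *)
Lemma card_nullsp_nbrs z : z *m A^T != 0 ->
  #|[set y in nullsp A | hamming_adj z y]| = multiplicity A (z *m A^T).
Proof.
set x := z *m A^T => x0.
pose b j := odflt 0 [pick a | a *: row j A^T == x].
pose f j := z - b j *: delta_mx 0 j.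
have bP j a : a *: row j A^T = x -> b j *: row j A^T = x.
  by rewrite /b; case: pickP => [c /eqP //|/(_ a)] h /eqP; rewrite h.
have b0 j : b j *: row j A^T = x -> b j != 0.
  by move=> bx; apply: contra x0 => /eqP bz; rewrite -bx bz scale0r.
set S := [set j | [exists a, a *: row j A^T == x]].
have bS j : j \in S -> b j *: row j A^T = x.
  by rewrite inE => /existsP[a /eqP/bP].
rewrite /multiplicity -/S -(card_in_imset (f := f) (D := S)).
  apply: eq_card => y; rewrite [LHS]in_set.
  apply/andP/imsetP => [[yN zy]|[j /bS jb ->]]; last first.
    rewrite nullspE mulmxBl -scalemxAl syndrome_delta.
    rewrite jb subrr eqxx; split=> //;
      rewrite /hamming_adj hdistE opprB addrC subrK.
    by apply/weight1P; exists j, (b j); split=> //; apply: b0.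
  move: zy; rewrite /hamming_adj hdistE => /weight1P[j [a [a0 zy]]].
  have ax : a *: row j A^T = x.
    rewrite -syndrome_delta scalemxAl -zy mulmxBl.
    by move: yN; rewrite nullspE => /eqP->; rewrite subr0.
  have jS : j \in S by rewrite inE; apply/existsP; exists a; rewrite ax.
  exists j => //; rewrite /f -[LHS](subKr z) zy; congr (_ - _ *: _).
  apply/eqP; rewrite -subr_eq0; apply: contraT => ne.
  have /eqP : (a - b j) *: row j A^T = 0 by rewrite scalerBl ax bS // subrr.
  rewrite scaler_eq0 (negbTE ne) => /eqP r0.
  by move: x0; rewrite -ax r0 scaler0 eqxx.
move=> i j /bS/b0 bi0 /bS/b0 bj0 /addrI/oppr_inj/rowP/(_ i).
rewrite !mxE !eqxx /= mulr1; case: eqP => // _.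
by rewrite mulr0 => bi; rewrite bi eqxx in bi0.
Qed.

(** Every non-codeword has exactly nu codeword neighbours, and nonzero columns leave codewords with
    none. So there are two cells, and regularity of the Hamming graph gives the counts in the second
    one. *)
Lemma constant_multiplicity_cr nu :
  (0 < nu)%N -> (0 < n)%N -> (forall i, row i A^T != 0) ->
  (forall s, s != 0 -> multiplicity A s = nu) ->
  completely_regular (nullsp A) /\ covering_radius (nullsp A) = 1%N.
Proof.
move=> nu0 n0 A0 Anu; set D := nullsp A.
have D_linear : linear_code D := nullsp_linear.
have out x : x \notin D -> code_dist D x = 1%N.
  move=> xD; have s0 : x *m A^T != 0 by rewrite -nullspE.
  apply/eqP; rewrite eqn_leq lt0n code_dist_eq0 // xD andbT.
  have /card_gt0P[y] : (0 < #|[set y in D | hamming_adj x y]|)%N.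
    by rewrite card_nullsp_nbrs // Anu.
  rewrite in_set => /andP[yD /eqP xy].
  by apply: leq_trans (code_dist_le x yD) _; rewrite xy.
have distE x : code_dist D x = (x \notin D).
  have [xD|/out -> //] := boolP (x \in D).
  by apply/eqP; rewrite code_dist_eq0.
have rad : covering_radius D = 1%N.
  apply/eqP; rewrite eqn_leq; apply/andP; split.
    by apply/bigmax_leqP => x _; rewrite distE; case: (x \in D).
  have := code_dist_le_radius D (delta_mx 0 (Ordinal n0)).
  by rewrite distE nullspE syndrome_delta A0.
have degree x y : #|[set z : 'rV[F]_n | hamming_adj x z]| = #|[set z : 'rV[F]_n | hamming_adj y z]|.
  rewrite -[RHS](card_imset _ (addrI (x - y))) /=; apply: eq_card => z.
  rewrite inE; apply/idP/imsetP => [xz|[w]].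
    exists (z - (x - y)); rewrite ?subrKC // inE; move: xz.
    by rewrite /hamming_adj !hdistE !opprB addrCA subrKA addrC.
  by rewrite inE => yw ->; move: yw; rewrite /hamming_adj !hdistE opprD addrA subKr.
have nbrs0 x y : (x \in D) = (y \in D) ->
    #|[set z in D | hamming_adj x z]| = #|[set z in D | hamming_adj y z]|.
  have inside z : z \in D -> #|[set w in D | hamming_adj z w]| = 0%N.
    move=> zD; apply: eq_card0 => w; rewrite in_set.
    apply/negP=> /andP[wD]; rewrite /hamming_adj hdistE => /weight1P[j [a [a0 e]]].
    have : z - w \in D by apply: codeB.
    by rewrite e nullspE -scalemxAl syndrome_delta scaler_eq0 (negbTE a0) (negbTE (A0 j)).
  have [xD|xD] := boolP (x \in D) => /esym yD; first by rewrite !inside.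
  by rewrite !card_nullsp_nbrs ?Anu -?nullspE ?yD.
split=> //.
have shellE i : shell D i = if i == 0%N then D else if i == 1%N then ~: D else set0.
  apply/setP=> x; rewrite in_set distE.
  case: i => [|[|i]] /=; rewrite ?in_setC ?in_set0; by case: (x \in D).
rewrite /completely_regular rad => _ _ /imsetP[i _ ->] /imsetP[j _ ->] x y.
rewrite !shellE => xi yi.
have {xi yi} xy : (x \in D) = (y \in D).
  case: i xi yi => -[|[|//]] _ /=; first by move=> -> ->.
  by rewrite !in_setC => /negbTE-> /negbTE->.
case: j => -[|[|//]] _ /=; first exact: nbrs0.
have split_nbrs z : (#|[set w in D | hamming_adj z w]|
    + #|[set w in ~: D | hamming_adj z w]|)%N = #|[set w : 'rV[F]_n | hamming_adj z w]|.
  rewrite -(cardsID D [set w : 'rV[F]_n | hamming_adj z w]); congr (_ + _)%N;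
    apply: eq_card => w.
    by rewrite !(in_setI, in_set) andbC.
  by rewrite !(in_setD, in_setC, in_set).
by apply/eqP; rewrite -(eqn_add2l #|[set w in D | hamming_adj x w]|) split_nbrs
  (nbrs0 x y xy) split_nbrs (degree x y).
Qed.

End SyndromeCounting.

Section GammaMultiplicity.
Variables (F : finFieldType) (r n : nat) (A : 'M[F]_(r, n)).
Local Notation C := (nullsp A).
Hypothesis C_cr : completely_regular C.
Hypothesis C_delta : forall i, delta_mx 0 i \notin C.

Let C_linear : linear_code C := nullsp_linear A.

Lemma row_nonzero i : row i A^T != 0.
Proof. by rewrite -syndrome_delta -nullspE. Qed.

(** Some multiple of a unit vector has syndrome [x], and it lies in the first shell. *)
Lemma multiplicity_gamma x : x != 0 -> (0 < multiplicity A x)%N ->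
  multiplicity A x = gamma C 1.
Proof.
move=> x0 /card_gt0P[i]; rewrite inE => /existsP[a /eqP ax].
have a0 : a != 0 by apply: contra x0 => /eqP a0; rewrite -ax a0 scale0r.
have sx : (a *: delta_mx 0 i) *m A^T = x by rewrite -scalemxAl syndrome_delta.
rewrite -sx -card_nullsp_nbrs ?sx // /gamma.
rewrite -[X in shell_nbrs _ X _](code_dist_delta C_linear C_delta i a0) /= -card_shell_nbrs //.
by apply: eq_card => y;
  rewrite ![y \in [set _ in _ | _]]in_set [in RHS]in_set code_dist_eq0.
Qed.

(** At a column of [B] the proportionality of multiplicities reads [c * gamma C 1 = d]. Cancelling
    [c] then shows that every nonzero point occurs [gamma C 1] times as often in [A] as in [B]. *)
Lemma code_equiv_hcopies m (B : 'M[F]_(r, m)) c d :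
  (0 < d)%N -> (0 < m)%N -> (forall j, row j B^T != 0) ->
  (forall j, multiplicity B (row j B^T) = 1%N) ->
  (forall u : 'rV_r, c * weight (u *m A) = d * weight (u *m B))%N ->
  code_equiv C (nullsp (hcopies (gamma C 1) B)).
Proof.
move=> d0 m0 B0 B1 AB; have cd := multiplicity_proportional AB.
have j0 := Ordinal m0.
have e0 := cd _ (B0 j0); rewrite B1 muln1 in e0.
have N0 : (0 < multiplicity A (row j0 B^T))%N.
  by rewrite lt0n; apply: contraTneq d0 => N0; rewrite -e0 N0 muln0.
rewrite (multiplicity_gamma (B0 j0) N0) in e0.
have c0 : (0 < c)%N by move: d0; rewrite -e0; case: (c).
apply: code_equiv_of_multiplicity => [i|j|x x0]; first exact: row_nonzero.
  suff -> : row j (hcopies (gamma C 1) B)^T = row (tagnat.sig2 j) B^T by [].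
  by apply/rowP=> i; rewrite !mxE.
apply/eqP; rewrite -(eqn_pmul2l c0) cd //.
by rewrite multiplicity_hcopies mulnA e0.
Qed.

End GammaMultiplicity.

Section Generators.
Variables (F : finFieldType) (n : nat).
Implicit Types (S : {set 'rV[F]_n}).

Lemma linear_code_submx S m (M : 'M[F]_(m, n)) w :
  linear_code S -> (forall i, row i M \in S) -> (w <= M)%MS -> w \in S.
Proof.
move=> S_linear MS /submxP[u ->]; rewrite mulmx_sum_row.
by elim/big_rec: _ => [|i v _ vS]; [apply: code0|apply: codeZD].
Qed.

Lemma linear_code_basis S : linear_code S ->
  exists r (A : 'M[F]_(r, n)), row_free A /\ forall w, (w \in S) = (w <= A)%MS.
Proof.
move=> S_linear; pose M := \matrix_(i < #|S|) (enum_val i).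
have MS i : row i M \in S by rewrite rowK enum_valP.
exists (\rank M), (row_base M); split=> [|w]; first exact: row_base_free.
rewrite eq_row_base; apply/idP/idP => [wS|]; last exact: linear_code_submx.
by rewrite (_ : w = row (enum_rank_in wS w) M) ?row_sub // rowK enum_rankK_in.
Qed.

Lemma card_row_space r (A : 'M[F]_(r, n)) : row_free A ->
  #|[set w : 'rV[F]_n | (w <= A)%MS]| = (#|F| ^ r)%N.
Proof.
move=> fA; transitivity #|[set u *m A | u in [set: 'rV[F]_r]]|.
  apply: eq_card => w; rewrite inE; apply/submxP/imsetP => [[u ->]|[u _ ->]].
    by exists u; rewrite ?inE.
  by exists u.
rewrite card_imset; last exact: row_free_inj.
by rewrite cardsT card_mx mul1n.
Qed.

Lemma parity_check_of_dual (C : {set 'rV[F]_n}) r (A : 'M[F]_(r, n)) :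
  linear_code C -> (forall i, row i A \in dual_code C) ->
  (forall w, w \in dual_code C -> (w <= A)%MS) -> C = nullsp A.
Proof.
move=> C_linear AW WA; have eqA x i : (x *m A^T) 0 i = dot (row i A) x.
  by rewrite mulmx_tr_dot trmxK dotC.
apply/setP=> x; rewrite nullspE; apply/idP/eqP => [xC|xA].
  by apply/rowP=> i; rewrite eqA mxE; have /dual_codeP-> := AW i.
apply: dual_dual => // u /WA/submxP[v ->]; rewrite mulmx_sum_row.
elim/big_rec: _ => [|i w _ IH]; first exact: dot0l.
by rewrite dotDl IH dotZl -eqA xA mxE mulr0 addr0.
Qed.

End Generators.

(** * Parity check matrices of Hamming codes *)

Section HammingMatrix.
Variable F : finFieldType.

Lemma exists_hamming_mx (r : nat) : exists m (H : 'M[F]_(r, m)),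
  hamming_mx H /\ forall x, x != 0 -> multiplicity H x = 1%N.
Proof.
(* One column for each projective point, its canonical representative. *)
pose P := [set x : 'rV[F]_r | (x != 0) && (line_rep x == x)].
have repIn x : x != 0 -> line_rep x \in P.
  move=> x0; have [a a0 e] := line_repP x.
  by rewrite inE e line_repZ // e scaler_eq0 negb_or a0 x0 eqxx.
pose H : 'M[F]_(r, #|P|) := \matrix_(i, j) (enum_val j : 'rV_r) 0 i.
have rowH j : row j H^T = enum_val j by apply/rowP=> i; rewrite !mxE.
have colH j : col j H = (enum_val j)^T by apply/colP=> i; rewrite !mxE.
have enumP (j : 'I_#|P|) : (enum_val j != 0 :> 'rV_r) /\ line_rep (enum_val j) = enum_val j.
  by have := enum_valP j; rewrite inE => /andP[? /eqP].
have line (j : 'I_#|P|) (x : 'rV[F]_r) a : x != 0 -> a *: enum_val j = x -> enum_val j = line_rep x.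
  move=> x0 e; have a0 : a != 0 by apply: contra x0 => /eqP a0;
    rewrite -e a0 scale0r.
  by rewrite -e line_repZ //; have [_ ->] := enumP j.
exists #|P|, H; split; [split=> [j|U dU]|move=> x x0].
- by rewrite colH trmx_eq0; have [] := enumP j.
- have vU : vpick U != 0 by rewrite vpick0 -dimv_eq0 dU.
  have eU : U = <[vpick U]>%VS.
    apply/esym/eqP; rewrite eqEdim dU dim_vline vU leqnn andbT.
    by rewrite -memvE memv_pick.
  have x0 : (vpick U)^T != 0 by rewrite trmx_eq0.
  pose j0 := enum_rank_in (repIn _ x0) (line_rep (vpick U)^T).
  have ej0 : enum_val j0 = line_rep (vpick U)^T by rewrite enum_rankK_in ?repIn.
  exists j0; split=> [|j jU].
    rewrite colH ej0; have [a a0 ->] := line_repP (vpick U)^T.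
    by rewrite linearZ /= trmxK {1}eU; apply/esym/eqP;
      rewrite eqEdim !dim_vline scaler_eq0
      (negbTE a0) vU leqnn andbT -memvE memvZ ?memv_line.
  have : vpick U \in <[col j H]>%VS by rewrite -jU memv_pick.
  case/vlineP=> a e; apply: enum_val_inj; rewrite ej0; apply/esym/(line _ _ a x0).
  by rewrite e colH linearZ /= trmxK.
rewrite /multiplicity; apply/eqP/cards1P.
exists (enum_rank_in (repIn _ x0) (line_rep x)); apply/setP=> j;
  rewrite inE [RHS]inE rowH.
apply/existsP/eqP => [[a /eqP /(line _ _ _ x0) e]|->].
  by apply: enum_val_inj; rewrite e enum_rankK_in ?repIn.
rewrite enum_rankK_in ?repIn //; have [a a0 ->] := line_repP x.
by exists a^-1; rewrite scalerK.
Qed.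

End HammingMatrix.

(** * Meeting supports *)

Lemma dual_code_basis (F : finFieldType) (n : nat) (C : {set 'rV[F]_n}) :
  linear_code C -> exists r (A : 'M[F]_(r, n)),
    [/\ row_free A, forall w, (w \in dual_code C) = (w <= A)%MS & C = nullsp A].
Proof.
move=> C_linear; have [r [A [fA WA]]] := linear_code_basis (dual_linear C).
exists r, A; split=> //; apply: parity_check_of_dual => // [i|w].
  by rewrite WA row_sub.
by rewrite WA.
Qed.

(** With radius 1 every non-codeword has a codeword neighbour, so every nonzero syndrome occurs
    among the columns, and then with multiplicity gamma_1. *)
Lemma radius1_hamming (F : finFieldType) (n : nat) (C : {set 'rV[F]_n}) :
  linear_code C -> completely_regular C ->
  (forall i, delta_mx 0 i \notin C) -> covering_radius C = 1%N ->
  exists (m r : nat) (D : {set 'rV[F]_m}) (H : 'M[F]_(r, m)),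
    [/\ hamming_code D, parity_check H D
      & code_equiv C (nullsp (hcopies (gamma C 1) H))].
Proof.
move=> C_linear C_cr C_delta C_rad.
have [r [A [fA _ CA]]] := dual_code_basis C_linear.
rewrite {}CA in C_linear C_cr C_delta C_rad *.
have A0 := row_nonzero C_delta.
have surj x : exists y : 'rV_n, y *m A^T = x.
  have : row_full A^T by rewrite /row_full mxrank_tr.
  by move/row_fullP=> [B BA]; exists (x *m B); rewrite -mulmxA BA mulmx1.
have NA x : x != 0 -> multiplicity A x = gamma (nullsp A) 1.
  move=> x0; have [y yx] := surj x; apply: (multiplicity_gamma C_cr C_delta) => //.
  have yC : y \notin nullsp A by rewrite nullspE yx.
  have y1 : code_dist (nullsp A) y = 1%N.
    apply/eqP; rewrite eqn_leq lt0n code_dist_eq0 // yC andbT.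
    by rewrite -C_rad code_dist_le_radius.
  have [c yc] := code_dist_descend C_linear y1.
  move=> /eqP; rewrite code_dist_eq0 // => cC.
  rewrite -yx -card_nullsp_nbrs ?yx //.
  by apply/card_gt0P; exists c; rewrite in_set cC.
(* With no parity checks the code would be the whole space, of covering radius 0. *)
have r0 : (0 < r)%N.
  case: r A {C_linear fA surj NA} A0 C_cr C_delta C_rad => // A A0 _ C_delta C_rad.
  have : covering_radius (nullsp A) == 0%N.
    rewrite -leqn0; apply/bigmax_leqP => x _; rewrite leqn0.
    rewrite code_dist_eq0 ?nullspE; last exact: nullsp_linear.
    by apply/eqP/rowP=> -[].
  by rewrite C_rad.
have [m [H [hH H1]]] := exists_hamming_mx F r.
exists m, r, (nullsp H), H; split=> //; first by exists r, H.
apply: code_equiv_of_multiplicity => // [j|x x0].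
  have -> : row j (hcopies (gamma (nullsp A) 1) H)^T = row (tagnat.sig2 j) H^T.
    by apply/rowP=> i; rewrite !mxE.
  by have [h _] := hH; rewrite -tr_col trmx_eq0.
by rewrite multiplicity_hcopies H1 // muln1 NA.
Qed.

Section MeetingWords.
Variables (F : finFieldType) (n : nat).
Implicit Types (a b u v w : 'rV[F]_n).

Definition overlap a b : nat := #|[set i | (a 0 i != 0) && (b 0 i != 0)]|.

Definition meets a b : bool := [exists i, (a 0 i != 0) && (b 0 i != 0)].

Lemma overlapC a b : overlap a b = overlap b a.
Proof. by apply: eq_card => i; rewrite !inE andbC. Qed.

Lemma overlap_gt0 a b : (0 < overlap a b)%N = meets a b.
Proof.
apply/card_gt0P/existsP => -[i]; first by rewrite inE; exists i.
by move=> h; exists i; rewrite inE.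
Qed.

Lemma overlap_eq0 a b : (overlap a b == 0%N) = ~~ meets a b.
Proof. by rewrite -overlap_gt0 lt0n negbK. Qed.

Lemma overlap_sum a b : overlap a b = (\sum_i ((a 0%R i != 0%R) && (b 0%R i != 0%R)))%N.
Proof.
rewrite /overlap -sum1_card big_mkcond; apply: eq_bigr => i _.
by rewrite inE; case: ifP.
Qed.

Lemma meetsC a b : meets a b = meets b a.
Proof. by apply: eq_existsb => i; rewrite andbC. Qed.

Lemma meets_self a : a != 0 -> meets a a.
Proof. by case/rV0Pn=> i ai; apply/existsP; exists i; rewrite ai. Qed.

Lemma meetsZ l a b : l != 0 -> meets (l *: a) b = meets a b.
Proof.
by move=> l0; apply: eq_existsb => i; rewrite mxE mulf_eq0 (negbTE l0).
Qed.

Lemma meetsP a b : reflect (exists2 i, a 0 i != 0 & b 0 i != 0) (meets a b).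
Proof.
by apply: (iffP existsP) => [[i /andP[]]|[i ai bi]]; exists i; rewrite // ai.
Qed.

Lemma weight_overlap a b : (weight (a + b) + overlap a b <= weight a + weight b)%N.
Proof.
rewrite !weight_sum overlap_sum -!big_split /=; apply: leq_sum => i _.
rewrite mxE; have [->|a0] := eqVneq (a 0 i) 0; first by rewrite add0r addn0.
by case: (b 0 i =P 0) => [->|_]; rewrite ?addr0 ?a0 //= leq_add2r; case: eqP.
Qed.

Lemma weightD_disjoint a b : ~~ meets a b -> weight (a + b) = (weight a + weight b)%N.
Proof.
move/existsPn=> h; rewrite !weight_sum -big_split; apply: eq_bigr => i _ /=.
have := h i; rewrite mxE negb_and !negbK => /orP[/eqP->|/eqP->].
  by rewrite add0r eqxx.
by rewrite addr0 eqxx addn0.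
Qed.

Lemma weight_sum_disjoint (I : finType) (w : I -> 'rV[F]_n) :
  (forall j k, meets (w j) (w k) -> j = k) ->
  weight (\sum_j w j) = (\sum_j weight (w j))%N.
Proof.
move=> h; rewrite weight_sum; under [RHS]eq_bigr => j _ do rewrite weight_sum.
rewrite exchange_big; apply: eq_bigr => i _ /=; rewrite summxE.
have [/existsP[j wj]|] := boolP [exists j, w j 0 i != 0].
  have z k : k != j -> w k 0 i = 0.
    move=> kj; apply/eqP; apply: contraNT kj => wk; apply/eqP/h.
    by apply/meetsP; exists i.
  rewrite (bigD1 j) //= [X in _ + X]big1; last by move=> k /z.
  rewrite addr0 wj [RHS](bigD1 j) //= wj big1 // => k /z->.
  by rewrite eqxx.
move/existsPn=> z; rewrite !big1 ?eqxx // => j _;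
  first by rewrite (eqP (negbNE (z j))) eqxx.
exact: (eqP (negbNE (z j))).
Qed.

(* Each coordinate of supp b is killed by exactly one scalar l. *)
Lemma sum_weight_pencil a b :
  (\sum_(l : F) weight (a + l *: b) + #|F| * overlap a b
   = #|F|.-1 * weight b + #|F| * weight a)%N.
Proof.
have q0 : (0 < #|F|)%N by apply/card_gt0P; exists 0.
under eq_bigr => l _ do rewrite weight_sum.
rewrite exchange_big overlap_sum !weight_sum !big_distrr -!big_split /=.
apply: eq_bigr => i _; under eq_bigr => l _ do rewrite !mxE.
have [b0|b0] := eqVneq (b 0 i) 0.
  under eq_bigr => l _ do rewrite b0 mulr0 addr0.
  by rewrite sum_nat_const andbF !muln0 add0n addn0.
rewrite andbT muln1; congr (_ + _)%N.
rewrite (bigD1 (- a 0 i / b 0 i)) //= mulfVK // subrr eqxx add0n.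
rewrite (eq_bigr (fun=> 1%N)) => [|l lx].
  by rewrite sum1_card cardC1.
suff -> : a 0 i + l * b 0 i != 0 by [].
apply: contra lx => /eqP e; apply/eqP/(mulIf b0).
by rewrite mulfVK //; apply/eqP; rewrite -addr_eq0 addrC e.
Qed.

End MeetingWords.

(** * Transitive case *)

Section ArithmeticWeights.
Variables (F : finFieldType) (n R t : nat) (W : {set 'rV[F]_n}).
Implicit Types (a b c u v w : 'rV[F]_n).
Hypothesis W_linear : linear_code W.
Hypothesis t_gt0 : (0 < t)%N.
Hypothesis W_weights :
  forall u, u \in W -> exists2 j, (j <= R)%N & weight u = (j * t)%N.

Local Notation T := (minwords t W).

Lemma minword_light w : w \in W -> w != 0 -> (weight w < 2 * t)%N -> w \in T.
Proof.
move=> wW; rewrite -weight_eq0 => w0 wlt; apply/minwordP; split=> //.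
have [j _ wj] := W_weights wW; move: w0 wlt; rewrite wj muln_eq0 ltn_pmul2r //.
by case: j {wj} => [|[|]] //; rewrite mul1n.
Qed.

Lemma minword_sum_meets a b : a \in T -> b \in T -> a + b != 0 -> meets a b ->
  a + b \in T.
Proof.
move=> aT bT ab0; rewrite -overlap_gt0 => ov; apply: minword_light => //.
  by apply: codeD => //; apply: (@minword_in _ _ t).
have := weight_overlap a b; rewrite (minword_weight aT) (minword_weight bT).
lia.
Qed.

(** The whole pencil lies in T, so [sum_weight_pencil] reads [q t + q overlap = (q - 1) t + q t]. *)
Lemma overlap_minwords a b : a \in T -> b \in T -> meets a b ->
  (forall l, a != l *: b) -> (#|F| * overlap a b = #|F|.-1 * t)%N.
Proof.
move=> aT bT ab npr; have := sum_weight_pencil a b.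
rewrite (eq_bigr (fun=> t)) => [|l _].
  by rewrite sum_nat_const !(@minword_weight _ _ t W) // addnC => /addIn.
have [->|l0] := eqVneq l 0; first by rewrite scale0r addr0 (minword_weight aT).
apply: (@minword_weight _ _ t W); apply: minword_sum_meets => //;
  first exact: minwordZ.
  by rewrite addr_eq0 -scaleNr.
by rewrite meetsC meetsZ // meetsC.
Qed.

Lemma minwordB_disjoint a b : a \in T -> b \in T -> a - b \in T -> meets a b.
Proof.
move=> aT bT /minword_weight abt; apply: contraTT t_gt0 => nab.
have : weight (a - b) = (t + t)%N.
  rewrite weightD_disjoint ?weightN ?(@minword_weight _ _ t W) // -scaleN1r meetsC meetsZ //.
    by rewrite meetsC.
  by rewrite oppr_eq0 oner_eq0.
by rewrite abt; lia.
Qed.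

Definition meeting_transitive := forall a b c, a \in T -> b \in T -> c \in T ->
  meets a b -> meets b c -> meets a c.

(** If [a] and [c] were disjoint, their overlaps with [b] would be disjoint parts of [b] of total
    size [2 t (q - 1) / q], which exceeds t when q > 2. *)
Lemma meeting_transitive_gt2 : (2 < #|F|)%N -> meeting_transitive.
Proof.
move=> q2 a b c aT bT cT ab bc.
have [/existsP[l /eqP al]|/existsPn nal] := boolP [exists l, a == l *: b].
  have l0 : l != 0 by apply: contraTneq aT => l0;
    apply: contraT => /negbNE/(minword_neq0 t_gt0); rewrite al l0 scale0r eqxx.
  by rewrite al meetsZ.
have [/existsP[l /eqP cl]|/existsPn ncl] := boolP [exists l, c == l *: b].
  have l0 : l != 0 by apply: contraTneq cT => l0;
    apply: contraT => /negbNE/(minword_neq0 t_gt0); rewrite cl l0 scale0r eqxx.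
  by rewrite cl meetsC meetsZ // meetsC.
apply: contraT => nac.
have ov1 := overlap_minwords aT bT ab nal.
have ov2 := overlap_minwords cT bT (etrans (meetsC c b) bc) ncl.
have : (overlap a b + overlap c b <= weight b)%N.
  rewrite !overlap_sum weight_sum -big_split; apply: leq_sum => i _ /=.
  have /existsPn/(_ i) := nac.
  by case: (a 0 i != 0); case: (b 0 i != 0); case: (c 0 i != 0).
rewrite (@minword_weight _ _ t W) //.
rewrite -(leq_pmul2l (ltn_trans (isT : (0 < 2)%N) q2)) mulnDr ov1 ov2 -mulnDl.
by rewrite leq_pmul2r //; lia.
Qed.

Hypothesis R_gt0 : (0 < R)%N.
Hypothesis W_weights_attained :
  forall j, (j <= R)%N -> exists2 u, u \in W & weight u = (j * t)%N.
Hypothesis T_generates :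
  forall S : {set 'rV[F]_n}, linear_code S -> T \subset S -> W \subset S.
Hypothesis T_sum_decomp : forall u v, u \in W -> v \in W -> weight u = weight v ->
  #|[set b in T | u - b \in T]| = #|[set b in T | v - b \in T]|.

(** Meeting is now an equivalence on T, and each class together with 0 is a subspace. All classes
    have the same size, hence the same dimension [s], because decomposition counts depend on the
    weight only. *)
Lemma transitive_components : meeting_transitive ->
  exists s (A : 'I_R -> 'M[F]_(s, n)),
    [/\ forall j (u : 'rV_s), u != 0 -> u *m A j \in T,
        forall j k (u v : 'rV_s), meets (u *m A j) (v *m A k) -> j = k
      & forall w, w \in W -> (w <= \mxcol_j A j)%MS].
Proof.
move=> tr.
(* Equivalent words satisfy the same predicate, so [pick] selects one representative per class. *)
pose rep a := odflt a [pick b in T | meets a b].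
have repP a : a \in T -> rep a \in T /\ meets a (rep a).
  rewrite /rep; case: pickP => [b /andP[bT ab] _|h aT]; first by [].
  by have := h a; rewrite /= aT meets_self ?(minword_neq0 t_gt0 aT).
have rep_eq a b : a \in T -> b \in T -> meets a b -> rep a = rep b.
  move=> aT bT ab; rewrite /rep (eq_pick (Q := fun c =>
    (c \in T) && meets b c)) => [|c].
    by case: pickP => // /(_ b); rewrite /= bT meets_self ?(minword_neq0 t_gt0 bT).
  case: (boolP (c \in T)) => //= cT; apply/idP/idP => h.
    by apply: (tr b a c) => //; rewrite meetsC.
  exact: (tr a b c).
pose Rp := rep @: T; pose e (j : 'I_#|Rp|) : 'rV[F]_n := enum_val j.
have eT j : e j \in T.
  by have /imsetP[a aT ->] : e j \in Rp := enum_valP j; case: (repP a aT).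
have rep_e j : rep (e j) = e j.
  have /imsetP[a aT ->] : e j \in Rp := enum_valP j.
  by have [rT am] := repP a aT; rewrite [RHS](rep_eq a (rep a)).
have e_inj j k : meets (e j) (e k) -> j = k.
  by move=> m; apply: enum_val_inj; rewrite -/(e j) -/(e k) -rep_e (rep_eq _ (e k)).
pose V j := 0 |: [set w in T | meets (e j) w].
have VT j w : w \in V j -> w != 0 -> w \in T /\ meets (e j) w.
  by rewrite in_setU1 in_set => /orP[->|/andP[]].
have VZ j l w : w \in V j -> l *: w \in V j.
  have [->|l0] := eqVneq l 0; first by rewrite scale0r setU11.
  rewrite !in_setU1 ![_ \in [set _ in T | _]]in_set => /orP[/eqP->|/andP[wT m]].
    by rewrite scaler0 eqxx.
  by rewrite minwordZ // meetsC meetsZ // meetsC m orbT.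
have VD j u v : u \in V j -> v \in V j -> u + v \in V j.
  move=> uV vV; have [->|u0] := eqVneq u 0; first by rewrite add0r.
  have [->|v0] := eqVneq v 0; first by rewrite addr0.
  have [->|uv0] := eqVneq (u + v) 0; first exact: setU11.
  have [uT eu] := VT j u uV u0; have [vT ev] := VT j v vV v0.
  have uvT : u + v \in T.
    by apply: minword_sum_meets => //; apply: (tr u (e j) v) => //; rewrite meetsC.
  rewrite in_setU1 in_set uvT /=; apply/orP; right.
  have /existsP[i /andP[uvi _]] := meets_self uv0.
  have [ui|ui] := eqVneq (u 0 i) 0.
    apply: (tr (e j) v) => //; apply/meetsP; exists i => //.
    by move: uvi; rewrite mxE ui add0r.
  by apply: (tr (e j) u) => //; apply/meetsP; exists i.
have V_linear j : linear_code (V j).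
  by split=> [|l u v uV vV]; [exact: setU11|apply: VD => //; apply: VZ].
(* Besides 0 and [e j], the subspace consists of the [b] in T with [e j - b] in T, a count given by
   the weight of [e j]. *)
have V_card j : #|V j| = (#|[set b in T | (e j - b)%R \in T]|).+2.
  have e0 := minword_neq0 t_gt0 (eT j).
  rewrite (cardsD1 0 (V j)) setU11 (cardsD1 (e j)) in_setD1 e0 in_setU1 in_set.
  rewrite eT meets_self // orbT /= !add1n; congr _.+2.
  apply: eq_card => b; rewrite in_setD1 in_setD1 [in RHS]in_set.
  apply/and3P/andP => [[be b0 bV]|[bT ebT]].
    have [bT eb] := VT j b bV b0; split=> //.
    have : e j - b \in V j.
      by rewrite VD // -?scaleN1r ?VZ // in_setU1 in_set eT meets_self // orbT.
    by case/VT; rewrite // subr_eq0 eq_sym.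
  split; last by rewrite in_setU1 in_set bT minwordB_disjoint // orbT.
    by apply: contraTneq ebT => ->; rewrite subrr;
      apply/negP => /(minword_neq0 t_gt0); rewrite eqxx.
  exact: (minword_neq0 t_gt0 bT).
have [a0 a0T] : exists a, a \in T.
  have [a aW] := W_weights_attained R_gt0; rewrite mul1n => at_.
  by exists a; apply/minwordP.

pose j0 : 'I_#|Rp| := enum_rank_in (imset_f rep a0T) (rep a0).
have [s [A0 [fA0 VA0]]] := linear_code_basis (V_linear j0).
have basis j : exists A : 'M[F]_(s, n), row_free A /\ forall w,
  (w \in V j) = (w <= A)%MS.
  have [r [A [fA VA]]] := linear_code_basis (V_linear j).
  suff rs : r = s by rewrite -rs; exists A.
  apply: (@expnI #|F|); first exact: finRing_gt1.
  rewrite -(card_row_space fA) -(card_row_space fA0).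
  have -> : [set w : 'rV[F]_n | (w <= A)%MS] = V j by apply/setP=> w;
    rewrite in_set VA.
  have -> : [set w : 'rV[F]_n | (w <= A0)%MS] = V j0 by apply/setP=> w;
    rewrite in_set VA0.
  rewrite !V_card; congr _.+2; apply: T_sum_decomp;
    rewrite ?(@minword_in _ _ t W) //.
  by rewrite !(@minword_weight _ _ t W).
have [A hA] := fin_all_exists basis.
have AV j (u : 'rV_s) : u *m A j \in V j by have [_ ->] := hA j; rewrite submxMl.
have AT j (u : 'rV[F]_s) : u != 0 -> u *m A j \in T.
  move=> u0; have [fA _] := hA j.
  suff /(VT j _ (AV j u))[] : u *m A j != 0 by [].
  by apply: contra u0 => /eqP u0; apply/eqP/(row_free_inj fA); rewrite u0 mul0mx.
have meetA j k (u v : 'rV[F]_s) : meets (u *m A j) (v *m A k) -> j = k.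
  move=> m; have [i ui vi] := meetsP _ _ m.
  have u0 : u *m A j != 0 by apply: contraNneq ui => ->; rewrite mxE.
  have v0 : v *m A k != 0 by apply: contraNneq vi => ->; rewrite mxE.
  have [uT eu] := VT j _ (AV j u) u0; have [vT ev] := VT k _ (AV k v) v0.
  apply: e_inj; apply: (tr _ (u *m A j)) => //; apply: (tr _ (v *m A k)) => //.
  by rewrite meetsC.
have gen w : w \in W -> (w <= \mxcol_j A j)%MS.
  pose S := [set w : 'rV[F]_n | (w <= \mxcol_j A j)%MS].
  suff /subsetP WS : W \subset S by move/WS; rewrite in_set.
  apply: T_generates.
    split=> [|l u v]; rewrite !in_set ?sub0mx // => uA vA.
    by rewrite addmx_sub ?scalemx_sub.
  apply/subsetP=> a aT; rewrite in_set.
  pose j : 'I_#|Rp| := enum_rank_in (imset_f rep aT) (rep a).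
  have ej : e j = rep a by rewrite /e enum_rankK_in // imset_f.
  have : a \in V j.
    by rewrite in_setU1 in_set aT ej meetsC; have [_ ->] := repP a aT; rewrite orbT.
  have [_ ->] := hA j => /submxP[u ->].
  apply/submxP; exists (\mxrow_k (if k == j then u else 0)).
  rewrite mul_mxrow_mxcol (bigD1 j) //= eqxx big1 ?addr0 // => k /negbTE->.
  by rewrite mul0mx.
have wE (v : 'rV_(\sum_(j < #|Rp|) s)) :
    (weight (v *m \mxcol_j A j) = (#|[set j | submxrow v j != 0%R]|) * t)%N.
  rewrite -{1}[v]submxrowK mul_mxrow_mxcol weight_sum_disjoint;
    last by move=> j k /meetA.
  rewrite -[X in (X * t)%N]sum1_card big_distrl [RHS]big_mkcond /=;
    apply: eq_bigr => j _.
  rewrite in_set mul1n; case: ifP => [/AT/minword_weight //|/negbFE/eqP->].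
  by rewrite mul0mx weight0.
(* Weights count nonzero components in units of t. The sum of all [e j] has weight [#|Rp| * t], and
   the weight [R * t] is attained. *)
have kR : #|Rp| = R.
  apply/eqP; rewrite eqn_leq; apply/andP; split; last first.
    have [w /gen/submxP[v ->]] := W_weights_attained (leqnn R).
    rewrite wE => /eqP; rewrite eqn_pmul2r // => /eqP <-.
    by rewrite -[X in (_ <= X)%N]card_ord max_card.
  have : \sum_j e j \in W.
    by elim/big_rec: _ => [|j v _ vW]; rewrite ?code0 ?codeD // (minword_in (eT j)).
  case/W_weights=> m mR; rewrite weight_sum_disjoint; last by move=> j k /e_inj.
  rewrite (eq_bigr (fun=> t)) => [|j _]; last exact: (minword_weight (eT j)).
  by rewrite sum_nat_const card_ord => /eqP; rewrite eqn_pmul2r // => /eqP->.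
by rewrite -kR; exists s, A.
Qed.

End ArithmeticWeights.

(** * Powers of a code and block diagonal parity checks *)

Section ProductCode.
Variables (F : finFieldType) (k s m : nat) (G : 'M[F]_(s, m)).

Definition diag_copies : 'M[F]_(\sum_(i < k) s, \sum_(j < k) m) :=
  \mxblock_(i < k, j < k) (if i == j then G else 0).

Lemma mul_diag_copies (u : 'rV_(\sum_(i < k) s)) :
  u *m diag_copies = \mxrow_j (submxrow u j *m G).
Proof.
rewrite -{1}[u]submxrowK mul_mxrow_mxblock; apply: eq_mxrow => j.
rewrite (bigD1 j) //= eqxx big1 ?addr0 // => i /negbTE->.
by rewrite mulmx0.
Qed.

Lemma mul_tr_diag_copies (x : 'rV_(\sum_(j < k) m)) :
  x *m diag_copies^T = \mxrow_i (submxrow x i *m G^T).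
Proof.
rewrite tr_mxblock -{1}[x]submxrowK mul_mxrow_mxblock; apply: eq_mxrow => j.
rewrite (bigD1 j) //= eqxx big1 ?addr0 // => i /negbTE ij.
by rewrite eq_sym ij trmx0 mulmx0.
Qed.

Lemma nullsp_diag_copies : nullsp diag_copies = code_power k (nullsp G).
Proof.
apply/setP=> x; rewrite nullspE mul_tr_diag_copies in_set.
apply/eqP/forallP => [x0 j|x0].
  by rewrite nullspE -[_ *m _](mxrowK (fun i => submxrow x i *m G^T)) x0 submxrow0.
by rewrite -mxrow0; apply: eq_mxrow => j; apply/eqP; rewrite -nullspE.
Qed.

Lemma row_diag_copies : (forall j, row j G^T != 0) ->
  forall i, row i diag_copies^T != 0.
Proof.
move=> G0 i; have /rV0Pn[p] := G0 (tagnat.sig2 i); rewrite mxE mxE => gp.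
apply/rV0Pn; exists (tagnat.Rank (tagnat.sig1 i) p);
  rewrite mxE mxE /diag_copies mxE.
set l := tagnat.sig1 i; set p' := tagnat.sig2 _.
have -> : p' = p by apply: val_inj; rewrite /p' tagnat.Rank2K.
by rewrite tagnat.Rank1K eqxx.
Qed.

End ProductCode.

(** Cut one component down to its support to get [G], whose nonzero combinations all have weight t.
    The other components may differ from it, but [\mxcol_j A j] has the same weights as the block
    diagonal matrix of copies of [G], and weights determine the code up to equivalence. *)
Lemma constant_weight_components (F : finFieldType) (n k s t : nat)
    (A : 'I_k -> 'M[F]_(s, n)) :
  (0 < n)%N -> (0 < k)%N -> (0 < t)%N ->
  (forall i, row i (\mxcol_j A j)^T != 0) ->
  (forall j (u : 'rV_s), u != 0 -> weight (u *m A j) = t) ->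
  (forall j l (u v : 'rV_s), meets (u *m A j) (v *m A l) -> j = l) ->
  exists (m : nat) (C1 : {set 'rV[F]_m}),
    [/\ completely_regular C1, covering_radius C1 = 1%N
      & code_equiv (nullsp (\mxcol_j A j)) (code_power k C1)].
Proof.
move=> n0 k0 t0 A0 At Am; pose j0 := Ordinal k0.
have s0 : (0 < s)%N.
  have /rV0Pn[p _] := A0 (Ordinal n0).
  exact: leq_ltn_trans (leq0n _) (ltn_ord (tagnat.sig2 p)).
pose D := [set i | row i (A j0)^T != 0].
pose G : 'M[F]_(s, #|D|) := \matrix_(a, b) A j0 a (enum_val b).
have rowG b : row b G^T = row (enum_val b) (A j0)^T.
  by apply/rowP=> a; rewrite !mxE.
have G0 b : row b G^T != 0 by rewrite rowG; have := enum_valP b; rewrite inE.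
have wG (u : 'rV_s) : weight (u *m G) = weight (u *m A j0).
  rewrite !weight_sum.
  under eq_bigr => b _ do rewrite mulmx_tr_dot rowG -mulmx_tr_dot.
  rewrite -(big_enum_val (fun i => nat_of_bool ((u *m A j0) 0 i != 0))).
  rewrite big_mkcond; apply: eq_bigr => i _.
  rewrite inE; case: eqP => //= i0.
  by rewrite mulmx_tr_dot i0 dot0r eqxx.
have Gt (u : 'rV_s) : u != 0 -> weight (u *m G) = t by move/(At j0); rewrite wG.
have q0 : (0 < #|F|)%N by apply/card_gt0P; exists 0.
have NG := multiplicity_constant_weight Gt.
(* The common multiplicity forced by the constant weight t; the division is exact by [NG]. *)
pose nu := ((#|F| * t) %/ (#|F| ^ s))%N.
have NGnu (x : 'rV_s) : x != 0 -> multiplicity G x = nu.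
  by move=> x0; rewrite /nu -(NG x x0) mulKn // expn_gt0 q0.
have [x1 x10] : exists x : 'rV[F]_s, x != 0.
  exists (const_mx 1); apply/rV0Pn; exists (Ordinal s0); rewrite mxE.
  exact: oner_neq0.
have nu0 : (0 < nu)%N.
  rewrite -(NGnu x1 x10) lt0n; apply/eqP=> N0; have := NG x1 x10.
  by rewrite N0 muln0 => /esym/eqP; rewrite muln_eq0 !gtn_eqF.
have D0 : (0 < #|D|)%N.
  have := t0; rewrite -(Gt x1 x10) => /card_gt0P[b _].
  exact: leq_ltn_trans (leq0n _) (ltn_ord b).
have [G_cr G_rad] := constant_multiplicity_cr nu0 D0 G0 NGnu.
exists #|D|, (nullsp G); split=> //; rewrite -nullsp_diag_copies.
apply: code_equiv_of_multiplicity => //; first exact: row_diag_copies.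
move=> x x0; apply/eqP; rewrite -(eqn_pmul2l (isT : (0 < 1)%N)); apply/eqP.
apply: multiplicity_proportional x x0 => u; rewrite !mul1n.
rewrite -{1}[u]submxrowK mul_mxrow_mxcol weight_sum_disjoint;
  last by move=> j l /Am.
rewrite mul_diag_copies weight_mxrow; apply: eq_bigr => j _; rewrite mxrowK wG.
by have [->|u0] := eqVneq (submxrow u j) 0; rewrite ?mul0mx ?weight0 // !At.
Qed.

(** * Block families over the field with two elements *)

Section TwoElements.
Variable F : finFieldType.
Hypothesis F2 : #|F| = 2%N.

Lemma field2_cases (x : F) : x = 0 \/ x = 1.
Proof.
have [->|x0] := eqVneq x 0; [by left|right; apply/eqP; apply: contraT => x1].
have : (#|[set 0%R; 1%R; x]| <= #|F|)%N by exact: max_card.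
by rewrite F2 setUC cardsU1 !inE negb_or x0 x1 cards2 eq_sym oner_eq0.
Qed.

Lemma field2_neq0 (x : F) : x != 0 -> x = 1.
Proof. by case: (field2_cases x) => -> //; rewrite eqxx. Qed.

Lemma field2_opp (x : F) : - x = x.
Proof.
case: (field2_cases x) => ->; first exact: oppr0.
by apply: field2_neq0; rewrite oppr_eq0 oner_eq0.
Qed.

Lemma row2_opp n (x : 'rV[F]_n) : - x = x.
Proof. by apply/rowP=> i; rewrite mxE field2_opp. Qed.

Lemma row2_addxx n (x : 'rV[F]_n) : x + x = 0.
Proof. by rewrite -{1}[x]row2_opp addNr. Qed.

Lemma row2_eq n (x y : 'rV[F]_n) :
  (forall i, (x 0 i != 0) = (y 0 i != 0)) -> x = y.
Proof.
move=> h; apply/rowP=> i; have := h i.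
by case: (field2_cases (x 0 i)) => ->; case: (field2_cases (y 0 i)) => ->;
   rewrite ?eqxx ?oner_eq0.
Qed.

Lemma field2_add_neq0 (x y : F) : (x + y != 0) = (x != 0) (+) (y != 0).
Proof.
case: (field2_cases x) => ->; case: (field2_cases y) => ->;
  rewrite ?add0r ?addr0 ?eqxx ?oner_eq0 //.
by rewrite -{1}[1]field2_opp addNr eqxx.
Qed.

Lemma overlap_le_l n (a b : 'rV[F]_n) : (overlap a b <= weight a)%N.
Proof. by apply/subset_leq_card/subsetP=> i; rewrite !inE => /andP[]. Qed.

Lemma overlap_le_r n (a b : 'rV[F]_n) : (overlap a b <= weight b)%N.
Proof. by rewrite overlapC overlap_le_l. Qed.

Lemma overlap_eq_weight n (a b : 'rV[F]_n) : overlap a b = weight b ->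
  forall i, b 0 i != 0 -> a 0 i != 0.
Proof.
move=> e i bi.
have : [set i | (a 0 i != 0) && (b 0 i != 0)] == [set i | b 0 i != 0].
  rewrite eqEcard; apply/andP; split; last by rewrite -/(weight b) -e.
  by apply/subsetP=> j; rewrite !inE => /andP[].
by move/eqP/setP/(_ i); rewrite !inE bi andbT.
Qed.

Lemma weight2D n (a b : 'rV[F]_n) :
  (weight (a + b) + 2 * overlap a b = weight a + weight b)%N.
Proof.
rewrite !weight_sum overlap_sum big_distrr -!big_split /=; apply: eq_bigr => i _.
by rewrite mxE field2_add_neq0; case: (a 0 i != 0); case: (b 0 i != 0).
Qed.

Lemma overlapDr n (d x y : 'rV[F]_n) : ~~ meets x y ->
  overlap d (x + y) = (overlap d x + overlap d y)%N.
Proof.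
move=> /existsPn xy; rewrite !overlap_sum -big_split; apply: eq_bigr => i _ /=.
have := xy i; rewrite mxE field2_add_neq0.
by case: (d 0 i != 0); case: (x 0 i != 0); case: (y 0 i != 0).
Qed.

Lemma overlap_sum_disjoint n (d : 'rV[F]_n) (B : {set 'rV[F]_n}) :
  {in B &, forall x y, meets x y -> x = y} ->
  overlap d (\sum_(x in B) x) = (\sum_(x in B) overlap d x)%N.
Proof.
move=> B_dis; rewrite overlap_sum.
under [RHS]eq_bigr => x _ do rewrite overlap_sum.
rewrite exchange_big; apply: eq_bigr => i _ /=; rewrite summxE.
have [/existsP[x /andP[xB xi]]|no] := boolP [exists x, (x \in B) && (x 0 i != 0)].
  have z y : (y \in B) && (y != x) -> y 0 i = 0.
    case/andP=> yB yx; apply/eqP; apply: contraNT yx => yi.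
    by apply/eqP/B_dis => //; apply/meetsP; exists i.
  rewrite (bigD1 x) //= big1 ?addr0 //.
  rewrite (bigD1 x) //= big1 ?addn0 // => y /z->.
  by rewrite eqxx andbF.
have z y : y \in B -> y 0 i = 0.
  move=> yB; apply/eqP; apply: contraNT no => yi.
  by apply/existsP; exists y; rewrite yB.
rewrite !big1 ?eqxx ?andbF //; first by move=> y /z->; rewrite eqxx andbF.
Qed.

End TwoElements.

(** * Binary words of weight t as sums of two half-size blocks *)

Section BlockFamilies.
Variables (F : finFieldType) (n R t : nat) (W : {set 'rV[F]_n}).
Implicit Types (a b c d e u v w x y z : 'rV[F]_n) (B : {set 'rV[F]_n}).
Hypothesis F2 : #|F| = 2%N.
Hypothesis W_linear : linear_code W.
Hypothesis t_gt0 : (0 < t)%N.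
Hypothesis W_weights :
  forall u, u \in W -> exists2 j, (j <= R)%N & weight u = (j * t)%N.

Local Notation T := (minwords t W).

Hypothesis T_cover : forall i, exists2 w, w \in T & w 0 i != 0.
Hypothesis T_generates :
  forall S : {set 'rV[F]_n}, linear_code S -> T \subset S -> W \subset S.
Hypothesis T_sum_decomp : forall u v, u \in W -> v \in W -> weight u = weight v ->
  #|[set b in T | u - b \in T]| = #|[set b in T | v - b \in T]|.
Variables (a0 b0 c0 : 'rV[F]_n).
Hypothesis a0T : a0 \in T.
Hypothesis b0T : b0 \in T.
Hypothesis c0T : c0 \in T.
Hypothesis ab0 : meets a0 b0.
Hypothesis bc0 : meets b0 c0.
Hypothesis nac0 : ~~ meets a0 c0.

Let sum_meets := minword_sum_meets W_linear t_gt0 W_weights.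

Lemma meets_sum_mem u v : u \in T -> v \in T -> u != v -> meets u v -> u + v \in T.
Proof.
move=> uT vT uv m; apply: sum_meets => //.
by rewrite addr_eq0 row2_opp.
Qed.

Lemma overlap_half a b : a \in T -> b \in T -> a != b -> meets a b ->
  (2 * overlap a b = t)%N.
Proof.
move=> aT bT ab m; have := overlap_minwords W_linear t_gt0 W_weights aT bT m.
rewrite F2 mul1n; apply=> l; case: (field2_cases F2 l) => ->.
  by rewrite scale0r (minword_neq0 t_gt0 aT).
by rewrite scale1r.
Qed.

Lemma disjoint_neq a b : a \in T -> ~~ meets a b -> a != b.
Proof.
by move=> aT; apply: contraNneq => <-; apply: meets_self (minword_neq0 t_gt0 aT).
Qed.

(* The number of decompositions of a weight-2t word into two minimal words is
   constant, and at least three because of a0 + c0 = b0 + (a0 + c0 - b0). *)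
Lemma disjoint_link a c : a \in T -> c \in T -> ~~ meets a c ->
  exists b, [/\ b \in T, meets a b & meets b c].
Proof.
move=> aT cT nac.
have sumW x y : x \in T -> y \in T -> x + y \in W.
  by move=> xT yT; apply: codeD; rewrite ?(minword_in xT) ?(minword_in yT).
have sum2t x y : x \in T -> y \in T -> ~~ meets x y -> weight (x + y) = (2 * t)%N.
  by move=> xT yT xy; rewrite weightD_disjoint // !(@minword_weight _ _ t W) // mul2n addnn.
pose S u := [set b in T | u - b \in T].
have SS : #|S (a + c)| = #|S (a0 + c0)|.
  by apply: T_sum_decomp; rewrite ?sumW // !sum2t.
have b0S : b0 \in S (a0 + c0).
  have ab : a0 + b0 \in T.
    by apply: meets_sum_mem => //; apply: contraNneq nac0 => ->.
  rewrite in_set b0T row2_opp // addrAC meets_sum_mem //.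
    apply: contraNneq (disjoint_neq a0T nac0) => e.
    have := sum2t _ _ a0T c0T nac0.
    rewrite -e addrA row2_addxx // add0r (minword_weight b0T); move: t_gt0;
      clear; lia.
  have [i bi ci] := meetsP _ _ bc0; apply/meetsP; exists i => //.
  have /existsPn/(_ i) := nac0; rewrite ci andbT negbK => /eqP ai.
  by rewrite mxE ai add0r.
have ends x y : x \in T -> y \in T -> x \in S (x + y) /\ y \in S (x + y).
  by move=> xT yT; split; rewrite in_set ?xT ?yT ?addrK // addrC addKr.
have [a0S c0S] := ends _ _ a0T c0T; have [aS cS] := ends _ _ aT cT.
have S3 : (2 < #|S (a + c)%R|)%N.
  rewrite SS; have <- : #|[set a0; b0; c0]| = 3%N.
    rewrite setUC cardsU1 cards2 !inE negb_or.
    have ->: c0 != a0 by rewrite eq_sym disjoint_neq.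
    have ->: c0 != b0 by apply: contraNneq nac0 => ->.
    by have -> : a0 != b0 by apply: contraNneq nac0 => ->.
  by apply/subset_leq_card/subsetP=> x;
    rewrite !in_setU !in_set1 => /orP[/orP[]|] /eqP->.
have [b bS [ba bc]] : exists2 b, b \in S (a + c) & b != a /\ b != c.
  have : (0 < #|S (a + c)%R :\: [set a; c]|)%N.
    rewrite cardsD subn_gt0; apply: leq_ltn_trans S3.
    by apply: leq_trans (subset_leq_card (subsetIr _ _)) _; rewrite cards2;
      case: eqP.
  case/card_gt0P=> b; rewrite in_setD in_set2 negb_or => /andP[/andP[ba bc] bS].
  by exists b.
have : b \in S (a + c) by []; rewrite in_set => /andP[bT sT].
(* If [b] missed [x], the word [x + y - b] would be the disjoint sum of [x] and [y - b]; having
   weight t, it would force [y = b]. *)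
have meet x y : x \in T -> y \in T -> ~~ meets x y -> b != y -> x + y - b \in T -> meets x b.
  move=> xT yT xy yb xyb; apply: contraT => nxb.
  have dis : ~~ meets x (y - b).
    apply/existsPn=> i; move/existsPn/(_ i): xy; move/existsPn/(_ i): nxb.
    rewrite !mxE field2_opp // field2_add_neq0 //.
    by case: (x 0 i != 0); case: (y 0 i != 0); case: (b 0 i != 0).
  have := minword_weight xyb;
    rewrite -addrA weightD_disjoint // (minword_weight xT).
  move/eqP; rewrite -[X in _ == X]addn0 eqn_add2l weight_eq0 subr_eq0.
  by rewrite eq_sym (negbTE yb).
exists b; split=> //; first exact: (meet a c).
by rewrite meetsC; apply: (meet c a); rewrite // ?[c + a]addrC // meetsC.
Qed.

(** Blocks have half the weight t and so are not words of W; only their pairwise sums are. The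
    boolean form allows a maximal family to be taken with [maxset]. *)
Definition block_family h B :=
  [forall x in B, forall y in B,
     [&& weight x == h, meets x y ==> (x == y) & (x != y) ==> (x + y \in T)]].

Variable h : nat.
Hypothesis h_half : (2 * h = t)%N.

Let h_gt0 : (0 < h)%N.
Proof. by move: t_gt0; rewrite -h_half; case: h. Qed.

Lemma block_familyP B : reflect
  [/\ forall x, x \in B -> weight x = h,
      {in B &, forall x y, meets x y -> x = y}
    & {in B &, forall x y, x != y -> x + y \in T}] (block_family h B).
Proof.
apply: (iffP forall_inP) => [BB|[wB dB sB] x xB].
  have BBP x y : x \in B -> y \in B -> [/\ weight x = h, meets x y -> x = y
      & x != y -> x + y \in T].
    move=> xB yB; have /forall_inP/(_ y yB) := BB x xB.
    by case/and3P=> /eqP w /implyP d /implyP s; split=> // m; apply/eqP/d.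
  by split=> [x xB|x y xB yB|x y xB yB]; have [] := BBP x _ xB ltac:(eassumption).
apply/forall_inP=> y yB; apply/and3P; split; first exact/eqP/wB.
  by apply/implyP=> m; apply/eqP/dB.
by apply/implyP=> ne; apply: sB.
Qed.

Lemma overlap_values d e : d \in T -> e \in T ->
  [\/ overlap d e = 0%N, overlap d e = h | overlap d e = (2 * h)%N].
Proof.
move=> dT eT; have [<-|de] := eqVneq d e.
  constructor 3; rewrite h_half -(minword_weight dT).
  by apply: eq_card => i; rewrite !inE andbb.
have [m|] := boolP (meets d e); last by rewrite -overlap_eq0 => /eqP; constructor 1.
by constructor 2; have := overlap_half dT eT de m; rewrite -h_half; clear; lia.
Qed.

Lemma block_overlap_le B d x : block_family h B -> x \in B -> (overlap d x <= h)%N.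
Proof. by move=> /block_familyP[wB _ _] /wB <-; apply: overlap_le_r. Qed.

Lemma block_types B d : block_family h B -> (2 < #|B|)%N -> d \in T ->
  {in B, forall x, 2 * overlap d x = h}%N \/
  {in B, forall x, overlap d x = 0%N \/ overlap d x = h}.
Proof.
move=> BB B3 dT; have [wB dB sB] := block_familyP _ BB.
have pair x y : x \in B -> y \in B -> x != y ->
   [\/ overlap d x + overlap d y = 0, overlap d x + overlap d y = h
     | overlap d x + overlap d y = 2 * h]%N.
  move=> xB yB xy; rewrite -overlapDr //; first exact/overlap_values/sB.
  by apply: contra xy => /(dB _ _ xB yB)/eqP.
have le x : x \in B -> (overlap d x <= h)%N by apply: block_overlap_le.
have [/existsP[x /and3P[xB x0 xh]]|no] :=
  boolP [exists x, [&& x \in B, overlap d x != 0%N & overlap d x != h]]; last first.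
  right=> x xB; have /existsPn/(_ x) := no; rewrite xB /= negb_and !negbK.
  by case/orP=> /eqP; [left|right].
left; have compl y : y \in B -> y != x -> (overlap d x + overlap d y = h)%N.
  move=> yB yx; have := le x xB; have := le y yB.
  have := pair x y xB yB; rewrite eq_sym => /(_ yx).
  by move=> p; move/eqP: x0; move/eqP: xh; case: p; clear; lia.
have /card_gt1P[y [z [yB zB yz]]] : (1 < #|B :\ x|)%N.
  by move: B3; rewrite (cardsD1 x) xB.
move: yB zB; rewrite !in_setD1 => /andP[yx yB] /andP[zx zB].
have hx : (2 * overlap d x = h)%N.
  have := compl y yB yx; have := compl z zB zx; move/eqP: x0; move/eqP: xh.
  by case: (pair y z yB zB yz); clear; lia.
move=> y' y'B; have [->//|y'x] := eqVneq y' x.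
by have := compl y' y'B y'x; move: hx; clear; lia.
Qed.

Lemma block_sum_overlap B d : block_family h B ->
  overlap d (\sum_(x in B) x) = (\sum_(x in B) overlap d x)%N.
Proof. by move=> /block_familyP[_ dB _]; apply: overlap_sum_disjoint. Qed.

(** The rest of [d] outside [x] is a new block: its sum with another block [y] is [d + (x + y)], a
    sum of two words of T meeting in [x]. *)
Lemma block_extend B d x : block_family h B -> d \in T -> x \in B ->
  overlap d x = h -> {in B, forall y, y != x -> overlap d y = 0%N} ->
  block_family h ((d + x) |: B).
Proof.
move=> BB dT xB dx d0; have [wB dB sB] := block_familyP _ BB.
have dxw : weight (d + x) = h.
  have := weight2D F2 d x; rewrite dx (minword_weight dT) (wB x xB) -h_half;
    clear; lia.
have sub i : x 0 i != 0 -> d 0 i != 0.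
  by apply: overlap_eq_weight; rewrite dx wB.
have dis y : y \in B -> ~~ meets (d + x) y.
  move=> yB; apply/existsPn=> i; rewrite mxE field2_add_neq0 //.
  have [->|yx] := eqVneq y x.
    by have := sub i; case: (x 0 i != 0); case: (d 0 i != 0) => // /(_ isT).
  have := d0 y yB yx; move/eqP; rewrite overlap_eq0 => /existsPn/(_ i).
  have /existsPn/(_ i) : ~~ meets x y.
    by apply: contra yx => /(dB _ _ xB yB)->.
  by case: (x 0 i != 0); case: (y 0 i != 0); case: (d 0 i != 0).
have mem y : y \in B -> d + x + y \in T.
  move=> yB; have [->|yx] := eqVneq y x;
    first by rewrite -addrA row2_addxx // addr0.
  rewrite -addrA; have xyT : x + y \in T by apply: sB => //; rewrite eq_sym.
  apply: sum_meets => //.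
    rewrite addrA -weight_eq0 weightD_disjoint ?dis // dxw -lt0n.
    by rewrite addn_gt0 h_gt0.
  rewrite -overlap_gt0 overlapDr //; first by rewrite dx addn_gt0 h_gt0.
  by apply: contra yx => /(dB _ _ xB yB)->.
apply/block_familyP; split=> [y|y z|y z].
- by rewrite in_setU1 => /orP[/eqP->|/wB].
- rewrite !in_setU1 => /orP[/eqP->|yB] /orP[/eqP->|zB] //.
  + by rewrite (negbTE (dis _ zB)).
  + by rewrite meetsC (negbTE (dis _ yB)).
  exact: dB.
rewrite !in_setU1 => /orP[/eqP->|yB] /orP[/eqP->|zB].
- by rewrite eqxx.
- by move=> _; apply: mem.
- by move=> _; rewrite addrC; apply: mem.
exact: sB.
Qed.

(** With words read as sets, the blocks are the intersection of [a0] and [b0], then [a0] minus [b0],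
    [b0] minus [a0], and [c0] minus [b0]. Since [a0] and [c0] are disjoint and each covers half of
    [b0], the third block is also the intersection of [b0] and [c0], so [block_extend] applies
    again. *)
Lemma exists_block_family4 : exists2 B, block_family h B & (3 < #|B|)%N.
Proof.
have ab : a0 != b0 by apply: contraNneq nac0 => ->.
have bc : b0 != c0 by apply: contraNneq nac0 => <-.
pose p : 'rV[F]_n := \row_i (a0 0 i * b0 0 i).
have pE i : (p 0 i != 0) = (a0 0 i != 0) && (b0 0 i != 0).
  by rewrite mxE mulf_eq0 negb_or.
have ovab : overlap a0 b0 = h by have := overlap_half a0T b0T ab ab0;
  rewrite -h_half; clear; lia.
have ovbc : overlap b0 c0 = h by have := overlap_half b0T c0T bc bc0;
  rewrite -h_half; clear; lia.
have wp : weight p = h by rewrite -ovab; apply: eq_card => i; rewrite !inE pE.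
have oap : overlap a0 p = h.
  by rewrite -wp; apply: eq_card => i; rewrite !inE pE; case: (a0 0 i != 0).
have obp : overlap b0 p = h.
  by rewrite -wp; apply: eq_card => i; rewrite !inE pE; case: (a0 0 i != 0);
    case: (b0 0 i != 0).
have B1 : block_family h [set p].
  apply/block_familyP; split=> [x|x y|x y]; rewrite !in_set1.
  - by move/eqP->.
  - by move=> /eqP-> /eqP->.
  by move=> /eqP-> /eqP->; rewrite eqxx.
have B2 : block_family h ((a0 + p) |: [set p]).
  apply: block_extend => //; first exact: set11.
  by move=> y; rewrite in_set1 => /eqP->; rewrite eqxx.
have nap : meets b0 (a0 + p) = false.
  apply/negbTE/existsPn=> i; rewrite mxE field2_add_neq0 // pE.
  by case: (a0 0 i != 0); case: (b0 0 i != 0).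
have B3 : block_family h ((b0 + p) |: ((a0 + p) |: [set p])).
  apply: block_extend => //; first by rewrite in_setU1 set11 orbT.
  move=> y; rewrite in_setU1 in_set1 => /orP[/eqP-> _|/eqP->]; last by rewrite eqxx.
  by apply/eqP; rewrite overlap_eq0 nap.
have wap : weight (a0 + p) = h.
  by have := weight2D F2 a0 p; rewrite oap (minword_weight a0T) wp -h_half;
    clear; lia.
have wbp : weight (b0 + p) = h.
  by have := weight2D F2 b0 p; rewrite obp (minword_weight b0T) wp -h_half;
    clear; lia.
have c_out x : (forall i, x 0 i != 0 -> a0 0 i != 0) -> overlap c0 x = 0%N.
  move=> sub; apply/eqP; rewrite overlap_eq0; apply/existsPn=> i.
  move/existsPn/(_ i): nac0; have := sub i.
  by case: (c0 0 i != 0); case: (x 0 i != 0); case: (a0 0 i != 0) => // /(_ isT).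
have cp : overlap c0 p = 0%N by apply: c_out => i; rewrite pE => /andP[].
have cap : overlap c0 (a0 + p) = 0%N.
  apply: c_out => i; rewrite mxE field2_add_neq0 // pE.
  by case: (a0 0 i != 0); case: (b0 0 i != 0).
have cbp : overlap c0 (b0 + p) = h.
  rewrite -ovbc; apply: eq_card => i; rewrite !inE mxE field2_add_neq0 // pE.
  by move/existsPn/(_ i): nac0; case: (c0 0 i != 0); case: (b0 0 i != 0);
    case: (a0 0 i != 0).
exists ((c0 + (b0 + p)) |: ((b0 + p) |: ((a0 + p) |: [set p]))).
  apply: block_extend => //; first by rewrite setU11.
  move=> y; rewrite !in_setU1 in_set1 => /or3P[] /eqP-> //.
  by rewrite eqxx.
have wcbp : weight (c0 + (b0 + p)) = h.
  by have := weight2D F2 c0 (b0 + p);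
    rewrite cbp (minword_weight c0T) wbp -h_half; clear; lia.
have occ : overlap c0 (c0 + (b0 + p)) = h.
  rewrite -wcbp; apply: eq_card => i; rewrite !inE mxE field2_add_neq0 //.
  have := @overlap_eq_weight _ _ c0 (b0 + p) (etrans cbp (esym wbp)) i.
  by case: (c0 0 i != 0) => //=; case: ((b0 + p) 0 i != 0) => // /(_ isT).
rewrite !cardsU1 cards1 !in_setU1 !in_set1 !negb_or.
have -> : c0 + (b0 + p) != b0 + p.
  by rewrite -subr_eq0 addrK (minword_neq0 t_gt0 c0T).
have -> : c0 + (b0 + p) != a0 + p by apply/eqP => e; move: occ; rewrite e cap;
  move: h_gt0; clear; lia.
have -> : c0 + (b0 + p) != p by apply/eqP => e; move: occ; rewrite e cp;
  move: h_gt0; clear; lia.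
have -> : b0 + p != a0 + p by rewrite (inj_eq (addIr p)) eq_sym.
have -> : b0 + p != p by rewrite -subr_eq0 addrK (minword_neq0 t_gt0 b0T).
by have -> : a0 + p != p by rewrite -subr_eq0 addrK (minword_neq0 t_gt0 a0T).
Qed.

Lemma block_sum_coord B i : block_family h B ->
  ((\sum_(x in B) x) 0 i != 0) = [exists x in B, x 0 i != 0].
Proof.
move=> /block_familyP[_ dB _]; rewrite summxE.
have [/exists_inP[x xB xi]|no] := boolP [exists x in B, x 0 i != 0].
  rewrite (bigD1 x) //= big1 ?addr0 // => y /andP[yB yx].
  apply/eqP; apply: contraNT yx => yi.
  by apply/eqP/dB => //; apply/meetsP; exists i.
rewrite big1 ?eqxx // => x xB; apply/eqP; apply: contraNT no => xi.
by apply/exists_inP; exists x.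
Qed.

(** Two blocks contained in [d] already exhaust its weight t = 2 h. *)
Lemma block_trichotomy B d : block_family h B -> d \in T ->
  {in B, forall x, overlap d x = 0%N \/ overlap d x = h} ->
  [\/ {in B, forall x, overlap d x = 0%N},
      exists x, [/\ x \in B, overlap d x = h
                  & {in B, forall y, y != x -> overlap d y = 0%N}]
    | exists x y, [/\ x \in B, y \in B, x != y & d = x + y]].
Proof.
move=> BB dT tB; have [wB dB sB] := block_familyP _ BB.
have [/exists_inP[x xB /eqP dx]|no] := boolP [exists x in B, overlap d x == h];
  last first.
  constructor 1 => x xB; case: (tB x xB) => // dx.
  by case/exists_inP: no; exists x; rewrite ?dx.
have [/exists_inP[y]|no] := boolP [exists y in B :\ x, overlap d y == h];
  last first.
  constructor 2; exists x; split=> // y yB yx; case: (tB y yB) => // dy.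
  by case/exists_inP: no; exists y; rewrite ?in_setD1 ?yx ?dy.
rewrite in_setD1 => /andP[yx yB] /eqP dy; constructor 3.
have xy : x != y by rewrite eq_sym.
have xyT := sB x y xB yB xy; exists x, y; split=> //.
have ov : overlap d (x + y) = t.
  rewrite overlapDr //; first by rewrite dx dy -h_half; clear; lia.
  by apply: contra xy => /(dB _ _ xB yB)/eqP.
apply: row2_eq => // i; apply/idP/idP.
  by apply: overlap_eq_weight; rewrite overlapC ov (minword_weight dT).
by apply: overlap_eq_weight; rewrite ov (minword_weight xyT).
Qed.

Hypothesis W_weights_attained :
  forall j, (j <= R)%N -> exists2 u, u \in W & weight u = (j * t)%N.

(* A minimal word meeting all four blocks in h/2 points lies in their union, and
   forces every other minimal word to lie there too. *)
Lemma half_overlap_case B d : block_family h B -> (3 < #|B|)%N -> d \in T ->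
  {in B, forall x, 2 * overlap d x = h}%N ->
  [/\ R = 2%N, const_mx 1 \in W, weight (const_mx 1 : 'rV[F]_n) = (2 * t)%N
    & forall w, w \in W -> w != 0 -> w != const_mx 1 -> weight w = t].
Proof.
move=> BB B3 dT dh; have [wB dB sB] := block_familyP _ BB.
pose u := \sum_(x in B) x.
have half_sum e : {in B, forall x, 2 * overlap e x = h}%N ->
    (2 * overlap e u = #|B| * h)%N.
  move=> eh; rewrite block_sum_overlap // big_distrr /= (eq_bigr (fun=> h)) //.
  by rewrite sum_nat_const.
(* [#|B| * h] is twice the overlap of [d] with the union, hence at most 2 t = 4 h. *)
have B4 : #|B| = 4%N.
  apply/eqP; rewrite eqn_leq B3 andbT -(leq_pmul2r h_gt0) -(half_sum d dh).
  have := overlap_le_l d u; rewrite (minword_weight dT) -h_half; clear; lia.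
have half_sub e : e \in T -> {in B, forall x, 2 * overlap e x = h}%N ->
    forall i, e 0 i != 0 -> u 0 i != 0.
  move=> eT /half_sum eu; apply: overlap_eq_weight.
  by rewrite overlapC (minword_weight eT) -h_half; move: eu; rewrite B4; clear; lia.
have coord e i : e 0 i != 0 -> u 0 i != 0 -> exists2 x,
  x \in B & (0 < overlap e x)%N.
  move=> ei; rewrite block_sum_coord // => /exists_inP[x xB xi]; exists x => //.
  by rewrite overlap_gt0; apply/meetsP; exists i.
(* [d] lies in the union of the blocks, where [e] coincides with [x]. So [e] and [d] would share h /
   2 coordinates, whereas two words of T share 0, h or 2 h. *)
have no_single e x : e \in T -> x \in B -> overlap e x = h ->
    {in B, forall y, y != x -> overlap e y = 0%N} -> False.
  move=> eT xB ex e0; have xe i : x 0 i != 0 -> e 0 i != 0.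
    by apply: overlap_eq_weight; rewrite ex wB.
  have ed : overlap e d = overlap d x.
    apply: eq_card => i; rewrite !inE; apply/andP/andP => [[ei di]|[di xi]];
      last first.
      by rewrite xe.
    split=> //; have := half_sub d dT dh i di.
    rewrite block_sum_coord // => /exists_inP[y yB yi].
    have [<-//|yx] := eqVneq y x.
    have /eqP := e0 y yB yx; rewrite overlap_eq0 => /existsPn/(_ i).
    by rewrite ei yi.
  have := dh x xB; rewrite -ed; have := h_gt0.
  by case: (overlap_values eT dT) => ->; clear; lia.
have Bgt2 : (2 < #|B|)%N by apply: ltnW.
have pair_sub x y i : x \in B -> y \in B -> (x + y) 0 i != 0 -> u 0 i != 0.
  move=> xB yB; rewrite mxE field2_add_neq0 // block_sum_coord // => xyi.
  apply/exists_inP; case: (boolP (x 0 i != 0)) xyi => [xi _|_ yi];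
    first by exists x.
  by exists y.
have inside e : e \in T -> forall i, e 0 i != 0 -> u 0 i != 0.
  move=> eT; case: (block_types BB Bgt2 eT) => [eh|]; first exact: half_sub.
  case/(block_trichotomy BB eT) => [e0|[x [xB ex e0]]|[x [y [xB yB xy ->]]] i].
  (* Here [e] misses every block. A word [b] linking it to [x + y] leaves the union, and each
     possible type of [b] relative to the blocks contradicts this or its meeting [x + y]. *)
  - have /card_gt1P[x [y [xB yB xy]]] := ltnW Bgt2.
    have nm : ~~ meets x y by apply: contra xy => /(dB _ _ xB yB)/eqP.
    have nxe : ~~ meets (x + y) e.
      by rewrite -overlap_eq0 overlapC overlapDr // !e0.
    have [b [bT ab be]] := disjoint_link (sB _ _ xB yB xy) eT nxe.
    have out : ~ (forall i, b 0 i != 0 -> u 0 i != 0).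
      move=> bu; have [i bi ei] := meetsP _ _ be.
      by have [z zB] := coord e i ei (bu i bi); rewrite e0.
    case: (block_types BB Bgt2 bT) => [bh|]; first by case: out; apply: half_sub.
    case/(block_trichotomy BB bT) => [bB|[z [zB bz bB]]|[z [w [zB wB' zw bE]]]].
    + by move: ab; rewrite meetsC -overlap_gt0 overlapDr // !bB.
    + by case: (no_single b z).
    by case: out => i; rewrite bE; apply: pair_sub.
  - by case: (no_single e x).
  exact: pair_sub.
have u1 : u = const_mx 1.
  apply/rowP=> i; rewrite [RHS]mxE; apply: field2_neq0 => //.
  by have [w wT wi] := T_cover i; apply: inside wi.
have wu : weight u = (2 * t)%N.
  have -> : weight u = overlap u u by apply: eq_card => i; rewrite !inE andbb.
  rewrite block_sum_overlap // (eq_bigr (fun=> h)) => [|x xB].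
    by rewrite sum_nat_const B4 -h_half; clear; lia.
  rewrite -(wB x xB) u1; apply: eq_card => i; rewrite !inE mxE oner_eq0.
  by [].
(* The four blocks group into two pairs, each with its sum in T. *)
have uW : u \in W.
  have /card_gt1P[x [y [xB yB xy]]] := ltnW Bgt2.
  have yBx : y \in B :\ x by rewrite in_setD1 eq_sym xy.
  have : (1 < #|(B :\ x) :\ y|)%N.
    by move: B3; rewrite (cardsD1 x) xB (cardsD1 y (B :\ x)) yBx.
  case/card_gt1P=> z [w [zB wB' zw]].
  have wBz : w \in (B :\ x) :\ y :\ z by rewrite in_setD1 eq_sym zw.
  have : #|(B :\ x) :\ y :\ z :\ w| = 0%N.
    move: B4; rewrite (cardsD1 x) xB (cardsD1 y (B :\ x)) yBx.
    by rewrite (cardsD1 z (_ :\ y)) zB (cardsD1 w (_ :\ z)) wBz; clear; lia.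
  move/eqP; rewrite cards_eq0 => /eqP E0.
  rewrite /u (big_setD1 x) //= (big_setD1 y) //= (big_setD1 z) //= (big_setD1 w) //=.
  rewrite E0 big_set0 addr0 (addrA x y); move: zB wB'; rewrite !in_setD1.
  case/and3P=> _ _ zB /and3P[_ _ wB'].
  by apply: codeD => //; apply: (@minword_in _ _ t); apply: sB.
have wle w : (weight w <= 2 * t)%N.
  by rewrite -wu u1; apply/subset_leq_card/subsetP=> i; rewrite !inE mxE oner_eq0.
have R2 : R = 2%N.
  apply/eqP; rewrite eqn_leq; apply/andP; split.
    have [w _ wR] := W_weights_attained (leqnn R).
    by rewrite -(leq_pmul2r t_gt0) -wR.
  have [j jR /eqP] := W_weights uW; rewrite wu eqn_pmul2r // => /eqP j2.
  by rewrite j2.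
rewrite -u1; split=> // w wW w0 wu1; have [j jR wj] := W_weights wW.
have wn0 : weight w != 0%N by rewrite weight_eq0.
case: j jR wj wn0 => [|[|j]] jR wj; rewrite wj ?mul1n // => _.
case/eqP: wu1; apply: row2_eq => // i.
have ww : weight w = (2 * t)%N.
  apply/eqP; rewrite eqn_leq wle wj leq_pmul2r //.
have u_i : u 0 i != 0 by rewrite u1 mxE oner_eq0.
rewrite u_i; apply: (@overlap_eq_weight _ _ w u _ i u_i).
rewrite wu -ww; apply: eq_card => k; rewrite !inE u1 mxE oner_eq0 andbT //.
Qed.

Hypothesis no_half : forall B d, block_family h B -> (3 < #|B|)%N -> d \in T ->
  ~ {in B, forall x, 2 * overlap d x = h}%N.

(** In a maximal family no word of T contains one block and misses the others, by [block_extend]. A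
    word missing all blocks would be linked to some [x + y] by a sum of two blocks, which cannot
    meet it. *)
Lemma exists_full_block_family : exists B, [/\ block_family h B, (3 < #|B|)%N
  & forall d, d \in T -> exists x y, [/\ x \in B, y \in B, x != y & d = x + y]].
Proof.
have [B1 B1B B13] := exists_block_family4.
have [B /maxsetP[BB Bmax] B1sub] := maxset_exists (P := block_family h) B1B.
have B3 : (3 < #|B|)%N by apply: leq_trans B13 (subset_leq_card B1sub).
have Bgt2 : (2 < #|B|)%N by apply: ltnW.
have [wB dB sB] := block_familyP _ BB.
have types e : e \in T -> {in B, forall x, overlap e x = 0%N \/ overlap e x = h}.
  by move=> eT; case: (block_types BB Bgt2 eT) => // /(no_half BB B3 eT).
have no_single e x : e \in T -> x \in B -> overlap e x = h ->
    {in B, forall y, y != x -> overlap e y = 0%N} -> False.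
  move=> eT xB ex e0; have := Bmax _ (block_extend BB eT xB ex e0) (subsetUr _ _).
  move/setP/(_ (e + x)); rewrite in_setU1 eqxx /= => /esym exB.
  have ne : e + x != x by rewrite -subr_eq0 addrK (minword_neq0 t_gt0 eT).
  have sub i : (e + x) 0 i != 0 -> e 0 i != 0.
    have := @overlap_eq_weight _ _ e x (etrans ex (esym (wB _ xB))) i.
    rewrite mxE field2_add_neq0 //.
    by case: (e 0 i != 0); case: (x 0 i != 0) => // /(_ isT).
  have ov : overlap e (e + x) = weight (e + x).
    apply: eq_card => i; rewrite !inE andb_idl //; exact: sub.
  by have := e0 _ exB ne; rewrite ov wB //; have := h_gt0; clear; lia.
exists B; split=> // d dT.
case: (block_trichotomy BB dT (types d dT)) => [d0|[x [xB dx d0]]|//]; last first.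
  by case: (no_single d x).
have /card_gt1P[x [y [xB yB xy]]] := ltnW Bgt2.
have nm : ~~ meets x y by apply: contra xy => /(dB _ _ xB yB)/eqP.
have nxd : ~~ meets (x + y) d by rewrite -overlap_eq0 overlapC overlapDr // !d0.
have [b [bT ab bd]] := disjoint_link (sB _ _ xB yB xy) dT nxd.
case: (block_trichotomy BB bT (types b bT)) =>
  [bB|[z [zB bz bB]]|[z [w [zB wB' zw bE]]]].
- by move: ab; rewrite meetsC -overlap_gt0 overlapDr // !bB.
- by case: (no_single b z).
have nzw : ~~ meets z w by apply: contra zw => /(dB _ _ zB wB')/eqP.
by move: bd; rewrite bE meetsC -overlap_gt0 overlapDr // !d0.
Qed.

(** The rows of [M] are the blocks. Multiplying by [[I | 1]] adds the last block to each of the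
    others, and these sums generate all pairwise sums. *)
Lemma even_weight_case : exists r (M : 'M[F]_(r + 1, n)),
  [/\ (1 < r)%N, forall v : 'rV_(r + 1), weight (v *m M) = (h * weight v)%N,
      forall i, row i (repetition_mx F r *m M) \in W
    & forall w, w \in W -> (w <= repetition_mx F r *m M)%MS].
Proof.
have [B [BB B3 TB]] := exists_full_block_family;
  have [wB dB sB] := block_familyP _ BB.
pose r := (#|B|.-1)%N; have rE : #|B| = (r + 1)%N by rewrite /r; move: B3; clear;
  lia.
pose x (i : 'I_(r + 1)) : 'rV[F]_n := enum_val (cast_ord (esym rE) i).
have xB i : x i \in B by apply: enum_valP.
have x_inj : injective x by move=> i j /enum_val_inj/cast_ord_inj.
pose M : 'M[F]_(r + 1, n) := \matrix_i x i.
have mulM (v : 'rV_(r + 1)) : v *m M = \sum_i v 0 i *: x i.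
  by rewrite mulmx_sum_row; apply: eq_bigr => i _; rewrite rowK.
exists r, M; split; first by rewrite /r; move: B3; clear; lia.
- move=> v; rewrite mulM weight_sum_disjoint => [|i j m].
    rewrite weight_sum big_distrr /=; apply: eq_bigr => i _.
    by have [->|v0] := eqVneq (v 0 i) 0;
      rewrite ?scale0r ?weight0 ?muln0 // weightZ // wB // muln1.
  apply/x_inj/dB => //; have [k] := meetsP _ _ m; rewrite !mxE !mulf_eq0 !negb_or.
  by case/andP=> _ xi /andP[_ xj]; apply/meetsP; exists k.
- move=> i; rewrite row_mul mulM.
  have -> : \sum_j row i (repetition_mx F r) 0 j *: x j = x (lshift 1 i) + x (rshift r ord0).
    rewrite big_split_ord /= big_ord1; congr (_ + _); last first.
      by rewrite mxE row_mxEr mxE scale1r.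
    rewrite (bigD1 i) //= mxE row_mxEl mxE eqxx scale1r big1 ?addr0 // => j ji.
    by rewrite mxE row_mxEl mxE eq_sym (negbTE ji) scale0r.
  apply: (@minword_in _ _ t); apply: sB => //; rewrite (inj_eq x_inj).
  by rewrite -val_eqE /= addn0 ltn_eqF.
move=> w wW; pose S := [set w : 'rV[F]_n | (w <= repetition_mx F r *m M)%MS].
suff /subsetP/(_ w wW) : W \subset S by rewrite in_set.
apply: T_generates.
  split=> [|l u v]; rewrite !in_set ?sub0mx // => uA vA.
  by rewrite addmx_sub ?scalemx_sub.
apply/subsetP=> d /TB[y [z [yB zB yz ->]]]; rewrite in_set.
have idx y' : y' \in B -> exists i, y' = x i.
  move=> yB'; exists (cast_ord rE (enum_rank_in yB' y')).
  by rewrite /x cast_ordK enum_rankK_in.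
have [i yi] := idx y yB; have [j zj] := idx z zB.
pose v : 'rV[F]_(r + 1) := delta_mx 0 i + delta_mx 0 j.
have vM : v *m M = y + z by rewrite mulmxDl -!rowE !rowK yi zj.
have sv : \sum_k v 0 k = 0.
  have sd k : \sum_l (delta_mx 0 k : 'rV[F]_(r + 1)) 0 l = 1.
    rewrite (bigD1 k) //= mxE !eqxx big1 ?addr0 // => l lk.
    by rewrite mxE eqxx (negbTE lk).
  under eq_bigr => k _ do rewrite mxE.
  by rewrite big_split /= !sd -{1}[1](field2_opp F2) addNr.
(* A row [v] with coordinate sum 0 is its first r coordinates times [[I | 1]]. *)
clearbody v; rewrite -vM; apply/submxP; exists (lsubmx v); rewrite mulmxA;
  congr (_ *m _).
rewrite mul_mx_row mulmx1 -[LHS]hsubmxK; congr row_mx.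
apply/rowP=> k; rewrite !mxE ord1.
move: sv; rewrite big_split_ord /= big_ord1 => /eqP;
  rewrite addr_eq0 eq_sym eqr_oppLR => /eqP->.
rewrite field2_opp //; apply: eq_bigr => l _; by rewrite !mxE mulr1.
Qed.

End BlockFamilies.

(** * Identification of the binary codes *)

Lemma multiplicity_row1 (F : finFieldType) (r m : nat) (B : 'M[F]_(r, m)) :
  #|F| = 2%N -> (forall j, row j B^T != 0) ->
  injective (fun j => row j B^T) -> forall j, multiplicity B (row j B^T) = 1%N.
Proof.
move=> F2 B0 Binj j; apply/eqP/cards1P; exists j; apply/setP=> i.
rewrite in_set in_set1; apply/existsP/eqP => [[a /eqP e]|->]; last first.
  by exists 1; rewrite scale1r.
apply: Binj => /=; rewrite -e; case: (field2_cases F2 a) e => ->;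
  last by rewrite scale1r.
by rewrite scale0r => e; have := B0 j; rewrite -e eqxx.
Qed.

(** * Weights of binary simplex and first-order Reed-Muller codes *)

Section BinaryHamming.
Variables (F : finFieldType) (r m : nat) (H : 'M[F]_(r, m)).
Hypothesis F2 : #|F| = 2%N.
Hypothesis H_hamming : hamming_mx H.
Hypothesis H_mult : forall x, x != 0 -> multiplicity H x = 1%N.

Lemma hamming_row_neq0 j : row j H^T != 0.
Proof. by have [h _] := H_hamming; rewrite -tr_col trmx_eq0. Qed.

Lemma hamming_row_inj : injective (fun j => row j H^T).
Proof.
move=> i j /= e; have /eqP/cards1P[k /setP hk] := H_mult (hamming_row_neq0 j).
have mem l : row l H^T = row j H^T -> l = k.
  move=> el; apply/set1P; rewrite -hk inE; apply/existsP.
  by exists 1; rewrite scale1r el.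
by rewrite (mem i e) (mem j erefl).
Qed.

Lemma hamming_rows : [set row j H^T | j : 'I_m] = [set~ 0].
Proof.
apply/setP=> x; rewrite !inE; apply/imsetP/idP => [[j _ ->]|x0].
  exact: hamming_row_neq0.
have : (0 < multiplicity H x)%N by rewrite H_mult.
case/card_gt0P=> j; rewrite inE => /existsP[a /eqP ax]; exists j => //.
case: (field2_cases F2 a) ax => -> ax; last by rewrite -ax scale1r.
by rewrite -ax scale0r eqxx in x0.
Qed.

Lemma hamming_length : m.+1 = (2 ^ r)%N.
Proof.
have := card_imset (mem 'I_m) hamming_row_inj; rewrite -/(imset _ _).
have -> : [set row j H^T | j in 'I_m] = [set~ 0] by rewrite -hamming_rows.
rewrite cardsC1 card_mx mul1n F2 card_ord => <-.
by rewrite prednK // expn_gt0.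
Qed.

(** The columns are all nonzero vectors, so the weight counts the [x] with [dot v x != 0].
    Translation by a vector not orthogonal to [v] exchanges these with the others. *)
Lemma hamming_weight (v : 'rV_r) : v != 0 -> (2 * weight (v *m H) = m.+1)%N.
Proof.
move=> v0; rewrite hamming_length.
have -> : weight (v *m H) = #|[set x | dot v x != 0]|.
  rewrite /weight -(card_imset _ hamming_row_inj); apply: eq_card => x.
  rewrite [RHS]inE; apply/imsetP/idP => [[j]|vx].
    by rewrite inE mulmx_tr_dot => jv ->.
  have : x \in [set~ 0] by rewrite in_setC1; apply: contraNneq vx => ->;
    rewrite dot0r.
  rewrite -hamming_rows => /imsetP[j _ xj]; exists j => //.
  by rewrite inE mulmx_tr_dot -xj.
have [i vi] := rV0Pn _ v0; pose x0 : 'rV[F]_r := delta_mx 0 i.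
have vx0 : dot v x0 = 1 by rewrite dot_delta; apply: field2_neq0.
have -> : (2 ^ r = #|{: 'rV[F]_r}|)%N by rewrite card_mx mul1n F2.
rewrite -(cardsC [set x | dot v x != 0]) mul2n -addnn; congr (_ + _)%N.
rewrite -(card_imset _ (addIr x0)); apply: eq_card => x.
rewrite in_setC inE negbK; apply/imsetP/eqP => [[y]|vx].
  rewrite inE => /(field2_neq0 F2) vy ->.
  by rewrite dotDr vy vx0 -{1}[1](field2_opp F2) addNr.
exists (x - x0); last by rewrite subrK.
by rewrite inE dotDr vx dotNr vx0 add0r oppr_eq0 oner_eq0.
Qed.

Definition extended_mx : 'M[F]_(r + 1, m + 1) :=
  col_mx (row_mx H 0) (const_mx 1).

Lemma row_extended_mx_l j :
  row (lshift 1 j) extended_mx^T = row_mx (row j H^T) (const_mx 1).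
Proof.
apply/rowP=> i; rewrite mxE mxE /extended_mx; case: (split_ordP i) => k ->.
  by rewrite col_mxEu !row_mxEl !mxE.
by rewrite col_mxEd row_mxEr !mxE.
Qed.

Lemma row_extended_mx_r :
  row (rshift m ord0) extended_mx^T = row_mx 0 (const_mx 1).
Proof.
apply/rowP=> i; rewrite mxE mxE /extended_mx; case: (split_ordP i) => k ->.
  by rewrite col_mxEu row_mxEr row_mxEl !mxE.
by rewrite col_mxEd row_mxEr !mxE.
Qed.

Lemma row_extended_mx_neq0 j : row j extended_mx^T != 0.
Proof.
apply/rV0Pn; exists (rshift r ord0); rewrite mxE mxE col_mxEd mxE.
exact: oner_neq0.
Qed.

Lemma row_extended_mx_inj : injective (fun j => row j extended_mx^T).
Proof.
move=> i j /=; case: (split_ordP i) => k ->; case: (split_ordP j) => l ->.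
- by rewrite !row_extended_mx_l => /eq_row_mx[/hamming_row_inj->].
- rewrite ord1 row_extended_mx_l row_extended_mx_r => /eq_row_mx[e _].
  by have := hamming_row_neq0 k; rewrite e eqxx.
- rewrite ord1 row_extended_mx_l row_extended_mx_r => /eq_row_mx[e _].
  by have := hamming_row_neq0 l; rewrite -e eqxx.
by rewrite !ord1.
Qed.

Lemma parity_check_extended : parity_check extended_mx (parity_extension (nullsp H)).
Proof.
have key (y : 'rV[F]_m) (z : 'rV[F]_1) :
    (row_mx y z \in nullsp extended_mx)
      = (y \in nullsp H) && (z == const_mx (\sum_i y 0 i)).
  rewrite !inE tr_row_mx mul_col_mx mul_row_col mul0mx addr0 col_mx_eq0.
  congr (_ && _).
  have -> : const_mx 1 *m col_mx y^T z^T = const_mx (\sum_i y 0 i + z 0 0) :> 'M_1.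
    apply/matrixP=> k l; rewrite mxE [RHS]mxE big_split_ord /= big_ord1 col_mxEd.
    rewrite !mxE mul1r !ord1; congr (_ + _); apply: eq_bigr => p _.
    by rewrite col_mxEu !mxE mul1r.
  apply/eqP/eqP => [/matrixP/(_ 0 0)|->]; last first.
    by apply/matrixP=> k l; rewrite !mxE -[X in _ + X](field2_opp F2) subrr.
  rewrite !mxE => /eqP; rewrite addrC addr_eq0 (field2_opp F2) => /eqP zE.
  by apply/matrixP=> k l; rewrite !ord1 zE mxE.
rewrite /parity_check; apply/setP=> x; rewrite -[x]hsubmxK key.
apply/imsetP/andP => [[y yH /eq_row_mx[-> ->]]|[yH /eqP ->]]; first by [].
by exists (lsubmx x).
Qed.

Lemma weight_row_mx p (u : 'rV[F]_m) (v : 'rV[F]_p) :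
  weight (row_mx u v) = (weight u + weight v)%N.
Proof.
rewrite !weight_sum big_split_ord; congr (_ + _)%N; apply: eq_bigr => i _.
  by rewrite row_mxEl.
by rewrite row_mxEr.
Qed.

Lemma weight_addr_const p (u : 'rV[F]_p) :
  (weight (u + const_mx 1%R) + weight u = p)%N.
Proof.
rewrite !weight_sum -big_split /= -[RHS]card_ord -sum1_card.
apply: eq_bigr => i _; rewrite !mxE field2_add_neq0 // oner_eq0.
by case: (u 0 i != 0).
Qed.

Lemma extended_weight (v : 'rV_r) (l : 'rV_1) :
  weight (row_mx v l *m extended_mx) =
  (if l == 0%R then weight (v *m H) else m.+1 - weight (v *m H))%N.
Proof.
rewrite mul_row_col mul_mx_row mulmx0.
have [->|l0] := eqVneq l 0;
  first by rewrite mul0mx addr0 weight_row_mx weight0 addn0.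
have -> : l *m const_mx 1 = const_mx 1 :> 'rV[F]_(m + 1).
  apply/rowP=> i; rewrite !mxE big_ord1 mxE mulr1; apply: field2_neq0 => //.
  by apply: contra l0 => /eqP l0; apply/eqP/rowP=> k; rewrite ord1 l0 mxE.
have := weight_addr_const (row_mx (v *m H) (0 : 'rV_1)).
rewrite weight_row_mx weight0 addn0 => e.
by rewrite -[m.+1]addn1 -[X in (X - _)%N]e addnK.
Qed.

End BinaryHamming.

(** Both W and the row space of the extended matrix have three weights: 0, that of the all-one word,
    and half of it. With the all-one word as last basis vector on both sides, the weights are
    proportional. *)
Lemma extended_hamming_case (F : finFieldType) (n t : nat) (C : {set 'rV[F]_n}) :
  #|F| = 2%N -> linear_code C -> completely_regular C ->
  (forall i, delta_mx 0 i \notin C) -> (0 < t)%N ->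
  const_mx 1 \in dual_code C -> weight (const_mx 1 : 'rV[F]_n) = (2 * t)%N ->
  (forall w, w \in dual_code C -> w != 0 -> w != const_mx 1 -> weight w = t) ->
  (exists2 w, w \in dual_code C & weight w = t) ->
  exists (m r : nat) (D : {set 'rV[F]_m}) (E : 'M[F]_(r, m + 1)),
    [/\ hamming_code D, parity_check E (parity_extension D)
      & code_equiv C (nullsp (hcopies (gamma C 1) E))].
Proof.
move=> F2 C_linear C_cr C_delta t0 oneW onew Ww [w0 w0W w0t].
pose one : 'rV[F]_n := const_mx 1.
have [k [M [fM WM _]]] := dual_code_basis C_linear.
(* A basis of a complement of the all-one word, followed by that word, to match the shape of
   [extended_mx]. *)
pose D := row_base (M :\: one)%MS; pose A := col_mx D one.
have oneM : (one <= M)%MS by rewrite -WM.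
have eqA : (A :=: M)%MS.
  apply: eqmx_trans (addsmx_diff_cap_eq M one).
  apply: eqmx_trans (eqmx_sym (addsmxE D one)) _.
  by apply: adds_eqmx; [exact: eq_row_base|exact/eqmx_sym/capmx_idPr].
have D1 (v : 'rV_(\rank (M :\: one))) (l : 'rV_1) : v *m D + l *m one = 0 -> v = 0 /\ l = 0.
  move=> e; have vD : v *m D = 0.
    have : (v *m D <= (M :\: one) :&: one)%MS.
      rewrite sub_capmx -(eq_row_base (M :\: one)%MS) submxMl /=.
      by rewrite -[v *m D](addrK (l *m one)) e sub0r eqmx_opp submxMl.
    by rewrite capmx_diff submx0 => /eqP.
  split; first by apply: (row_free_inj (row_base_free _)); rewrite mul0mx -/D.
  move: e; rewrite vD add0r => l0.
  have e k' : (l *m one) 0 k' = 0 by rewrite l0 mxE.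
  have [i _] : exists i, one 0 i != 0.
    by apply/rV0Pn; rewrite -weight_eq0 onew -lt0n muln_gt0.
  apply/rowP=> j; have := e i; rewrite !ord1 !mxE big_ord1 mxE mulr1.
  by move->.
have AW u : u *m A \in dual_code C by rewrite WM -eqA submxMl.
have A_neq v (l : 'rV_1) : v != 0 -> row_mx v l *m A != 0 /\ row_mx v l *m A != one.
  move=> v0; rewrite mul_row_col; split; apply: contra v0 => /eqP e.
    by have [-> _] := D1 _ _ e.
  have /D1[-> //] : v *m D + (l - 1%:M) *m one = 0.
  by rewrite mulmxBl mul1mx addrA e subrr.
have CA : C = nullsp A.
  apply: parity_check_of_dual => // [i|w]; last by rewrite WM -eqA.
  by rewrite rowE AW.
have oneE (l : 'rV_1) : l != 0 -> l *m one = one.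
  move=> l0; apply/rowP=> i; rewrite !mxE big_ord1 mxE mulr1;
    apply: field2_neq0 => //.
  by apply: contra l0 => /eqP l0; apply/eqP/rowP=> j; rewrite ord1 l0 mxE.
have r0 : (0 < \rank (M :\: one))%N.
  have : (w0 <= A)%MS by rewrite eqA -WM.
  case/submxP=> u; rewrite -[u]hsubmxK.
  have [v0 e|] := eqVneq (lsubmx u) 0; last first.
    by case/rV0Pn=> p _ _; apply: leq_ltn_trans (leq0n _) (ltn_ord p).
  move: w0t; rewrite e v0 mul_row_col mul0mx add0r.
  have [->|/oneE->] := eqVneq (rsubmx u) 0.
    by rewrite mul0mx weight0; move: t0; clear; lia.
  by rewrite onew; move: t0; clear; lia.
have [m [H [hH H1]]] := exists_hamming_mx F (\rank (M :\: one)%MS).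
pose E := extended_mx H.
exists m, (\rank (M :\: one) + 1)%N, (nullsp H), E; split.
- by exists (\rank (M :\: one)), H.
- exact: parity_check_extended.
rewrite [in X in code_equiv X _]CA; move: C_cr C_delta; rewrite CA => A_cr A_delta.
(* The factors are the weights of the all-one word: [m.+1] for the extended matrix, [2 * t] for
   W. *)
apply: (code_equiv_hcopies A_cr A_delta (c := m.+1) (d := (2 * t)%N)).
- by rewrite muln_gt0.
- by rewrite addn1.
- exact: row_extended_mx_neq0.
- apply: multiplicity_row1 => //; first exact: row_extended_mx_neq0.
  exact: (row_extended_mx_inj hH H1).
move=> u; rewrite -[u]hsubmxK extended_weight //.
have [v0|v0] := eqVneq (lsubmx u) 0; last first.
  have [n0 n1] := A_neq _ (rsubmx u) v0; rewrite Ww //.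
  have := hamming_weight F2 hH H1 v0.
  move: (weight _) => k' e.
  suff -> : (if rsubmx u == 0%R then k' else m.+1 - k')%N = k' by rewrite -e mulnAC.
  by case: ifP => // _; move: e; clear; lia.
rewrite v0 mul0mx weight0 subn0 mul_row_col mul0mx add0r.
have [->|/oneE->] := eqVneq (rsubmx u) 0; first by rewrite mul0mx weight0 !muln0.
by rewrite onew mulnC.
Qed.

(** * The coset graph and the folded cube *)

Section FoldedCube.
Variables (F : finFieldType) (r n : nat) (A : 'M[F]_(r, n)).
Hypothesis F2 : #|F| = 2%N.
Hypothesis A_free : row_free A.

Lemma syndrome_surj p (B : 'M[F]_(r, p)) : row_free B ->
  forall s : 'rV_r, exists x, x *m B^T = s.
Proof.
move=> fB s; have : row_full B^T by rewrite /row_full mxrank_tr.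
by move/row_fullP=> [X XB]; exists (s *m X); rewrite -mulmxA XB mulmx1.
Qed.

(** A step in the Hamming graph changes the syndrome by a multiple of a column, so the coset graph
    is a Cayley graph on syndromes. *)
Lemma adjacent_syndromes p (B : 'M[F]_(r,
  p)) (s s' : 'rV_r) : row_free B -> s != s' ->
  (exists x y, [/\ x *m B^T = s, y *m B^T = s' & hamming_adj x y])
  <-> (0 < multiplicity B (s - s'))%N.
Proof.
move=> fB ss'; split=> [[x [y [<- <- ]]]|/card_gt0P[i]].
  rewrite /hamming_adj hdistE => /weight1P[i [a [a0 e]]].
  apply/card_gt0P; exists i; rewrite inE; apply/existsP; exists a.
  by rewrite -mulmxBl e -scalemxAl syndrome_delta.
rewrite inE => /existsP[a /eqP e]; have [x xs] := syndrome_surj fB s.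
exists x, (x - a *: delta_mx 0 i); split=> //.
  by rewrite mulmxBl -scalemxAl syndrome_delta e xs subKr.
rewrite /hamming_adj hdistE subKr; apply/weight1P; exists i, a; split=> //.
by apply: contraNneq ss' => a0; rewrite -subr_eq0 -e a0 scale0r.
Qed.

Local Notation rep := (repetition_mx F r).

Definition of_bits m (z : 'rV[bool]_m) : 'rV[F]_m := map_mx (fun b : bool =>
  b%:R) z.
Definition to_bits m (v : 'rV[F]_m) : 'rV[bool]_m := map_mx (fun x => x != 0) v.

Lemma of_bitsK m (z : 'rV[bool]_m) : to_bits (of_bits z) = z.
Proof.
apply/rowP=> i; rewrite !mxE; case: (z 0 i); rewrite ?oner_eq0 ?eqxx //.
Qed.

Lemma to_bitsK m (v : 'rV[F]_m) : of_bits (to_bits v) = v.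
Proof.
apply/rowP=> i; rewrite !mxE.
by case: (field2_cases F2 (v 0 i)) => ->; rewrite ?eqxx ?oner_eq0.
Qed.

Lemma of_bits_antipode m (z : 'rV[bool]_m) :
  of_bits (antipode z) = of_bits z + const_mx 1.
Proof.
apply/rowP=> i; rewrite !mxE; case: (z 0 i) => /=; last by rewrite add0r.
by rewrite -[X in _ + X](field2_opp F2) subrr.
Qed.

Lemma hamming_adj_of_bits m (z z' : 'rV[bool]_m) :
  hamming_adj (of_bits z) (of_bits z') = hamming_adj z z'.
Proof.
congr (_ == _); apply: eq_card => i; rewrite !inE !mxE.
by case: (z 0 i); case: (z' 0 i); rewrite ?eqxx ?oner_eq0 // eq_sym oner_eq0.
Qed.

Lemma rep_free : row_free rep.
Proof.
apply/row_freeP; exists (col_mx 1%:M 0).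
by rewrite mul_row_col mulmx1 mulmx0 addr0.
Qed.

Lemma rep_syndrome (v : 'rV_(r + 1)) i :
  (v *m rep^T) 0 i = v 0 (lshift 1 i) + v 0 (rshift r ord0).
Proof.
rewrite tr_row_mx trmx1 trmx_const -{1}[v]hsubmxK mul_row_col mulmx1.
by rewrite !mxE big_ord1 !mxE mulr1.
Qed.

Lemma rep_syndrome_eq (z z' : 'rV[bool]_(r + 1)) :
  of_bits z *m rep^T = of_bits z' *m rep^T <-> z' \in [set z; antipode z].
Proof.
rewrite in_set2; split=> [e|/orP[/eqP->|/eqP->] //]; last first.
  apply/rowP=> i; rewrite of_bits_antipode !rep_syndrome !mxE.
  by rewrite addrACA -[X in _ + (X + _)](field2_opp F2) addNr addr0.
pose d := of_bits z + of_bits z'.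
have zd : of_bits z' = of_bits z + d by rewrite addrA row2_addxx // add0r.
have dc i : d 0 i = d 0 (rshift r ord0).
  case: (split_ordP i) => k ->; last by rewrite ord1.
  apply/eqP; rewrite -subr_eq0 (field2_opp F2) -rep_syndrome mulmxDl -e.
  by rewrite row2_addxx // mxE.
have := zd; case: (field2_cases F2 (d 0 (rshift r ord0))) => dl.
  have -> : d = 0 by apply/rowP=> i; rewrite dc dl mxE.
  by rewrite addr0 => /(can_inj (@of_bitsK _))->; rewrite eqxx.
have -> : d = const_mx 1 by apply/rowP=> i; rewrite dc dl mxE.
by rewrite -of_bits_antipode => /(can_inj (@of_bitsK _))->; rewrite eqxx orbT.
Qed.

Hypothesis A_rep : forall s, s != 0 ->
  (0 < multiplicity A s)%N = (0 < multiplicity rep s)%N.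

Local Notation C := (nullsp A).

(** The default only matters for the empty set, which is not a coset. *)
Definition coset_syndrome (X : {set 'rV[F]_n}) : 'rV[F]_r :=
  odflt 0 [pick x in X] *m A^T.

Lemma mem_coset X x : X \in cosets C -> (x \in X) = (x *m A^T == coset_syndrome X).
Proof.
case/imsetP=> y _ ->.
have mem z : (z \in [set y + c | c in C]) = (z *m A^T == y *m A^T).
  rewrite -subr_eq0 -mulmxBl -nullspE; apply/imsetP/idP => [[c cC ->]|zC].
    by rewrite addrC addKr.
  by exists (z - y); rewrite // addrC subrK.
rewrite /coset_syndrome; case: pickP => [z|/(_ y)]; last by rewrite mem eqxx.
by rewrite /= !mem => /eqP->.
Qed.

(** Antipodal pairs are the cosets of the binary repetition code. Both graphs are thus Cayley graphs
    on the same syndromes, and [A_rep] says that their connection sets agree. *)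
Lemma folded_cube_iso :
  graph_iso (cosets C) (@coset_adj F n) (antipodal_pairs (r + 1)) (@folded_cube_adj (r + 1)).
Proof.
pose f X := [set z : 'rV[bool]_(r + 1) | of_bits z *m rep^T == coset_syndrome X].
have f_inh X : exists z, z \in f X.
  have [v vs] := syndrome_surj rep_free (coset_syndrome X).
  by exists (to_bits v); rewrite inE to_bitsK vs.
have fE X z : z \in f X -> f X = [set z; antipode z].
  rewrite inE => /eqP zX; apply/setP=> z'; rewrite inE -zX eq_sym.
  by apply/eqP/idP => /rep_syndrome_eq.
have f_inj : {in cosets C &, injective f}.
  move=> X Y XC YC fXY; have [z zX] := f_inh X.
  have : z \in f Y by rewrite -fXY.
  move: zX; rewrite !inE => /eqP-> /eqP sXY.
  by apply/setP=> x; rewrite !mem_coset // sXY.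
exists f; split=> //.
  apply/setP=> P; apply/imsetP/imsetP => [[X XC ->]|[z _ ->]].
    by have [z zX] := f_inh X; exists z => //; apply: fE.
  have [x xs] := syndrome_surj A_free (of_bits z *m rep^T).
  pose X := [set x + c | c in C].
  have XC : X \in cosets C by apply/imsetP; exists x.
  exists X => //; apply/esym/fE; rewrite inE -xs -mem_coset //.
  by apply/imsetP; exists 0; rewrite ?addr0 // nullspE mul0mx.
move=> X Y XC YC; rewrite /folded_cube_adj /coset_adj /quotient_adj (inj_in_eq f_inj) //.
have [->//|XY] := eqVneq X Y; rewrite /=.
have ss' : coset_syndrome X != coset_syndrome Y.
  apply: contra XY => /eqP e; apply/eqP/setP=> x.
  by rewrite !mem_coset // e.
have d0 : coset_syndrome X - coset_syndrome Y != 0 by rewrite subr_eq0.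
transitivity (0 < multiplicity rep (coset_syndrome X - coset_syndrome Y))%N.
  apply/exists_inP/idP =>
    [[z]|/(adjacent_syndromes rep_free ss')[v [v' [vX vY vv']]]].
    rewrite inE => /eqP zX /exists_inP[z']; rewrite inE => /eqP zY zz'.
    apply/(adjacent_syndromes rep_free ss').
    by exists (of_bits z), (of_bits z'); split; rewrite ?hamming_adj_of_bits.
  exists (to_bits v); first by rewrite inE to_bitsK vX.
  apply/exists_inP; exists (to_bits v'); first by rewrite inE to_bitsK vY.
  by rewrite -hamming_adj_of_bits !to_bitsK.
rewrite -A_rep //.
apply/idP/exists_inP => [/(adjacent_syndromes A_free ss')[x [y [xX yY xy]]]|[x xX]].
  exists x; first by rewrite mem_coset ?xX.
  by apply/exists_inP; exists y; rewrite // mem_coset ?yY.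
case/exists_inP=> y yY xy; apply/(adjacent_syndromes A_free ss').
by exists x, y; split=> //; apply/eqP; rewrite -mem_coset.
Qed.

End FoldedCube.

Lemma repetition_case (F : finFieldType) (n r h : nat) (C : {set 'rV[F]_n})
    (M : 'M[F]_(r + 1, n)) :
  #|F| = 2%N -> linear_code C -> completely_regular C ->
  (forall i, delta_mx 0 i \notin C) -> (1 < r)%N -> (0 < h)%N ->
  (forall v : 'rV_(r + 1), weight (v *m M) = (h * weight v)%N) ->
  (forall i, row i (repetition_mx F r *m M) \in dual_code C) ->
  (forall w, w \in dual_code C -> (w <= repetition_mx F r *m M)%MS) ->
  exists r' : nat,
    [/\ (0 < r')%N,
        code_equiv C (nullsp (hcopies (gamma C 1) (repetition_mx F r')))
      & graph_iso (cosets C) (@coset_adj F n)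
          (antipodal_pairs (r' + 1)) (@folded_cube_adj (r' + 1))].
Proof.
move=> F2 C_linear C_cr C_delta r1 h0 Mw MW WM.
pose rep := repetition_mx F r; pose A := rep *m M.
have CA : C = nullsp A by apply: parity_check_of_dual.
rewrite {}CA in C_linear C_cr C_delta MW WM *.
have Aw (u : 'rV_r) : (1 * weight (u *m A) = h * weight (u *m rep))%N.
  by rewrite mul1n /A mulmxA Mw.
have rowl j : row (lshift 1 j) rep^T = delta_mx 0 j.
  by apply/rowP=> i; rewrite mxE mxE row_mxEl !mxE eqxx eq_sym.
have rowr : row (rshift r ord0) rep^T = const_mx 1.
  by apply/rowP=> i; rewrite mxE mxE row_mxEr !mxE.
have B0 j : row j rep^T != 0.
  apply/rV0Pn; case: (split_ordP j) => k ->.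
    by rewrite rowl; exists k; rewrite mxE !eqxx oner_eq0.
  by rewrite ord1 rowr; exists (Ordinal (ltnW r1)); rewrite mxE oner_eq0.
(* With at least two rows the all-one column of [[I | 1]] differs from the unit columns, so no point
   is repeated. *)
have nconst k : delta_mx 0 k != const_mx 1 :> 'rV[F]_r.
  apply/eqP => /rowP e.
  have [l lk] : exists l : 'I_r, l != k.
    have : (1 < #|'I_r|)%N by rewrite card_ord.
    rewrite (cardD1 k) inE add1n ltnS => /card_gt0P[l].
    by rewrite !inE andbT => lk; exists l.
  by have := e l; rewrite !mxE eqxx (negbTE lk) => /esym/eqP; rewrite oner_eq0.
have B1 : forall j, multiplicity rep (row j rep^T) = 1%N.
  apply: multiplicity_row1 => // i j /=.
  case: (split_ordP i) => k ->; case: (split_ordP j) => l ->.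
  - rewrite !rowl => /rowP/(_ k); rewrite !mxE !eqxx /=.
    by case: eqP => [->//|_] /eqP; rewrite oner_eq0.
  - by rewrite ord1 rowl rowr => /eqP; rewrite (negbTE (nconst k)).
  - by rewrite ord1 rowl rowr => /esym/eqP; rewrite (negbTE (nconst l)).
  by rewrite !ord1.
have fA : row_free A.
  apply/inj_row_free => u uA; have := Aw u.
  rewrite uA weight0 mul1n => /esym/eqP; rewrite muln_eq0 (gtn_eqF h0) weight_eq0.
  by move=> /eqP ur; apply: (row_free_inj (rep_free F r)); rewrite ur mul0mx.
exists r; split; first exact: ltnW.
  by apply: (code_equiv_hcopies C_cr C_delta h0 _ B0 B1 Aw); rewrite addn1.
apply: folded_cube_iso => // s s0.
have := multiplicity_proportional Aw s0; rewrite mul1n => ->.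
by rewrite muln_gt0 h0.
Qed.

(** * Separation of the four cases *)

Theorem theorem3p16 (q n rho : nat) (F : finFieldType) (cardF : #|F| = q)
    (C : {set 'rV[F]_n}) (C_nontrivial : nontrivial C) (C_reduced : reduced C)
    (C_linear : linear_code C) (C_cr : completely_regular C)
    (C_rho : covering_radius C = rho) (t : algC)
    (C_spec : spec C =i
       [seq (n * q.-1)%:R - (q * j)%:R * t | j <- iota 0 rho.+1]) :
  [\/ q = 2%N /\
      (exists r : nat,
         [/\ (0 < r)%N,
             code_equiv C (nullsp (hcopies (gamma C 1) (repetition_mx F r)))
           & graph_iso (cosets C) (@coset_adj F n)
               (antipodal_pairs (r + 1)) (@folded_cube_adj (r + 1))]),
      rho = 1%N /\
      (exists (m r : nat) (D : {set 'rV[F]_m}) (H : 'M[F]_(r, m)),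
         [/\ hamming_code D, parity_check H D
           & code_equiv C (nullsp (hcopies (gamma C 1) H))]),
      [/\ rho = 2%N, q = 2%N
        & exists (m r : nat) (D : {set 'rV[F]_m}) (E : 'M[F]_(r, m + 1)),
            [/\ hamming_code D, parity_check E (parity_extension D)
              & code_equiv C (nullsp (hcopies (gamma C 1) E))]]
    | [/\ (2 <= rho)%N, (2 <= q)%N
        & exists (m : nat) (C1 : {set 'rV[F]_m}),
            [/\ completely_regular C1, covering_radius C1 = 1%N
              & code_equiv C (code_power rho C1)]]].
Proof.
subst q rho; set R := covering_radius C.
have [_ CT] := C_nontrivial.
have C_delta i : delta_mx 0 i \notin C by apply: reduced_delta.
have [s [s0 R0 Ws Wa]] := arithmetic_weights C_linear C_cr CT C_spec.
(* Radius 1 always gives (b), whether or not the code also has another of the forms; the rest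
   assumes radius at least 2, as (d) requires. *)
have [R1|R1] := eqVneq R 1%N.
  by constructor 2; split=> //; apply: radius1_hamming.
have R2 : (2 <= R)%N by rewrite ltn_neqAle eq_sym R1.
pose W := dual_code C; have W_linear : linear_code W := dual_linear C.
pose T := minwords s W.
have T_cover : forall i, exists2 w, w \in T & w 0 i != 0.
  exact: (minwords_cover C_linear C_cr s0 R0 Wa C_delta).
have T_gen : forall S : {set 'rV[F]_n}, linear_code S -> T \subset S -> W \subset S.
  exact: (minwords_generate C_linear C_cr s0 R0 Ws Wa C_delta).
have T_dec : forall u v, u \in W -> v \in W -> weight u = weight v ->
    #|[set b in T | u - b \in T]| = #|[set b in T | v - b \in T]|.
  by move=> u v; apply: card_sum_decomp => //; apply: weight_invariant_minwords.
have q2 : (1 < #|F|)%N := finRing_gt1 F.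
have [w1 w1T] : exists w, w \in T.
  have [w wW] := Wa 1%N R0; rewrite mul1n => ws.
  by exists w; apply/minwordP.
have n0 : (0 < n)%N.
  rewrite (leq_trans s0) // -(minword_weight w1T) -[X in (_ <= X)%N]card_ord.
  exact: max_card.
(* Transitivity of meeting is decided as a boolean, so that its failure supplies the words [a], [b],
   [c] from which the blocks are built. *)
have [|notr] := boolP [forall a in T, forall b in T, forall c in T,
    meets a b ==> meets b c ==> meets a c].
  move/forall_inP=> tr0.
  have tr : meeting_transitive s W.
    move=> a b c aT bT cT ab bc.
    have /forall_inP/(_ b bT)/forall_inP/(_ c cT) := tr0 a aT.
    by rewrite ab bc.
  have [d [A [AT Am gen]]] := transitive_components W_linear s0 Ws R0 Wa T_gen T_dec tr.
  constructor 4; split=> //.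
  have CA : C = nullsp (\mxcol_j A j).
    apply: parity_check_of_dual => // i; rewrite row_mxcol rowE.
    apply: (@minword_in _ _ s); apply: AT.
    by apply/rV0Pn; exists (tagnat.sig2 i); rewrite mxE !eqxx oner_eq0.
  have A0 : forall i, row i (\mxcol_j A j)^T != 0.
    by apply: row_nonzero => i; rewrite -CA.
  have At j (u : 'rV_d) : u != 0 -> weight (u *m A j) = s.
    by move=> u0; apply: minword_weight (AT j u u0).
  have := constant_weight_components n0 R0 s0 A0 At Am.
  by rewrite -CA.
have F2 : #|F| = 2%N.
  apply/eqP; rewrite eqn_leq q2 andbT leqNgt; apply: contra notr => F3.
  have tr := meeting_transitive_gt2 W_linear s0 Ws F3.
  apply/forall_inP=> a aT; apply/forall_inP=> b bT; apply/forall_inP=> c cT.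
  by apply/implyP=> ab; apply/implyP=> bc; apply: (tr a b c).
move: notr; rewrite negb_forall_in => /exists_inP[a aT].
rewrite negb_forall_in => /exists_inP[b bT];
  rewrite negb_forall_in => /exists_inP[c cT].
rewrite negb_imply => /andP[ab]; rewrite negb_imply => /andP[bc nac].
have ab_neq : a != b by apply: contraNneq nac => ->.
pose h := overlap a b.
have h_half : (2 * h = s)%N := overlap_half F2 W_linear s0 Ws aT bT ab_neq ab.
have h0 : (0 < h)%N by rewrite overlap_gt0.
have [/existsP[B /existsP[d /and4P[BB B3 dT /forall_inP dh]]]|nohalf] :=
  boolP [exists B : {set 'rV[F]_n}, exists d, [&& block_family s W h B,
    (3 < #|B|)%N,
    d \in T & [forall x in B, (2 * overlap d x == h)%N]]].
  have dh' : {in B, forall x, 2 * overlap d x = h}%N by move=> x /dh/eqP.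
  have [RR oneW onew Ww] := half_overlap_case F2 W_linear s0 Ws T_cover T_dec
    aT bT cT ab bc nac h_half Wa BB B3 dT dh'.
  constructor 3; split=> //.
  apply: (extended_hamming_case F2 C_linear C_cr C_delta s0 oneW onew Ww).
  by exists w1; [exact: minword_in w1T|exact: minword_weight w1T].
have no_half B d : block_family s W h B -> (3 < #|B|)%N -> d \in T ->
    ~ {in B, forall x, 2 * overlap d x = h}%N.
  move=> BB B3 dT dh; case/existsP: nohalf; exists B; apply/existsP; exists d.
  by rewrite BB B3 dT; apply/forall_inP=> x /dh->.
have [r [M [r1 Mw MW WM]]] := even_weight_case F2 W_linear s0 Ws T_gen T_dec
  aT bT cT ab bc nac h_half no_half.
constructor 1; split=> //.
exact: (repetition_case F2 C_linear C_cr C_delta r1 h0 Mw MW WM).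
Qed.
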